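(* (ZFC) Let $\kappa$ be a limit of measurable cardinals. (i) No well-ordering of $\mathcal{P}(\kappa)$ is definable by a $\Sigma_1$-formula with parameters in $H(\kappa)\cup\{\kappa,\kappa^+\}$. (ii) If $\mathrm{cof}(\kappa)>\omega$, then no injection from $\kappa^+$ into $\mathcal{P}(\kappa)$ is definable by a $\Sigma_1$-formula with parameters in $H(\kappa)\cup\{\kappa\}$.
   Context: $\Sigma_1$ refers to the Levy hierarchy of formulas of set theory. $H(\kappa)$ is the set of all sets of hereditary cardinality less than $\kappa$. A relation or function, viewed as a class $R$ of ordered pairs, is definable by a $\Sigma_1$-formula with parameters in a set $P$ if $R=\{\langle x,y\rangle\mid\varphi(x,y,p_0,\ldots,p_{n-1})\}$ (evaluated in $V$) for some $\Sigma_1$-formula $\varphi$ and $p_0,\ldots,p_{n-1}\in P$. *)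

(* Defs.v *)
(* ZFC statements are rendered as statements about all models of ZFC: a
   first-order structure for the language of set theory whose equality is
   Leibniz equality, satisfying the axioms, with Separation and Replacement
   restricted to (deeply embedded) first-order formulas with parameters.  All
   set-theoretic notions below are the internal ones of the structure. *)

Record set_structure := SetStructure {
  carrier :> Type;
  mem : carrier -> carrier -> Prop
}.

Arguments mem {s} _ _.

Declare Scope st_scope.
Delimit Scope st_scope with st.
Open Scope st_scope.

Notation "x ∈ y" := (mem x y) (at level 70, no associativity) : st_scope.

(* First-order formulas in the language of set theory, with de Bruijn indices:
   index 0 is bound by the innermost quantifier. *)
Inductive formula : Type :=
| Mem (i j : nat)
| Eq (i j : nat)
| Neg (f : formula)
| And (f g : formula)
| Or (f g : formula)
| Imp (f g : formula)
| All (f : formula)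
| Ex (f : formula).

Definition scons {A : Type} (x : A) (e : nat -> A) (n : nat) : A :=
  match n with
  | O => x
  | S m => e m
  end.

Fixpoint sat {M : set_structure} (e : nat -> M) (f : formula) : Prop :=
  match f with
  | Mem i j => e i ∈ e j
  | Eq i j => e i = e j
  | Neg g => ~ sat e g
  | And g h => sat e g /\ sat e h
  | Or g h => sat e g \/ sat e h
  | Imp g h => sat e g -> sat e h
  | All g => forall x : M, sat (scons x e) g
  | Ex g => exists x : M, sat (scons x e) g
  end.

Fixpoint free_vars_below (n : nat) (f : formula) : Prop :=
  match f with
  | Mem i j | Eq i j => i < n /\ j < n
  | Neg g => free_vars_below n g
  | And g h | Or g h | Imp g h => free_vars_below n g /\ free_vars_below n h
  | All g | Ex g => free_vars_below (S n) g
  end.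

(* In the bounded quantifiers the bound is [S j], so that it is a variable
   other than the quantified one. *)
Inductive Delta0 : formula -> Prop :=
| D0_Mem i j : Delta0 (Mem i j)
| D0_Eq i j : Delta0 (Eq i j)
| D0_Neg f : Delta0 f -> Delta0 (Neg f)
| D0_And f g : Delta0 f -> Delta0 g -> Delta0 (And f g)
| D0_Or f g : Delta0 f -> Delta0 g -> Delta0 (Or f g)
| D0_Imp f g : Delta0 f -> Delta0 g -> Delta0 (Imp f g)
| D0_BAll j f : Delta0 f -> Delta0 (All (Imp (Mem 0 (S j)) f))
| D0_BEx j f : Delta0 f -> Delta0 (Ex (And (Mem 0 (S j)) f)).

Inductive Sigma1 : formula -> Prop :=
| S1_Delta0 f : Delta0 f -> Sigma1 f
| S1_Ex f : Sigma1 f -> Sigma1 (Ex f).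

Definition subset {M : set_structure} (x y : M) : Prop :=
  forall z : M, z ∈ x -> z ∈ y.

Notation "x ⊆ y" := (subset x y) (at level 70, no associativity) : st_scope.

Definition is_empty {M : set_structure} (x : M) : Prop :=
  forall z : M, ~ z ∈ x.

Definition nonempty {M : set_structure} (x : M) : Prop :=
  exists z : M, z ∈ x.

Record ZFC (M : set_structure) : Prop := {
  zfc_extensionality :
    forall x y : M, (forall z, z ∈ x <-> z ∈ y) -> x = y;
  zfc_foundation :
    forall x : M, nonempty x ->
      exists y, y ∈ x /\ forall z, z ∈ y -> ~ z ∈ x;
  zfc_pairing :
    forall x y : M, exists p, forall z, z ∈ p <-> z = x \/ z = y;
  zfc_union :
    forall x : M, exists u, forall z, z ∈ u <-> exists y, y ∈ x /\ z ∈ y;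
  zfc_power_set :
    forall x : M, exists p, forall z, z ∈ p <-> z ⊆ x;
  zfc_infinity :
    exists x : M,
      (exists e, is_empty e /\ e ∈ x) /\
      (forall y, y ∈ x ->
         exists s, s ∈ x /\ forall z, z ∈ s <-> z ∈ y \/ z = y);
  zfc_separation :
    forall (f : formula) (e : nat -> M) (x : M),
      exists y, forall z, z ∈ y <-> z ∈ x /\ sat (scons z e) f;
  zfc_replacement :
    forall (f : formula) (e : nat -> M) (a : M),
      (forall x, x ∈ a -> forall y y',
         sat (scons x (scons y e)) f -> sat (scons x (scons y' e)) f ->
         y = y') ->
      exists b, forall y,
        y ∈ b <-> exists x, x ∈ a /\ sat (scons x (scons y e)) f;
  zfc_choice :
    forall a : M,
      (forall x, x ∈ a -> nonempty x) ->
      (forall x y z, x ∈ a -> y ∈ a -> z ∈ x -> z ∈ y -> x = y) ->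
      exists c, forall x, x ∈ a -> exists! y, y ∈ x /\ y ∈ c
}.

(* [p] is the Kuratowski pair {{x}, {x, y}}. *)
Definition is_pair {M : set_structure} (p x y : M) : Prop :=
  forall z : M,
    z ∈ p <->
    (forall w, w ∈ z <-> w = x) \/ (forall w, w ∈ z <-> w = x \/ w = y).

Definition maps {M : set_structure} (f x y : M) : Prop :=
  exists p : M, p ∈ f /\ is_pair p x y.

Definition is_function {M : set_structure} (f a b : M) : Prop :=
  (forall p : M, p ∈ f -> exists x y, x ∈ a /\ y ∈ b /\ is_pair p x y) /\
  (forall x : M, x ∈ a -> exists! y, maps f x y).

Definition is_bijection {M : set_structure} (f a b : M) : Prop :=
  is_function f a b /\
  (forall y : M, y ∈ b -> exists! x, maps f x y).

Definition strict_well_order {M : set_structure}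
    (A : M -> Prop) (R : M -> M -> Prop) : Prop :=
  (forall x, A x -> ~ R x x) /\
  (forall x y z, A x -> A y -> A z -> R x y -> R y z -> R x z) /\
  (forall x y, A x -> A y -> R x y \/ x = y \/ R y x) /\
  (forall s : M, (forall x, x ∈ s -> A x) -> nonempty s ->
     exists m, m ∈ s /\ forall x, x ∈ s -> x = m \/ R m x).

Definition transitive {M : set_structure} (x : M) : Prop :=
  forall y : M, y ∈ x -> y ⊆ x.

Definition is_ordinal {M : set_structure} (a : M) : Prop :=
  transitive a /\ strict_well_order (fun x => x ∈ a) mem.

Definition is_limit_ordinal {M : set_structure} (a : M) : Prop :=
  is_ordinal a /\ nonempty a /\
  (forall x, x ∈ a -> exists y, y ∈ a /\ x ∈ y).

Definition is_omega {M : set_structure} (w : M) : Prop :=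
  is_limit_ordinal w /\ forall x, x ∈ w -> ~ is_limit_ordinal x.

Definition is_cardinal {M : set_structure} (k : M) : Prop :=
  is_ordinal k /\ forall a, a ∈ k -> ~ exists f, is_bijection f a k.

Definition is_cardinality {M : set_structure} (x c : M) : Prop :=
  is_cardinal c /\ exists f, is_bijection f x c.

Definition cardinality_below {M : set_structure} (x k : M) : Prop :=
  exists c, c ∈ k /\ is_cardinality x c.

Definition is_successor_cardinal {M : set_structure} (k kp : M) : Prop :=
  is_cardinal kp /\ k ∈ kp /\
  (forall c, is_cardinal c -> k ∈ c -> kp ⊆ c).

Definition is_cofinal_function {M : set_structure} (f a k : M) : Prop :=
  is_function f a k /\
  (forall x, x ∈ k -> exists b y, maps f b y /\ x ⊆ y).

Definition is_cofinality {M : set_structure} (k c : M) : Prop :=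
  is_ordinal c /\ (exists f, is_cofinal_function f c k) /\
  (forall d, d ∈ c -> ~ exists f, is_cofinal_function f d k).

Definition uncountable_cofinality {M : set_structure} (k : M) : Prop :=
  exists c w, is_cofinality k c /\ is_omega w /\ w ∈ c.

Definition is_transitive_closure {M : set_structure} (x t : M) : Prop :=
  transitive t /\ x ⊆ t /\
  (forall t', transitive t' -> x ⊆ t' -> t ⊆ t').

Definition in_H {M : set_structure} (k x : M) : Prop :=
  exists t, is_transitive_closure x t /\ cardinality_below t k.

Definition is_nonprincipal_ultrafilter {M : set_structure} (u m : M) : Prop :=
  (forall x, x ∈ u -> x ⊆ m) /\
  m ∈ u /\
  (forall x, is_empty x -> ~ x ∈ u) /\
  (forall x y, x ∈ u -> x ⊆ y -> y ⊆ m -> y ∈ u) /\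
  (forall x y i, x ∈ u -> y ∈ u ->
     (forall z, z ∈ i <-> z ∈ x /\ z ∈ y) -> i ∈ u) /\
  (forall x y, x ⊆ m ->
     (forall z, z ∈ y <-> z ∈ m /\ ~ z ∈ x) -> x ∈ u \/ y ∈ u) /\
  (forall a s, (forall z, z ∈ s <-> z = a) -> ~ s ∈ u).

(* Closure of the filter [u] on [m] under intersections of fewer than [k]
   elements; the intersection is taken relative to [m]. *)
Definition is_complete {M : set_structure} (k u m : M) : Prop :=
  forall d i, d ⊆ u -> cardinality_below d k ->
    (forall z, z ∈ i <-> z ∈ m /\ forall x, x ∈ d -> z ∈ x) -> i ∈ u.

Definition is_measurable {M : set_structure} (m : M) : Prop :=
  is_cardinal m /\
  (exists w, is_omega w /\ w ∈ m) /\
  (exists u, is_nonprincipal_ultrafilter u m /\ is_complete m u m).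

(* That [k] is a cardinal follows. *)
Definition is_limit_of_measurables {M : set_structure} (k : M) : Prop :=
  is_ordinal k /\ nonempty k /\
  (forall a, a ∈ k -> exists m, m ∈ k /\ a ∈ m /\ is_measurable m).

(* Binary class relations [R x y] stand for the classes {<x, y> | R x y}.  The
   formula has [x], [y] and the [n] parameters as its variables 0, 1 and
   2, 3, and so on; the values [p i] with [n <= i] are irrelevant. *)
Definition Sigma1_definable {M : set_structure}
    (P : M -> Prop) (R : M -> M -> Prop) : Prop :=
  exists (f : formula) (n : nat) (p : nat -> M),
    Sigma1 f /\ free_vars_below (2 + n) f /\
    (forall i, i < n -> P (p i)) /\
    (forall x y, R x y <-> sat (scons x (scons y p)) f).

Definition is_well_ordering_of {M : set_structure}
    (A : M -> Prop) (R : M -> M -> Prop) : Prop :=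
  (forall x y, R x y -> A x /\ A y) /\ strict_well_order A R.

Definition is_injection_from_into {M : set_structure}
    (A B : M -> Prop) (F : M -> M -> Prop) : Prop :=
  (forall x y, F x y -> A x /\ B y) /\
  (forall x, A x -> exists! y, F x y) /\
  (forall x x' y, F x y -> F x' y -> x = x').

(* Main.v *)
(* For a measure [u] on [m < k] and an ordinal [i < k], let [j_i] be the embedding of the universe
   into its [i]-th iterated ultrapower by [u].  If [m] is above the hereditary size of the
   parameters in [H(k)] and is not the cofinality of [k], then [j_i] fixes all the parameters,
   including [k] and [k^+], so by upward absoluteness a relation that is [Sigma_1] in them is
   preserved: [R x y] implies [R (j_i x) (j_i y)].

   (i) If [i] is measurable then [j_i] maps [m] to [i] and fixes the measurables below [m] and
   above [i].  For measurables [f 0 < f 1 < ...] and [X n = {f l | l <> n}] this yields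
   embeddings [j] with [j (X (n + 1)) = X n].  A well-ordering [R] has a least [X n], whence
   [R (j y) y] for [y = X (n + 1)]; applying [j] to the least such [y] gives a smaller one.

   (ii) Fix [m] and [u].  Unboundedly many [g < k^+] are fixed by all [j_i] with [i < k], namely the
   limits of suitable [omega]-sequences.  For these [F g = j_i (F g)], so [F g] is determined by its
   intersection with [m], as [i] is a subset of [j_i m]; but [k^+] is regular and [P(m)] has size
   less than [k].

   The iterated ultrapower is taken directly: its elements are represented by the functions on [m^i]
   that depend on finitely many coordinates, modulo the filter of the sets that contain all
   sequences following some strategy, where a strategy assigns to each initial segment of a
   sequence a set in [u] to which the next value must belong. *)

From Stdlib Require Import Classical ClassicalEpsilon FunctionalExtensionality.
From Stdlib Require Import PropExtensionality PeanoNat Lia.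
Require Import Defs.

(* The model's Separation and Replacement accept only first-order classes, so the embeddings must be
   definable functions. Two choices make this possible. Upward preservation of [Sigma1] relations
   asks for Łoś's theorem only for [Delta0] formulas, where witnesses are bounded by sets. And the
   collapse of one function is computed in a transitive set containing its values, so that no
   class-sized recursion occurs.

   Finite supports are what lets the filter of strategies decide predicates: integrating out the
   largest coordinate of a support reduces the question to [u] and a smaller support. Intersections
   over index sets that are small for [u] need no supports, and they give well-foundedness. No
   successive ultrapowers or direct limits have to be formed.

   Cardinal arithmetic is replaced by two notions. [small] says that a set lies below the measured
   cardinal; its closure under function spaces and power sets covers the uses of inaccessibility.
   [ranked] does the same for size at most [k], and yields the regularity of [kp]. *)
Existing Class ZFC.

(** * Definability with parameters *)

Fixpoint rename (r : nat -> nat) (f : formula) : formula :=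
  match f with
  | Mem i j => Mem (r i) (r j)
  | Eq i j => Eq (r i) (r j)
  | Neg g => Neg (rename r g)
  | And g h => And (rename r g) (rename r h)
  | Or g h => Or (rename r g) (rename r h)
  | Imp g h => Imp (rename r g) (rename r h)
  | All g => All (rename (fun n => match n with O => O | S m => S (r m) end) g)
  | Ex g => Ex (rename (fun n => match n with O => O | S m => S (r m) end) g)
  end.

Fixpoint var_bound (f : formula) : nat :=
  match f with
  | Mem i j | Eq i j => S (max i j)
  | Neg g => var_bound g
  | And g h | Or g h | Imp g h => max (var_bound g) (var_bound h)
  | All g | Ex g => var_bound g
  end.

Section Definability.
Context {M : set_structure}.
Implicit Types e : nat -> M.

Lemma sat_rename f : forall r e, sat e (rename r f) <-> sat (fun i => e (r i)) f.
Proof.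
  assert (sc : forall r e (x : M),
    (fun i => scons x e (match i with O => O | S m => S (r m) end)) =
    scons x (fun i => e (r i))).
  { intros r e x. extensionality i. now destruct i. }
  induction f; intros r e; simpl; try tauto.
  - now rewrite IHf.
  - now rewrite IHf1, IHf2.
  - now rewrite IHf1, IHf2.
  - now rewrite IHf1, IHf2.
  - split; intros H x; specialize (H x).
    + now rewrite IHf, sc in H.
    + now rewrite IHf, sc.
  - split; intros [x H]; exists x.
    + now rewrite IHf, sc in H.
    + now rewrite IHf, sc.
Qed.

Lemma sat_agree_below n f : free_vars_below n f ->
  forall e e', (forall i, i < n -> e i = e' i) -> sat e f <-> sat e' f.
Proof.
  revert n.
  assert (sc : forall n e e' (x : M), (forall i, i < n -> e i = e' i) ->
    forall i, i < S n -> scons x e i = scons x e' i).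
  { intros n e e' x H [|i] Hi; simpl; [easy | apply H; lia]. }
  induction f; simpl; intros n Hf e e' He;
    try (destruct Hf as [H1 H2]);
    try (rewrite (He i), (He j) by lia; tauto);
    try (rewrite (IHf1 n H1 e e' He), (IHf2 n H2 e e' He); tauto).
  - rewrite (IHf n Hf e e' He); tauto.
  - split; intros H x; specialize (H x);
      [rewrite <- (IHf _ Hf (scons x e)) | rewrite (IHf _ Hf _ (scons x e'))]; eauto.
  - split; intros [x H]; exists x;
      [rewrite <- (IHf _ Hf (scons x e)) | rewrite (IHf _ Hf _ (scons x e'))]; eauto.
Qed.

Lemma free_vars_below_mono f : forall n m, n <= m ->
  free_vars_below n f -> free_vars_below m f.
Proof.
  induction f; simpl; intros n m Hn Hf; try lia; try (destruct Hf; split); eauto;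
    apply (IHf (S n)); auto; lia.
Qed.

Lemma free_vars_below_var_bound f : free_vars_below (var_bound f) f.
Proof.
  induction f; simpl; try lia; auto;
    try (split; eapply free_vars_below_mono; try eassumption; lia);
    eapply free_vars_below_mono; try eassumption; lia.
Qed.

(* First-order definability with parameters of a predicate on environments;
   [inr c] is an occurrence of the parameter [c]. *)
Definition slot e (c : nat + M) : M :=
  match c with inl k => e k | inr x => x end.

Definition defp (P : (nat -> M) -> Prop) : Prop :=
  exists f g, forall e, P e <-> sat (fun i => slot e (g i)) f.

(** Only the graph has to be definable, so operations obtained from a choice operator qualify once
    they are uniquely specified. *)
Definition dterm (t : (nat -> M) -> M) : Prop :=
  defp (fun e => e 0 = t (fun n => e (S n))).

Lemma defp_iff_compat P Q : (forall e, P e <-> Q e) -> defp P -> defp Q.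
Proof. intros H (f & g & Hf). exists f, g. intros e. now rewrite <- H. Qed.

(** Two formulas come with separate slot assignments; interleaving these over the even and the odd
    indices gives one assignment that serves both. *)
Let mix (g h : nat -> nat + M) (n : nat) : nat + M :=
  if Nat.even n then g (Nat.div2 n) else h (Nat.div2 n).

Lemma mix_l g h f e :
  sat (fun i => slot e (mix g h i)) (rename (fun n => 2 * n) f) <->
  sat (fun i => slot e (g i)) f.
Proof.
  rewrite sat_rename.
  replace (fun i => slot e (mix g h (2 * i))) with (fun i => slot e (g i)); [tauto|].
  extensionality i. unfold mix.
  now rewrite Nat.even_mul, Nat.div2_double.
Qed.

Lemma mix_r g h f e :
  sat (fun i => slot e (mix g h i)) (rename (fun n => S (2 * n)) f) <->
  sat (fun i => slot e (h i)) f.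
Proof.
  rewrite sat_rename.
  replace (fun i => slot e (mix g h (S (2 * i)))) with (fun i => slot e (h i)); [tauto|].
  extensionality i. unfold mix.
  now rewrite Nat.even_succ, Nat.odd_mul, Nat.div2_succ_double.
Qed.

Lemma defp_and P Q : defp P -> defp Q -> defp (fun e => P e /\ Q e).
Proof.
  intros (f & g & Hf) (f' & g' & Hf').
  exists (And (rename (fun n => 2 * n) f) (rename (fun n => S (2 * n)) f')), (mix g g').
  intros e. cbn [sat]. now rewrite mix_l, mix_r, Hf, Hf'.
Qed.

Lemma defp_not P : defp P -> defp (fun e => ~ P e).
Proof.
  intros (f & g & Hf). exists (Neg f), g. intros e. simpl. now rewrite Hf.
Qed.

Lemma defp_or P Q : defp P -> defp Q -> defp (fun e => P e \/ Q e).
Proof.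
  intros HP HQ.
  eapply defp_iff_compat; [|exact (defp_not _ (defp_and _ _ (defp_not _ HP) (defp_not _ HQ)))].
  intros e. simpl. tauto.
Qed.

Lemma defp_imp (P Q : (nat -> M) -> Prop) : defp P -> defp Q -> defp (fun e => P e -> Q e).
Proof.
  intros HP HQ.
  eapply defp_iff_compat; [|exact (defp_or _ _ (defp_not _ HP) HQ)].
  intros e. simpl. tauto.
Qed.

Lemma defp_iff P Q : defp P -> defp Q -> defp (fun e => P e <-> Q e).
Proof. intros HP HQ. apply defp_and; apply defp_imp; assumption. Qed.

Lemma defp_ex (Q : M -> (nat -> M) -> Prop) :
  defp (fun e => Q (e 0) (fun n => e (S n))) -> defp (fun e => exists x, Q x e).
Proof.
  intros (f & g & Hf).
  (* All slots that hold variable 0 are merged into the quantified index. The remaining slots move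
     up by one, past the quantifier, and the new value at the merged slots is never read. *)
  exists (Ex (rename (fun i => match g i with inl O => O | _ => S i end) f)).
  exists (fun i => match g i with inl (S k) => inl k | inl O => inl O | inr c => inr c end).
  intros e. simpl.
  assert (H : forall x, Q x e <-> sat (scons x (fun i => slot e
    (match g i with inl (S k) => inl k | inl O => inl O | inr c => inr c end)))
    (rename (fun i => match g i with inl O => O | _ => S i end) f)).
  { intros x. specialize (Hf (scons x e)). cbn [scons] in Hf.
    change (fun n : nat => e n) with e in Hf. rewrite Hf, sat_rename.
    match goal with |- sat ?a _ <-> sat ?b _ => replace b with a; [tauto|] end.
    extensionality i. destruct (g i) as [[|k]|c] eqn:E; simpl; now rewrite ?E. }
  split; intros [x Hx]; exists x; now apply H.
Qed.

Lemma defp_all (Q : M -> (nat -> M) -> Prop) :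
  defp (fun e => Q (e 0) (fun n => e (S n))) -> defp (fun e => forall x, Q x e).
Proof.
  intros H.
  eapply defp_iff_compat;
    [|exact (defp_not _ (defp_ex (fun x e => ~ Q x e) (defp_not _ H)))].
  intros e. simpl. split.
  - intros H1 x. apply NNPP. intros H2. apply H1. now exists x.
  - intros H1 [x Hx]. auto.
Qed.

Lemma defp_rename (P : (nat -> M) -> Prop) (r : nat -> nat) :
  defp P -> defp (fun e => P (fun n => e (r n))).
Proof.
  intros (f & g & Hf).
  exists f, (fun i => match g i with inl k => inl (r k) | inr c => inr c end).
  intros e. rewrite Hf.
  match goal with |- sat ?a _ <-> sat ?b _ => replace b with a; [tauto|] end.
  extensionality i. now destruct (g i).
Qed.

Lemma defp_eq01 : defp (fun e => e 0 = e 1).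
Proof. exists (Eq 0 1), inl. intros e. simpl. tauto. Qed.

Lemma defp_mem01 : defp (fun e => e 0 ∈ e 1).
Proof. exists (Mem 0 1), inl. intros e. simpl. tauto. Qed.

Lemma dterm_var k : dterm (fun e => e k).
Proof. exists (Eq 0 1), (fun i => inl (match i with O => O | _ => S k end)). simpl. tauto. Qed.

Lemma dterm_const c : dterm (fun _ => c).
Proof.
  exists (Eq 0 1), (fun i => match i with O => inl O | _ => inr c end). simpl. tauto.
Qed.

Lemma dterm_rename t (r : nat -> nat) : dterm t -> dterm (fun e => t (fun n => e (r n))).
Proof.
  intros H.
  exact (defp_rename _ (fun n => match n with O => O | S m => S (r m) end) H).
Qed.

Lemma defp_subst (P : M -> (nat -> M) -> Prop) t :
  defp (fun e => P (e 0) (fun n => e (S n))) -> dterm t -> defp (fun e => P (t e) e).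
Proof.
  intros HP Ht.
  eapply defp_iff_compat; [|apply (defp_ex (fun x e => x = t e /\ P x e))].
  - intros e. split; [intros (x & -> & H); exact H | intros H; now exists (t e)].
  - apply defp_and; [exact Ht | exact HP].
Qed.

Lemma defp_subst1 (P : M -> Prop) t :
  defp (fun e => P (e 0)) -> dterm t -> defp (fun e => P (t e)).
Proof. intros HP Ht. exact (defp_subst (fun x _ => P x) t HP Ht). Qed.

Lemma defp_subst2 (P : M -> M -> Prop) s t :
  defp (fun e => P (e 0) (e 1)) -> dterm s -> dterm t -> defp (fun e => P (s e) (t e)).
Proof.
  intros HP Hs Ht.
  apply (defp_subst (fun x e => P x (t e))); [|exact Hs].
  apply (defp_subst (fun y e => P (e 0) y) (fun e => t (fun n => e (S n)))).
  - exact (defp_rename _ (fun n => match n with O => 1 | _ => 0 end) HP).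
  - exact (dterm_rename t S Ht).
Qed.

Lemma defp_subst3 (P : M -> M -> M -> Prop) s t u :
  defp (fun e => P (e 0) (e 1) (e 2)) -> dterm s -> dterm t -> dterm u ->
  defp (fun e => P (s e) (t e) (u e)).
Proof.
  intros HP Hs Ht Hu.
  apply (defp_subst (fun x e => P x (t e) (u e))); [|exact Hs].
  apply (defp_subst (fun y e => P (e 0) y (u (fun n => e (S n)))) (fun e => t (fun n => e (S n)))).
  2: exact (dterm_rename t S Ht).
  apply (defp_subst (fun z e => P (e 1) (e 0) z) (fun e => u (fun n => e (S (S n))))).
  - exact (defp_rename _ (fun n => match n with O => 2 | 1 => 1 | _ => 0 end) HP).
  - exact (dterm_rename u (fun n => S (S n)) Hu).
Qed.

Lemma defp_mem s t : dterm s -> dterm t -> defp (fun e => s e ∈ t e).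
Proof. apply (defp_subst2 mem). exact defp_mem01. Qed.

Lemma defp_eq s t : dterm s -> dterm t -> defp (fun e => s e = t e).
Proof. apply (defp_subst2 eq). exact defp_eq01. Qed.

Lemma dterm_subst1 (F : M -> M) t :
  dterm (fun e => F (e 0)) -> dterm t -> dterm (fun e => F (t e)).
Proof.
  intros HF Ht. unfold dterm.
  apply (defp_subst2 (fun x y => x = F y)); [|exact (dterm_var 0)|exact (dterm_rename t S Ht)].
  exact HF.
Qed.

Lemma dterm_subst2 (F : M -> M -> M) s t :
  dterm (fun e => F (e 0) (e 1)) -> dterm s -> dterm t -> dterm (fun e => F (s e) (t e)).
Proof.
  intros HF Hs Ht. unfold dterm.
  apply (defp_subst3 (fun x y z => x = F y z));
    [|exact (dterm_var 0)|exact (dterm_rename s S Hs)|exact (dterm_rename t S Ht)].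
  exact HF.
Qed.

(** Makes a class out of an arbitrary given formula: needed for the induction on formulas in Łoś's
    theorem, and for treating a [Sigma1] relation as a definable class. *)
Lemma defp_sat f : forall t : nat -> (nat -> M) -> M,
  (forall i, dterm (t i)) -> defp (fun e => sat (fun i => t i e) f).
Proof.
  assert (sc : forall (t : nat -> (nat -> M) -> M), (forall i, dterm (t i)) -> forall i,
    dterm (fun e => scons (e 0) (fun i => t i (fun n => e (S n))) i)).
  { intros t Ht [|i]; simpl; [apply dterm_var | apply (dterm_rename _ S), Ht]. }
  induction f; intros t Ht; simpl.
  - now apply defp_mem.
  - now apply defp_eq.
  - now apply defp_not, IHf.
  - apply defp_and; auto.
  - apply defp_or; auto.
  - apply defp_imp; auto.
  - apply defp_all.
    exact (IHf (fun i e => scons (e 0) (fun i => t i (fun n => e (S n))) i) (sc t Ht)).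
  - apply defp_ex.
    exact (IHf (fun i e => scons (e 0) (fun i => t i (fun n => e (S n))) i) (sc t Ht)).
Qed.

Lemma defp_True : defp (fun _ => True).
Proof.
  eapply defp_iff_compat; [|exact (defp_imp _ _ defp_eq01 defp_eq01)]. simpl. tauto.
Qed.

Lemma defp_False : defp (fun _ => False).
Proof. eapply defp_iff_compat; [|exact (defp_not _ defp_True)]. simpl. tauto. Qed.

Definition dpred1 (P : M -> Prop) := defp (fun e => P (e 0)).
Definition dpred2 (P : M -> M -> Prop) := defp (fun e => P (e 0) (e 1)).
Definition dfun1 (F : M -> M) := dterm (fun e => F (e 0)).
Definition dfun2 (F : M -> M -> M) := dterm (fun e => F (e 0) (e 1)).

Lemma dpred1_use P t : dpred1 P -> dterm t -> defp (fun e => P (t e)).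
Proof. apply defp_subst1. Qed.
Lemma dpred2_use P s t : dpred2 P -> dterm s -> dterm t -> defp (fun e => P (s e) (t e)).
Proof. apply defp_subst2. Qed.
Lemma dfun1_use F t : dfun1 F -> dterm t -> dterm (fun e => F (t e)).
Proof. apply dterm_subst1. Qed.
Lemma dfun2_use F s t : dfun2 F -> dterm s -> dterm t -> dterm (fun e => F (s e) (t e)).
Proof. apply dterm_subst2. Qed.

End Definability.

(* Redefined below as set-theoretic operations are introduced. *)
Ltac dfn_ext := fail.

Ltac dfn_hyp := match goal with
  | H : dpred1 ?P |- defp (fun e => ?P (@?t e)) => simple apply (dpred1_use P t H)
  | H : dpred2 ?P |- defp (fun e => ?P (@?s e) (@?t e)) => simple apply (dpred2_use P s t H)
  | H : dfun1 ?F |- dterm (fun e => ?F (@?t e)) => simple apply (dfun1_use F t H)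
  | H : dfun2 ?F |- dterm (fun e => ?F (@?s e) (@?t e)) => simple apply (dfun2_use F s t H)
  | H : dterm ?t |- dterm (fun e => ?t e) => exact H
  | H : dterm ?t |- dterm (fun e => ?t (@?u e)) => exact (dterm_rename t _ H)
  end.

(** Every use of Separation, Replacement, induction or recursion on a class requires a definability
    proof. These follow the syntax of the class, so they are found by matching on its head
    symbol. *)
Ltac dfn_step :=
  match goal with
  | |- dpred1 _ => unfold dpred1
  | |- dpred2 _ => unfold dpred2
  | |- dfun1 _ => unfold dfun1
  | |- dfun2 _ => unfold dfun2
  | |- dterm (fun e => e _) => simple apply dterm_var
  | |- dterm (fun e => ?c) => exact (dterm_const c)
  | |- defp (fun e => @?P e /\ @?Q e) => simple apply (defp_and P Q)
  | |- defp (fun e => @?P e \/ @?Q e) => simple apply (defp_or P Q)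
  | |- defp (fun e => @?P e <-> @?Q e) => simple apply (defp_iff P Q)
  | |- defp (fun e => ~ @?P e) => simple apply (defp_not P)
  | |- defp (fun e => @?P e -> @?Q e) => simple apply (defp_imp P Q)
  | |- defp (fun e => forall x, @?Q e x) => simple apply (defp_all (fun x e => Q e x))
  | |- defp (fun e => exists! x, @?Q e x) => unfold unique
  | |- defp (fun e => exists x, @?Q e x) => simple apply (defp_ex (fun x e => Q e x))
  | |- defp (fun e => @?s e ∈ @?t e) => simple apply (defp_mem s t)
  | |- defp (fun e => @?s e = @?t e) => simple apply (defp_eq s t)
  | |- defp (fun e => True) => exact defp_True
  | |- defp (fun e => False) => exact defp_False
  | |- _ => dfn_hyp
  | |- _ => dfn_ext
  end; cbv beta.
Ltac dfn := cbv beta; repeat dfn_step.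

(** * Set theory in a model of ZFC *)

Section Sets.
Context {M : set_structure} {HM : ZFC M}.
Implicit Types x y z a b f : M.

Lemma set_ext x y : (forall z, z ∈ x <-> z ∈ y) -> x = y.
Proof. apply zfc_extensionality; exact HM. Qed.

Lemma subset_antisym x y : x ⊆ y -> y ⊆ x -> x = y.
Proof. intros H1 H2. apply set_ext. intros z. split; [apply H1 | apply H2]. Qed.

Lemma subset_refl x : x ⊆ x.
Proof. now intros z. Qed.

Lemma subset_trans x y z : x ⊆ y -> y ⊆ z -> x ⊆ z.
Proof. intros H1 H2 w Hw. auto. Qed.

(** Freezing all variables but one as parameters gives the unary classes that Separation takes. *)
Lemma defp_instance (P : (nat -> M) -> M -> Prop) :
  defp (fun e => P (fun n => e (S n)) (e 0)) -> forall e, dpred1 (P e).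
Proof.
  intros (f & g & Hf) e.
  exists f, (fun i => match g i with inl O => inl O | inl (S k) => inr (e k) | inr c => inr c end).
  intros e'. specialize (Hf (scons (e' 0) e)). cbn [scons] in Hf.
  change (fun n : nat => e n) with e in Hf. rewrite Hf.
  match goal with |- sat ?a _ <-> sat ?b _ => replace b with a; [tauto|] end.
  extensionality i. now destruct (g i) as [[|k]|c].
Qed.

Lemma dpred2_instance (P : M -> M -> Prop) c : dpred2 P -> dpred1 (P c).
Proof. intros H. exact (defp_instance (fun e => P (e 0)) (defp_rename _ (fun n => match n with O => 1 | _ => 0 end) H) (fun _ => c)). Qed.

Lemma separation (P : M -> Prop) x :
  dpred1 P -> exists y, forall z, z ∈ y <-> z ∈ x /\ P z.
Proof.
  intros (f & g & Hf).
  destruct (zfc_separation M HM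
    (rename (fun i => match g i with inl _ => 0 | inr _ => S i end) f)
    (fun i => match g i with inl _ => x | inr c => c end) x) as [y Hy].
  exists y. intros z. rewrite Hy, sat_rename, (Hf (fun _ => z)).
  match goal with |- _ /\ sat ?a _ <-> _ /\ sat ?b _ => replace b with a; [tauto|] end.
  extensionality i. destruct (g i) eqn:E; simpl; now rewrite ?E.
Qed.

Lemma replacement (R : M -> M -> Prop) a :
  dpred2 R -> (forall x y y', x ∈ a -> R x y -> R x y' -> y = y') ->
  exists b, forall y, y ∈ b <-> exists x, x ∈ a /\ R x y.
Proof.
  intros (f & g & Hf) Hfun.
  set (f' := rename (fun i => match g i with inl O => 0 | inl _ => 1 | inr _ => S (S i) end) f).
  set (e' := fun i => match g i with inl _ => a | inr c => c end).
  assert (H : forall x y, sat (scons x (scons y e')) f' <-> R x y).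
  { intros x y. unfold f'. rewrite sat_rename, (Hf (fun n => match n with O => x | _ => y end)).
    match goal with |- sat ?a _ <-> sat ?b _ => replace b with a; [tauto|] end.
    unfold e'. extensionality i. destruct (g i) as [[|k]|c] eqn:E; simpl; now rewrite ?E. }
  destruct (zfc_replacement M HM f' e' a) as [b Hb].
  - intros x Hx y y' H1 H2. rewrite H in H1, H2. eauto.
  - exists b. intros y. rewrite Hb. split; intros (x & Hx & H1); exists x; split; auto;
      now apply H.
Qed.

Lemma carrier_inhabited : inhabited M.
Proof. destruct (zfc_infinity M HM) as [x _]. now constructor. Qed.

(** Set operations thereby become total functions on the model; the value is arbitrary when no set
    has these elements. *)
Definition the_set (P : M -> Prop) : M :=
  epsilon carrier_inhabited (fun y => forall z, z ∈ y <-> P z).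

Lemma in_the_set (P : M -> Prop) :
  (exists y, forall z, z ∈ y <-> P z) -> forall z, z ∈ the_set P <-> P z.
Proof. intros H. exact (epsilon_spec carrier_inhabited _ H). Qed.

(** The choice operator itself is not first-order, but where the set exists extensionality
    determines it, so its graph is given by the formula listing its elements. *)
Lemma dterm_the_set (P : (nat -> M) -> M -> Prop) :
  (forall e, exists y, forall z, z ∈ y <-> P e z) ->
  defp (fun e => P (fun n => e (S n)) (e 0)) -> dterm (fun e => the_set (P e)).
Proof.
  intros Hs H. unfold dterm.
  apply (defp_iff_compat (fun e => forall z, z ∈ e 0 <-> P (fun n => e (S n)) z)).
  - intros e. pose proof (in_the_set _ (Hs (fun n => e (S n)))) as Hz. split.
    + intros H1. apply set_ext. intros z. now rewrite H1, Hz.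
    + now intros ->.
  - apply (defp_all (fun z e => z ∈ e 0 <-> P (fun n => e (S n)) z)).
    apply defp_iff; [dfn|].
    exact (defp_rename _ (fun n => match n with O => 0 | S k => S (S k) end) H).
Qed.

Definition sep x (P : M -> Prop) : M := the_set (fun z => z ∈ x /\ P z).
Definition repl x (F : M -> M) : M := the_set (fun z => exists w, w ∈ x /\ z = F w).

Lemma in_sep x P z : dpred1 P -> z ∈ sep x P <-> z ∈ x /\ P z.
Proof. intros H. apply in_the_set. now apply separation. Qed.

Lemma has_repl x F : dfun1 F -> exists b, forall z, z ∈ b <-> exists w, w ∈ x /\ z = F w.
Proof.
  intros H. apply (replacement (fun w z => z = F w)).
  - dfn.
  - intros w y y' _ -> ->. reflexivity.
Qed.

Lemma in_repl x F z : dfun1 F -> z ∈ repl x F <-> exists w, w ∈ x /\ z = F w.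
Proof. intros H. apply in_the_set. now apply has_repl. Qed.

Lemma dterm_sep t (P : (nat -> M) -> M -> Prop) :
  dterm t -> defp (fun e => P (fun n => e (S n)) (e 0)) -> dterm (fun e => sep (t e) (P e)).
Proof.
  intros Ht HP. apply (dterm_the_set (fun e z => z ∈ t e /\ P e z)).
  - intros e. apply separation. now apply defp_instance.
  - apply defp_and; [dfn | exact HP].
Qed.

Lemma dfun1_instance (F : (nat -> M) -> M -> M) :
  dterm (fun e => F (fun n => e (S n)) (e 0)) -> forall e, dfun1 (F e).
Proof.
  intros H e.
  destruct H as (f & g & Hf).
  exists f, (fun i => match g i with inl O => inl O | inl 1 => inl 1
    | inl (S (S k)) => inr (e k) | inr c => inr c end).
  intros e'. specialize (Hf (scons (e' 0) (scons (e' 1) e))). cbn [scons] in Hf.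
  change (fun n : nat => e n) with e in Hf. rewrite Hf.
  match goal with |- sat ?a _ <-> sat ?b _ => replace b with a; [tauto|] end.
  extensionality i. now destruct (g i) as [[|[|k]]|c].
Qed.

Lemma dterm_repl t (F : (nat -> M) -> M -> M) :
  dterm t -> dterm (fun e => F (fun n => e (S n)) (e 0)) -> dterm (fun e => repl (t e) (F e)).
Proof.
  intros Ht HF. apply (dterm_the_set (fun e z => exists w, w ∈ t e /\ z = F e w)).
  - intros e. apply has_repl. now apply dfun1_instance.
  - apply (defp_ex (fun w e => w ∈ t (fun n => e (S n)) /\ e 0 = F (fun n => e (S n)) w)).
    apply defp_and; [dfn|].
    exact (defp_rename _ (fun n => match n with O => 1 | S O => 0 | S (S k) => S (S k) end) HF).
Qed.

Definition empty : M := the_set (fun _ => False).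
Definition upair a b : M := the_set (fun z => z = a \/ z = b).
Definition union x : M := the_set (fun z => exists y, y ∈ x /\ z ∈ y).
Definition power x : M := the_set (fun z => z ⊆ x).

Lemma in_empty z : ~ z ∈ empty.
Proof.
  unfold empty. rewrite in_the_set; [tauto|].
  destruct carrier_inhabited as [x].
  destruct (separation (fun _ => False) x) as [y Hy]; [dfn|].
  exists y. intros w. rewrite Hy. tauto.
Qed.

Lemma empty_eq x : (forall z, ~ z ∈ x) -> x = empty.
Proof. intros H. apply set_ext. intros z. pose proof (H z). pose proof (in_empty z). tauto. Qed.

Lemma in_upair a b z : z ∈ upair a b <-> z = a \/ z = b.
Proof. apply in_the_set. apply zfc_pairing, HM. Qed.
Lemma in_union x z : z ∈ union x <-> exists y, y ∈ x /\ z ∈ y.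
Proof. apply in_the_set. apply zfc_union, HM. Qed.
Lemma in_power x z : z ∈ power x <-> z ⊆ x.
Proof. exact (in_the_set (fun z => z ⊆ x) (zfc_power_set M HM x) z). Qed.

Lemma dfun2_upair : dfun2 upair.
Proof.
  apply (dterm_the_set (fun e z => z = e 0 \/ z = e 1)); [intros; apply zfc_pairing, HM | dfn].
Qed.
Lemma dfun1_union : dfun1 union.
Proof.
  apply (dterm_the_set (fun e z => exists y, y ∈ e 0 /\ z ∈ y)); [intros; apply zfc_union, HM | dfn].
Qed.
Lemma dfun1_power : dfun1 power.
Proof.
  apply (dterm_the_set (fun e z => z ⊆ e 0)); [intros; apply zfc_power_set, HM | unfold subset; dfn].
Qed.

Definition sing x : M := upair x x.
Definition opair a b : M := upair (sing a) (upair a b).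
Definition cup a b : M := union (upair a b).
Definition succ x : M := cup x (sing x).

Lemma in_sing x z : z ∈ sing x <-> z = x.
Proof. unfold sing. rewrite in_upair. tauto. Qed.
Lemma in_cup a b z : z ∈ cup a b <-> z ∈ a \/ z ∈ b.
Proof.
  unfold cup. rewrite in_union. split.
  - intros (y & Hy & Hz). rewrite in_upair in Hy. destruct Hy as [->| ->]; auto.
  - intros [H|H]; [exists a | exists b]; rewrite in_upair; auto.
Qed.
Lemma in_succ x z : z ∈ succ x <-> z ∈ x \/ z = x.
Proof. unfold succ. rewrite in_cup, in_sing. tauto. Qed.

Lemma sing_inj a b : sing a = sing b -> a = b.
Proof. intros H. apply in_sing. rewrite <- H. now apply in_sing. Qed.

Lemma opair_inj a b a' b' : opair a b = opair a' b' -> a = a' /\ b = b'.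
Proof.
  intros H.
  assert (H1 : forall z, z = sing a \/ z = upair a b <-> z = sing a' \/ z = upair a' b').
  { intros z. rewrite <- !in_upair. fold (opair a b). fold (opair a' b'). now rewrite H. }
  assert (Ha : a = a').
  { destruct (proj1 (H1 (sing a)) (or_introl eq_refl)) as [E|E].
    - now apply sing_inj.
    - symmetry. apply in_sing. rewrite E. apply in_upair. now left. }
  subst a'. split; [reflexivity|].
  destruct (proj1 (H1 (upair a b)) (or_intror eq_refl)) as [E|E].
  - assert (b = a) as ->. { apply in_sing. rewrite <- E. apply in_upair. now right. }
    destruct (proj2 (H1 (upair a b')) (or_intror eq_refl)) as [E'|E'];
      symmetry; apply in_sing; [rewrite <- E'| rewrite <- E, <- E']; apply in_upair; now right.
  - assert (Hb : b = a \/ b = b'). { apply in_upair. rewrite <- E. apply in_upair. now right. }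
    assert (Hb' : b' = a \/ b' = b). { apply in_upair. rewrite E. apply in_upair. now right. }
    destruct Hb as [->|]; destruct Hb'; congruence.
Qed.

(** The union of all values at [x]: the value itself if there is exactly one, and [empty] outside
    the domain. This default is relied upon when sequences are padded. *)
Definition app f x : M := the_set (fun w => exists y, opair x y ∈ f /\ w ∈ y).

End Sets.

Ltac dfn_sets := match goal with
  | |- dterm (fun e => upair (@?s e) (@?t e)) => simple apply (dfun2_use upair s t dfun2_upair)
  | |- dterm (fun e => union (@?t e)) => simple apply (dfun1_use union t dfun1_union)
  | |- dterm (fun e => power (@?t e)) => simple apply (dfun1_use power t dfun1_power)
  | |- dterm (fun e => sep (@?t e) (@?P e)) => simple apply (dterm_sep t P)
  | |- dterm (fun e => repl (@?t e) (@?F e)) => simple apply (dterm_repl t F)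
  | |- dterm (fun e => sing _) => unfold sing
  | |- dterm (fun e => opair _ _) => unfold opair
  | |- dterm (fun e => cup _ _) => unfold cup
  | |- dterm (fun e => succ _) => unfold succ
  | |- defp (fun e => subset _ _) => unfold subset
  | |- defp (fun e => nonempty _) => unfold nonempty
  | |- defp (fun e => is_empty _) => unfold is_empty
  | |- defp (fun e => transitive _) => unfold transitive
  end.
Ltac dfn_ext ::= dfn_sets.

(** * Functions, products and definite descriptions *)

Section Functions.
Context {M : set_structure} {HM : ZFC M}.
Implicit Types x y z a b f : M.

Lemma has_app f x : exists w, forall z, z ∈ w <-> exists y, opair x y ∈ f /\ z ∈ y.
Proof.
  destruct (separation (fun z => exists y, opair x y ∈ f /\ z ∈ y) (union (union (union f))))
    as [w Hw]; [dfn|].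
  exists w. intros z. rewrite Hw. split; [tauto|].
  intros (y & H1 & H2). split; [|eauto].
  rewrite in_union. exists y. split; [|exact H2].
  rewrite in_union. exists (upair x y). split; [|apply in_upair; now right].
  rewrite in_union. exists (opair x y). split; [exact H1|].
  unfold opair. apply in_upair. now right.
Qed.

Lemma dfun2_app : dfun2 app.
Proof.
  apply (dterm_the_set (fun e z => exists y, opair (e 1) y ∈ e 0 /\ z ∈ y)) with (1 := fun e => has_app _ _).
  dfn.
Qed.

Lemma app_eq f x y : (forall y', opair x y' ∈ f <-> y' = y) -> app f x = y.
Proof.
  intros H. apply set_ext. intros z. unfold app. rewrite in_the_set by apply has_app.
  split.
  - intros (y' & H1 & H2). apply H in H1. now subst.
  - intros Hz. exists y. split; [now apply H | exact Hz].
Qed.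

Lemma app_undef f x : (forall y, ~ opair x y ∈ f) -> app f x = empty.
Proof.
  intros H. apply empty_eq. intros z Hz. unfold app in Hz. rewrite in_the_set in Hz by apply has_app.
  destruct Hz as (y & H1 & _). exact (H y H1).
Qed.

Definition lam a (F : M -> M) : M := repl a (fun x => opair x (F x)).

Lemma dterm_lam t (F : (nat -> M) -> M -> M) :
  dterm t -> dterm (fun e => F (fun n => e (S n)) (e 0)) -> dterm (fun e => lam (t e) (F e)).
Proof.
  intros Ht HF. unfold lam. apply (dterm_repl t (fun e x => opair x (F e x))); [exact Ht|].
  exact (dfun2_use _ _ _ (ltac:(dfn) : dfun2 opair) (dterm_var 0) HF).
Qed.

Lemma in_lam a F p : dfun1 F -> p ∈ lam a F <-> exists x, x ∈ a /\ p = opair x (F x).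
Proof. intros H. unfold lam. rewrite in_repl by dfn. tauto. Qed.

Lemma opair_in_lam a F x y : dfun1 F -> opair x y ∈ lam a F <-> x ∈ a /\ y = F x.
Proof.
  intros H. rewrite in_lam by exact H. split.
  - intros (x' & Hx & E). apply opair_inj in E as [-> ->]. now split.
  - intros [Hx ->]. eauto.
Qed.

Lemma app_lam a F x : dfun1 F -> x ∈ a -> app (lam a F) x = F x.
Proof.
  intros H Hx. apply app_eq. intros y'. rewrite opair_in_lam by exact H. tauto.
Qed.

Lemma app_lam_out a F x : dfun1 F -> ~ x ∈ a -> app (lam a F) x = empty.
Proof.
  intros H Hx. apply app_undef. intros y'. rewrite opair_in_lam by exact H. tauto.
Qed.

Lemma lam_ext a F G : (forall x, x ∈ a -> F x = G x) -> lam a F = lam a G.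
Proof.
  intros H. unfold lam, repl. f_equal. extensionality z.
  apply propositional_extensionality.
  split; intros (w & Hw & ->); exists w; split; auto; now rewrite H.
Qed.

Definition prod a b : M := union (repl a (fun x => repl b (fun y => opair x y))).

Lemma dterm_prod s t : dterm s -> dterm t -> dterm (fun e => prod (s e) (t e)).
Proof. intros. unfold prod. dfn. Qed.

Lemma in_prod a b p : p ∈ prod a b <-> exists x y, x ∈ a /\ y ∈ b /\ p = opair x y.
Proof.
  unfold prod. rewrite in_union. split.
  - intros (y & Hy & Hp). rewrite in_repl in Hy by dfn. destruct Hy as (w & Hw & ->).
    rewrite in_repl in Hp by dfn. destruct Hp as (v & Hv & ->). eauto.
  - intros (x & y & Hx & Hy & ->). exists (repl b (fun y => opair x y)).
    rewrite !in_repl by dfn. split; [now exists x | now exists y].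
Qed.

(** Being the graph of its own application on [a] says at once that [f] is single-valued with domain
    [a], and makes extensionality immediate. *)
Definition is_fun f a : Prop := f = lam a (app f).

Definition funs a b : M :=
  sep (power (prod a b)) (fun f => is_fun f a /\ forall x, x ∈ a -> app f x ∈ b).

End Functions.

Ltac dfn_functions := match goal with
  | |- dterm (fun e => app (@?s e) (@?t e)) => simple apply (dfun2_use app s t dfun2_app)
  | |- dterm (fun e => lam (@?t e) (@?F e)) => simple apply (dterm_lam t F)
  | |- dterm (fun e => prod (@?s e) (@?t e)) => simple apply (dterm_prod s t)
  | |- dterm (fun e => funs _ _) => unfold funs
  | |- defp (fun e => is_fun _ _) => unfold is_fun
  | |- _ => dfn_sets
  end.
Ltac dfn_ext ::= dfn_functions.

Section Functions2.
Context {M : set_structure} {HM : ZFC M}.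
Implicit Types x y z a b f : M.

Lemma is_fun_lam a F : dfun1 F -> is_fun (lam a F) a.
Proof.
  intros H. unfold is_fun. apply lam_ext. intros x Hx. now rewrite app_lam.
Qed.

Lemma fun_ext f g a : is_fun f a -> is_fun g a ->
  (forall x, x ∈ a -> app f x = app g x) -> f = g.
Proof. intros Hf Hg H. rewrite Hf, Hg. now apply lam_ext. Qed.

Lemma in_funs f a b : f ∈ funs a b <-> is_fun f a /\ forall x, x ∈ a -> app f x ∈ b.
Proof.
  unfold funs. rewrite in_sep by dfn. rewrite in_power. split; [tauto|].
  intros [H1 H2]. split; [|auto]. intros p Hp. rewrite H1 in Hp.
  rewrite in_lam in Hp by dfn. destruct Hp as (x & Hx & ->). apply in_prod. eauto 6.
Qed.

Lemma lam_in_funs a b F : dfun1 F -> (forall x, x ∈ a -> F x ∈ b) -> lam a F ∈ funs a b.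
Proof.
  intros HF H. apply in_funs. split; [now apply is_fun_lam|].
  intros x Hx. rewrite app_lam; auto.
Qed.

(* The value of [iota P] is [empty] when [P] does not determine a unique set. *)
Definition iota (P : M -> Prop) : M :=
  epsilon carrier_inhabited (fun y => (P y /\ forall y', P y' -> y' = y) \/
    (~ (exists y, P y /\ forall y', P y' -> y' = y) /\ y = empty)).

Lemma iota_spec P : (P (iota P) /\ forall y', P y' -> y' = iota P) \/
    (~ (exists y, P y /\ forall y', P y' -> y' = y) /\ iota P = empty).
Proof.
  apply (epsilon_spec carrier_inhabited (fun y => (P y /\ forall y', P y' -> y' = y) \/
    (~ (exists y, P y /\ forall y', P y' -> y' = y) /\ y = empty))).
  destruct (classic (exists y, P y /\ forall y', P y' -> y' = y)) as [[y H]|H].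
  - exists y. now left.
  - exists empty. right. now split.
Qed.

Lemma iota_eq (P : M -> Prop) y : P y -> (forall y', P y' -> y' = y) -> iota P = y.
Proof.
  intros H1 H2. destruct (iota_spec P) as [[H _]|[H _]].
  - now apply H2.
  - exfalso. apply H. eauto.
Qed.

Lemma iota_ext (P Q : M -> Prop) : (forall v, P v <-> Q v) -> iota P = iota Q.
Proof.
  intros H. f_equal. extensionality v. apply propositional_extensionality. apply H.
Qed.

Lemma dterm_iota (P : (nat -> M) -> M -> Prop) :
  defp (fun e => P (fun n => e (S n)) (e 0)) -> dterm (fun e => iota (P e)).
Proof.
  intros H. unfold dterm.
  assert (H1 : defp (fun e => P (fun n => e (S (S n))) (e 0))).
  { exact (defp_rename _ (fun n => match n with O => 0 | S n => S (S n) end) H). }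
  assert (H2 : defp (fun e => P (fun n => e (S (S (S n)))) (e 0))).
  { exact (defp_rename _ (fun n => match n with O => 0 | S n => S (S (S n)) end) H). }
  apply (defp_iff_compat (fun e =>
    (P (fun n => e (S n)) (e 0) /\ forall y', P (fun n => e (S n)) y' -> y' = e 0) \/
    (~ (exists y, P (fun n => e (S n)) y /\ forall y', P (fun n => e (S n)) y' -> y' = y)
     /\ e 0 = empty))).
  - intros e. split.
    + intros [[Ha Hb]|[Ha Hb]].
      * symmetry. now apply iota_eq.
      * destruct (iota_spec (P (fun n => e (S n)))) as [[Hc Hd]|[Hc Hd]]; [|congruence].
        exfalso. eauto.
    + intros ->. apply iota_spec.
  - dfn; first [exact H | exact H1 | exact H2].
Qed.

Definition cond (P : Prop) x y : M := iota (fun z => (P /\ z = x) \/ (~ P /\ z = y)).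

Lemma cond_true (P : Prop) x y : P -> cond P x y = x.
Proof. intros H. apply iota_eq; [now left | now intros y' [[_ ?]|[? _]]]. Qed.
Lemma cond_false (P : Prop) x y : ~ P -> cond P x y = y.
Proof. intros H. apply iota_eq; [now right | now intros y' [[? _]|[_ ?]]]. Qed.

Lemma dterm_cond (P : (nat -> M) -> Prop) s t :
  defp P -> dterm s -> dterm t -> dterm (fun e => cond (P e) (s e) (t e)).
Proof.
  intros HP Hs Ht. unfold cond.
  apply (dterm_iota (fun e z => (P e /\ z = s e) \/ (~ P e /\ z = t e))).
  pose proof (defp_rename _ S HP). dfn; assumption.
Qed.

End Functions2.

Ltac dfn_iota := match goal with
  | |- dterm (fun e => iota (@?P e)) => simple apply (dterm_iota P)
  | |- dterm (fun e => cond (@?P e) (@?s e) (@?t e)) => simple apply (dterm_cond P s t)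
  | |- _ => dfn_functions
  end.
Ltac dfn_ext ::= dfn_iota.

Section Projections.
Context {M : set_structure} {HM : ZFC M}.
Implicit Types x y p a b : M.

Definition pfst p : M := iota (fun x => exists y, p = opair x y).
Definition psnd p : M := iota (fun y => exists x, p = opair x y).

Lemma pfst_opair x y : pfst (opair x y) = x.
Proof. apply iota_eq; [eauto|]. intros x' [y' E]. now apply opair_inj in E as [-> _]. Qed.
Lemma psnd_opair x y : psnd (opair x y) = y.
Proof. apply iota_eq; [eauto|]. intros x' [y' E]. now apply opair_inj in E as [_ ->]. Qed.

Lemma dfun1_pfst : dfun1 pfst.
Proof. unfold pfst. dfn. Qed.
Lemma dfun1_psnd : dfun1 psnd.
Proof. unfold psnd. dfn. Qed.

Lemma app_lam_prod a b (H : M -> M -> M) x y : dfun1 (fun p => H (pfst p) (psnd p)) ->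
  x ∈ a -> y ∈ b -> app (lam (prod a b) (fun p => H (pfst p) (psnd p))) (opair x y) = H x y.
Proof.
  intros HH Hx Hy. rewrite app_lam; [now rewrite pfst_opair, psnd_opair|exact HH|].
  rewrite in_prod. eauto.
Qed.

End Projections.

Ltac dfn_projections := match goal with
  | |- dterm (fun e => pfst (@?t e)) => simple apply (dfun1_use pfst t dfun1_pfst)
  | |- dterm (fun e => psnd (@?t e)) => simple apply (dfun1_use psnd t dfun1_psnd)
  | |- _ => dfn_iota
  end.
Ltac dfn_ext ::= dfn_projections.

Section Choice.
Context {M : set_structure} {HM : ZFC M}.
Implicit Types x y z a b f : M.

Lemma choice_function a b (R : M -> M -> Prop) : dpred2 R ->
  (forall x, x ∈ a -> exists y, y ∈ b /\ R x y) ->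
  exists f, f ∈ funs a b /\ forall x, x ∈ a -> R x (app f x).
Proof.
  intros HR H.
  (* The axiom of choice is given for disjoint families; tagging the candidates for [x] with [x]
     makes them disjoint. *)
  set (fam := fun x => sep (prod (sing x) b) (fun p => exists y, p = opair x y /\ R x y)).
  assert (Hfam : forall x p, p ∈ fam x <-> exists y, y ∈ b /\ R x y /\ p = opair x y).
  { intros x p. unfold fam. rewrite in_sep by dfn. rewrite in_prod. split.
    - intros [(x' & y & Hx & Hy & ->) (y' & E & Hy')]. rewrite in_sing in Hx. subst x'.
      apply opair_inj in E as [_ ->]. eauto.
    - intros (y & Hy & Hr & ->). split; [|eauto].
      exists x, y. now rewrite in_sing. }
  assert (Hd : dfun1 fam). { unfold fam. dfn. }
  destruct (zfc_choice M HM (repl a fam)) as [c Hc].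
  - intros u Hu. rewrite in_repl in Hu by dfn. destruct Hu as (x & Hx & ->).
    destruct (H x Hx) as (y & Hy & Hr). exists (opair x y). apply Hfam. eauto.
  - intros u v p Hu Hv Hpu Hpv. rewrite in_repl in Hu, Hv by dfn.
    destruct Hu as (x & Hx & ->). destruct Hv as (x' & Hx' & ->).
    rewrite Hfam in Hpu, Hpv. destruct Hpu as (y & _ & _ & ->), Hpv as (y' & _ & _ & E).
    apply opair_inj in E as [-> _]. reflexivity.
  - set (G := fun x => iota (fun y => opair x y ∈ c /\ R x y /\ y ∈ b)).
    assert (HG : dfun1 G). { unfold G. dfn. }
    assert (HGs : forall x, x ∈ a -> G x ∈ b /\ R x (G x)).
    { intros x Hx. destruct (Hc (fam x)) as (p & [Hp1 Hp2] & Hp3).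
      { rewrite in_repl by dfn. eauto. }
      rewrite Hfam in Hp1. destruct Hp1 as (y & Hy & Hr & ->).
      assert (E : G x = y); [|now rewrite E].
      apply iota_eq; [now split|]. intros y' (H1 & H2 & H3).
      assert (E : opair x y = opair x y').
      { apply Hp3. split; [apply Hfam; eauto | exact H1]. }
      symmetry. now apply opair_inj in E. }
    exists (lam a G). split.
    + apply lam_in_funs; [exact HG | intros x Hx; now apply HGs].
    + intros x Hx. rewrite app_lam by assumption. now apply HGs.
Qed.

Lemma choice_of_elements a : exists c, forall x, x ∈ a -> nonempty x -> app c x ∈ x.
Proof.
  destruct (choice_function (sep a nonempty) (union a) (fun x y => y ∈ x)) as (c & _ & Hc).
  - dfn.
  - intros x Hx. rewrite in_sep in Hx by dfn. destruct Hx as [Hx [y Hy]].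
    exists y. split; [rewrite in_union; eauto | exact Hy].
  - exists c. intros x Hx Hn. apply Hc. rewrite in_sep by dfn. now split.
Qed.

Lemma minimal_element a (P : M -> Prop) : dpred1 P -> (exists x, x ∈ a /\ P x) ->
  exists x, x ∈ a /\ P x /\ forall y, y ∈ a -> y ∈ x -> ~ P y.
Proof.
  intros HP [x [Hx Px]].
  destruct (zfc_foundation M HM (sep a P)) as (y & Hy & Hmin).
  - exists x. rewrite in_sep by exact HP. now split.
  - rewrite in_sep in Hy by exact HP. exists y. split; [tauto|split; [tauto|]].
    intros z Hz Hzy Pz. apply (Hmin z Hzy). rewrite in_sep by exact HP. now split.
Qed.

Lemma mem_irrefl x : ~ x ∈ x.
Proof.
  intros H. destruct (minimal_element (sing x) (fun _ => True)) as (y & Hy & _ & Hm).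
  - dfn.
  - exists x. now rewrite in_sing.
  - rewrite in_sing in Hy. subst y. apply (Hm x); [now apply in_sing | exact H | exact I].
Qed.

Lemma mem_asym x y : x ∈ y -> ~ y ∈ x.
Proof.
  intros H1 H2. destruct (minimal_element (upair x y) (fun _ => True)) as (z & Hz & _ & Hm).
  - dfn.
  - exists x. rewrite in_upair. auto.
  - rewrite in_upair in Hz. destruct Hz as [->| ->].
    + apply (Hm y); [apply in_upair; now right | exact H2 | exact I].
    + apply (Hm x); [apply in_upair; now left | exact H1 | exact I].
Qed.

End Choice.

(** * Recursion, ordinals and cardinals *)

Section Recursion.
Context {M : set_structure} {HM : ZFC M}.
Implicit Types x y z a b f d : M.

Definition wf_on (E : M -> M -> Prop) a : Prop :=
  forall b, b ⊆ a -> nonempty b -> exists x, x ∈ b /\ forall y, y ∈ b -> ~ E y x.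

Lemma wf_on_mem a : wf_on mem a.
Proof.
  intros b _ [x Hx]. destruct (zfc_foundation M HM b (ex_intro _ x Hx)) as (y & Hy & H).
  exists y. split; [exact Hy|]. intros z Hz Hzy. exact (H z Hzy Hz).
Qed.

Lemma wf_induction (E : M -> M -> Prop) a (P : M -> Prop) :
  wf_on E a -> dpred1 P ->
  (forall x, x ∈ a -> (forall y, y ∈ a -> E y x -> P y) -> P x) -> forall x, x ∈ a -> P x.
Proof.
  intros Hwf HP Hstep x Hx. apply NNPP. intros Hn.
  destruct (Hwf (sep a (fun x => ~ P x))) as (m & Hm & Hmin).
  - intros y Hy. rewrite in_sep in Hy by dfn. tauto.
  - exists x. rewrite in_sep by dfn. now split.
  - rewrite in_sep in Hm by dfn. destruct Hm as [Hm1 Hm2]. apply Hm2, Hstep; [exact Hm1|].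
    intros y Hy Hym. apply NNPP. intros Hny. apply (Hmin y); [|exact Hym].
    rewrite in_sep by dfn. now split.
Qed.

Section WfRec.
Variables (E : M -> M -> Prop) (a : M) (G : M -> M -> M).
Hypotheses (HE : dpred2 E) (Hwf : wf_on E a) (HG : dfun2 G).

Let pre x := sep a (fun y => E y x).
Let approx p d := d ⊆ a /\ (forall x y, x ∈ d -> y ∈ a -> E y x -> y ∈ d) /\
  forall x, x ∈ d -> app p x = G x (lam (pre x) (app p)).

Lemma wf_recursion_agree p d q d' : approx p d -> approx q d' ->
  forall x, x ∈ a -> x ∈ d -> x ∈ d' -> app p x = app q x.
Proof.
  intros (H1 & H2 & H3) (H1' & H2' & H3').
  apply (wf_induction E a (fun x => x ∈ d -> x ∈ d' -> app p x = app q x) Hwf); [dfn|].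
  intros x Hx IH Hd Hd'. rewrite H3, H3' by assumption. f_equal.
  apply lam_ext. intros y Hy. unfold pre in Hy. rewrite in_sep in Hy by dfn.
  destruct Hy. apply IH; eauto.
Qed.

Lemma wf_recursion : exists f, is_fun f a /\
  forall x, x ∈ a -> app f x = G x (lam (sep a (fun y => E y x)) (app f)).
Proof.
  set (D := sep a (fun y => exists p d, approx p d /\ y ∈ d)).
  assert (Hap : dpred2 approx). { unfold approx, pre. dfn. }
  assert (HD : forall y, y ∈ D <-> y ∈ a /\ exists p d, approx p d /\ y ∈ d).
  { intros y. unfold D. rewrite in_sep by dfn. tauto. }
  set (F := fun y => iota (fun z => exists p d, approx p d /\ y ∈ d /\ z = app p y)).
  assert (HF : dfun1 F). { unfold F. dfn. }
  assert (HFs : forall p d y, approx p d -> y ∈ d -> F y = app p y).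
  { intros p d y Hp Hy. apply iota_eq.
    - eauto.
    - intros z (p' & d' & Hp' & Hy' & ->). eapply wf_recursion_agree; eauto.
      apply Hp. exact Hy. }
  set (f := lam D F).
  assert (Hf : forall y, y ∈ D -> app f y = F y). { intros y Hy. now apply app_lam. }
  assert (HfD : approx f D).
  { split; [|split].
    - intros y Hy. now apply HD.
    - intros x y Hx Hy Hyx. apply HD in Hx as (Hx & p & d & Hp & Hxd). apply HD.
      split; [exact Hy|]. exists p, d. split; [exact Hp|]. destruct Hp as (_ & H & _). eauto.
    - intros x Hx. rewrite Hf by exact Hx. apply HD in Hx as (Hx & p & d & Hp & Hxd).
      rewrite (HFs p d) by assumption. pose proof Hp as (Hp1 & Hp2 & Hp3).
      rewrite Hp3 by exact Hxd. f_equal. apply lam_ext. intros y Hy.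
      unfold pre in Hy. rewrite in_sep in Hy by dfn. destruct Hy as [Hy Hyx].
      assert (Hyd : y ∈ d) by eauto.
      rewrite Hf; [symmetry; eauto|]. apply HD. eauto 6. }
  assert (Hall : forall x, x ∈ a -> x ∈ D).
  { apply (wf_induction E a (fun x => x ∈ D) Hwf); [dfn|].
    intros x Hx IH. apply NNPP. intros Hn.
    set (v := G x (lam (pre x) (app f))).
    (* Adding the one value that the recursion prescribes at [x] gives a larger approximation, so no
       [x] can be missing from [D]. *)
    set (q := lam (cup D (sing x)) (fun y => cond (y = x) v (app f y))).
    assert (Hq1 : forall y, y ∈ D -> app q y = app f y).
    { intros y Hy. unfold q. rewrite app_lam; [|dfn|rewrite in_cup; now left].
      apply cond_false. congruence. }
    assert (Hq2 : app q x = v).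
    { unfold q. rewrite app_lam; [|dfn|rewrite in_cup, in_sing; now right].
      now apply cond_true. }
    apply Hn, HD. split; [exact Hx|]. exists q, (cup D (sing x)).
    rewrite in_cup, in_sing. split; [|now right].
    destruct HfD as (H1 & H2 & H3).
    split; [|split].
    - intros y. rewrite in_cup, in_sing. intros [Hy| ->]; auto.
    - intros y z Hy Hz Hzy. rewrite in_cup, in_sing in *. destruct Hy as [Hy| ->]; eauto.
    - intros y. rewrite in_cup, in_sing. intros [Hy| ->].
      + rewrite Hq1, H3 by exact Hy. f_equal. apply lam_ext. intros z Hz.
        unfold pre in Hz. rewrite in_sep in Hz by dfn. destruct Hz.
        symmetry. eauto.
      + rewrite Hq2. unfold v. f_equal. apply lam_ext. intros z Hz.
        unfold pre in Hz. rewrite in_sep in Hz by dfn. destruct Hz.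
        symmetry. eauto. }
  assert (ED : D = a). { apply subset_antisym; [apply HfD | exact Hall]. }
  exists f. split.
  - rewrite <- ED. now apply is_fun_lam.
  - intros x Hx. apply HfD. auto.
Qed.
End WfRec.
End Recursion.

(** * Ordinals and omega *)

Section Ordinals.
Context {M : set_structure} {HM : ZFC M}.
Implicit Types x y z a b c f n w : M.

Lemma ordinal_iff a : is_ordinal a <-> transitive a /\ forall x, x ∈ a -> transitive x.
Proof.
  split.
  - intros (Ht & _ & Htr & _). split; [exact Ht|].
    intros x Hx y Hy z Hz. pose proof (Ht x Hx y Hy) as Hya.
    exact (Htr z y x (Ht y Hya z Hz) Hya Hx Hz Hy).
  - intros [Ht Hx].
    assert (Htot : forall x y, x ∈ a -> y ∈ a -> x ∈ y \/ x = y \/ y ∈ x).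
    { apply NNPP. intros Hn.
      (* Take a minimal [x] that is incomparable with something, then a minimal [y] incomparable
         with [x]: by both minimalities they have the same elements. *)
      destruct (minimal_element a (fun x => exists y, y ∈ a /\ ~ (x ∈ y \/ x = y \/ y ∈ x)))
        as (x & Hxa & (y0 & Hy0) & Hxm); [dfn| |].
      { apply NNPP. intros Hn2. apply Hn. intros x y Hxa Hya. apply NNPP.
        intros H. apply Hn2. exists x. split; [exact Hxa|]. now exists y. }
      destruct (minimal_element a (fun y => ~ (x ∈ y \/ x = y \/ y ∈ x)))
        as (y & Hya & Hy & Hym); [dfn | exists y0; tauto |].
      apply Hy. right. left. apply subset_antisym; intros z Hz.
      - assert (Hza : z ∈ a) by exact (Ht x Hxa z Hz).
        destruct (classic (z ∈ y \/ z = y \/ y ∈ z)) as [[H|[E|H]]|H];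
          [exact H | exfalso; subst z; tauto | |].
        + exfalso. apply Hy. right. right. exact (Hx x Hxa z Hz y H).
        + exfalso. apply (Hxm z); eauto.
      - assert (Hza : z ∈ a) by exact (Ht y Hya z Hz).
        destruct (classic (x ∈ z \/ x = z \/ z ∈ x)) as [[H|[E|H]]|H];
          [| exfalso; subst z; tauto | exact H |].
        + exfalso. apply Hy. left. exact (Hx y Hya z Hz x H).
        + exfalso. now apply (Hym z). }
    split; [exact Ht|]. split; [|split; [|split]].
    + intros x _. apply mem_irrefl.
    + intros x y z _ _ Hz Hxy Hyz. exact (Hx z Hz y Hyz x Hxy).
    + exact Htot.
    + intros s Hs [x Hxs]. destruct (wf_on_mem a s Hs) as (m & Hm & Hmin); [now exists x|].
      exists m. split; [exact Hm|]. intros y Hy.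
      destruct (Htot m y) as [H|[H|H]]; auto. exfalso. eapply Hmin; eauto.
Qed.

Lemma dpred1_ordinal : dpred1 (M:=M) is_ordinal.
Proof.
  apply (defp_iff_compat (fun e => transitive (e 0) /\ forall x, x ∈ e 0 -> transitive x)).
  - intros e. now rewrite ordinal_iff.
  - dfn.
Qed.

Lemma ordinal_transitive a : is_ordinal a -> transitive a.
Proof. now intros []. Qed.

Lemma ordinal_trans a x y : is_ordinal a -> x ∈ a -> y ∈ x -> y ∈ a.
Proof. intros Ha Hx Hy. exact (ordinal_transitive a Ha x Hx y Hy). Qed.

Lemma ordinal_mem a x : is_ordinal a -> x ∈ a -> is_ordinal x.
Proof.
  rewrite !ordinal_iff. intros [Ht Hx] H. split; [auto|]. intros y Hy. apply Hx. eapply Ht; eauto.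
Qed.

Lemma ordinal_total a b : is_ordinal a -> is_ordinal b -> a ∈ b \/ a = b \/ b ∈ a.
Proof.
  intros Ha Hb.
  assert (Hc : is_ordinal (cup (cup a b) (upair a b))).
  { apply ordinal_iff. rewrite ordinal_iff in Ha, Hb. destruct Ha as [Ha Ha'], Hb as [Hb Hb'].
    split.
    - intros x Hx y Hy. rewrite !in_cup, in_upair in *.
      destruct Hx as [[Hx|Hx]|[->| ->]]; left; [left|right|left|right]; auto;
        [exact (Ha x Hx y Hy) | exact (Hb x Hx y Hy)].
    - intros x Hx. rewrite !in_cup, in_upair in *.
      destruct Hx as [[Hx|Hx]|[->| ->]]; auto. }
  destruct Hc as (_ & _ & _ & Ht & _). apply Ht; rewrite in_cup, in_upair; auto.
Qed.

Lemma ordinal_subset_or a b : is_ordinal a -> is_ordinal b -> a ⊆ b \/ b ∈ a.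
Proof.
  intros Ha Hb. destruct (ordinal_total a b Ha Hb) as [H|[->|H]]; auto.
  - left. apply Hb. exact H.
  - left. apply subset_refl.
Qed.

Lemma ordinal_subset_mem a b c : is_ordinal c -> is_ordinal a -> a ⊆ b -> b ∈ c -> a ∈ c.
Proof.
  intros Hc Ha Hab Hb. pose proof (ordinal_mem c b Hc Hb) as Hbo.
  destruct (ordinal_total a b Ha Hbo) as [H|[->|H]]; auto.
  - exact (ordinal_trans c b a Hc Hb H).
  - exfalso. exact (mem_irrefl b (Hab _ H)).
Qed.

Lemma ordinal_succ a : is_ordinal a -> is_ordinal (succ a).
Proof.
  rewrite !ordinal_iff. intros [Ht Hx]. split.
  - intros x Hxs y Hy. rewrite in_succ in *. left. destruct Hxs as [H| ->]; auto.
    exact (Ht x H y Hy).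
  - intros x. rewrite in_succ. intros [H| ->]; auto.
Qed.

Lemma ordinal_union a : (forall x, x ∈ a -> is_ordinal x) -> is_ordinal (union a).
Proof.
  intros H. apply ordinal_iff. split.
  - intros x Hx y Hy. rewrite in_union in *. destruct Hx as (z & Hz & Hxz).
    exists z. split; [exact Hz|]. exact (ordinal_trans z x y (H z Hz) Hxz Hy).
  - intros x Hx. rewrite in_union in Hx. destruct Hx as (z & Hz & Hxz).
    apply (ordinal_mem z); auto.
Qed.

Lemma ordinal_empty : is_ordinal (empty : M).
Proof.
  apply ordinal_iff. split; [intros x Hx | intros x Hx]; now apply in_empty in Hx.
Qed.

Lemma empty_mem a : is_ordinal a -> nonempty a -> empty ∈ a.
Proof.
  intros Ha [x Hx]. destruct (ordinal_total empty a ordinal_empty Ha) as [H|[<-|H]]; auto.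
  - now apply in_empty in Hx.
  - now apply in_empty in H.
Qed.

Lemma ordinal_cup_mem a b c : is_ordinal c -> a ∈ c -> b ∈ c -> cup a b ∈ c.
Proof.
  intros Hc Ha Hb.
  assert (H : cup a b = a \/ cup a b = b).
  { pose proof (ordinal_mem _ _ Hc Ha) as Hao. pose proof (ordinal_mem _ _ Hc Hb) as Hbo.
    destruct (ordinal_subset_or a b Hao Hbo) as [H|H]; [right | left]; apply set_ext; intros z;
      rewrite in_cup; split; auto; intros [Hz|Hz]; auto.
    exact (ordinal_transitive a Hao b H z Hz). }
  destruct H as [->| ->]; assumption.
Qed.

Lemma ordinal_cup_mem_inv a b c : is_ordinal a -> is_ordinal b -> is_ordinal c ->
  cup a b ∈ c -> a ∈ c /\ b ∈ c.
Proof.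
  intros Ha Hb Hc H. split; apply (ordinal_subset_mem _ (cup a b)); auto;
    intros z Hz; rewrite in_cup; auto.
Qed.

Lemma least_ordinal (P : M -> Prop) a : dpred1 P -> is_ordinal a -> P a ->
  exists b, is_ordinal b /\ b ⊆ a /\ P b /\ forall x, x ∈ b -> ~ P x.
Proof.
  intros HP Ha Pa.
  destruct (minimal_element (succ a) P HP) as (b & Hb & Pb & Hm).
  { exists a. rewrite in_succ. auto. }
  pose proof (ordinal_succ a Ha) as Hs.
  exists b. split; [eapply ordinal_mem; eauto|]. split.
  - rewrite in_succ in Hb. destruct Hb as [Hb| ->]; [now apply Ha | apply subset_refl].
  - split; [exact Pb|]. intros x Hx. apply Hm; [|exact Hx]. exact (ordinal_trans _ b x Hs Hb Hx).
Qed.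

Lemma ordinal_induction (P : M -> Prop) a : dpred1 P -> is_ordinal a ->
  (forall b, is_ordinal b -> (forall x, x ∈ b -> P x) -> P b) -> P a.
Proof.
  intros HP Ha H. apply NNPP. intros Hn.
  destruct (least_ordinal (fun x => ~ P x) a) as (b & Hb & _ & Hnb & Hm); [dfn|auto|auto|].
  apply Hnb, H; auto. intros x Hx. apply NNPP. now apply Hm.
Qed.

Lemma limit_succ a x : is_ordinal a -> (forall x, x ∈ a -> exists y, y ∈ a /\ x ∈ y) ->
  x ∈ a -> succ x ∈ a.
Proof.
  intros Ha Hl Hx. destruct (Hl x Hx) as (y & Hy & Hxy).
  pose proof (ordinal_mem a x Ha Hx) as Hxo. pose proof (ordinal_mem a y Ha Hy) as Hyo.
  apply (ordinal_subset_mem (succ x) y); auto using ordinal_succ.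
  intros z. rewrite in_succ. intros [Hz| ->]; auto. exact (ordinal_trans y x z Hyo Hxy Hz).
Qed.

End Ordinals.

Ltac dfn_ordinals := match goal with
  | |- defp (fun e => is_ordinal (@?t e)) => simple apply (dpred1_use is_ordinal t dpred1_ordinal)
  | |- _ => dfn_projections
  end.
Ltac dfn_ext ::= dfn_ordinals.

Section Omega.
Context {M : set_structure} {HM : ZFC M}.
Implicit Types x y z a b c f n : M.
Variable w : M.
Hypothesis Hw : is_omega w.

Lemma omega_ordinal : is_ordinal w.
Proof. apply Hw. Qed.

Lemma omega_empty : empty ∈ w.
Proof. apply empty_mem; apply Hw. Qed.

Lemma omega_succ n : n ∈ w -> succ n ∈ w.
Proof. apply limit_succ; apply Hw. Qed.

Lemma omega_induction (P : M -> Prop) : dpred1 P -> P empty ->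
  (forall n, n ∈ w -> P n -> P (succ n)) -> forall n, n ∈ w -> P n.
Proof.
  intros HP H0 HS n Hn. apply NNPP. intros Hnn.
  destruct (minimal_element w (fun x => ~ P x)) as (m & Hm & Hnm & Hmin); [dfn | eauto |].
  pose proof (ordinal_mem w m omega_ordinal Hm) as Hmo.
  destruct (classic (nonempty m)) as [Hne|He].
  (* As an element of [w], the nonempty [m] is no limit ordinal, so it has a greatest element [x],
     and [m = succ x]. *)
  - destruct (classic (exists x, x ∈ m /\ forall y, y ∈ m -> ~ x ∈ y)) as [(x & Hx & Hmax)|Hl].
    + assert (Hxw : x ∈ w) by exact (ordinal_trans w m x omega_ordinal Hm Hx).
      apply Hnm. replace m with (succ x).
      * apply HS; [exact Hxw|]. apply NNPP. now apply Hmin.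
      * apply set_ext. intros z. rewrite in_succ. split.
        -- intros [Hz| ->]; auto. exact (ordinal_trans m x z Hmo Hx Hz).
        -- intros Hz.
           destruct (ordinal_total z x) as [H|[H|H]]; eauto using ordinal_mem.
           exfalso. exact (Hmax z Hz H).
    + apply (proj2 Hw m Hm). split; [exact Hmo|split; [exact Hne|]].
      intros x Hx. apply NNPP. intros H. apply Hl. exists x. split; [exact Hx|].
      intros y Hy Hxy. eauto.
  - apply Hnm. rewrite (empty_eq m); [exact H0|]. intros z Hz. apply He. now exists z.
Qed.

Lemma union_succ x : transitive x -> union (succ x) = x.
Proof.
  intros Hx. apply set_ext. intros z. rewrite in_union. split.
  - intros (y & Hy & Hz). rewrite in_succ in Hy. destruct Hy as [Hy| ->]; auto. exact (Hx y Hy z Hz).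
  - intros Hz. exists x. rewrite in_succ. auto.
Qed.

Lemma omega_recursion a0 (N : M -> M) : dfun1 N ->
  exists f, app f empty = a0 /\ forall n, n ∈ w -> app f (succ n) = N (app f n).
Proof.
  intros HN.
  (* [union] serves as the predecessor on successors. *)
  destruct (wf_recursion mem w (fun n h => cond (n = empty) a0 (N (app h (union n)))))
    as (f & _ & Hf); [dfn | apply wf_on_mem | dfn |].
  exists f. split.
  - rewrite Hf by apply omega_empty. now apply cond_true.
  - intros n Hn. rewrite Hf by now apply omega_succ.
    rewrite cond_false.
    + rewrite union_succ by (eapply ordinal_mem; [exact omega_ordinal|exact Hn]).
      rewrite app_lam; [reflexivity|dfn|]. rewrite in_sep by dfn.
      split; [exact Hn|]. rewrite in_succ. auto.
    + intros E. apply (in_empty n). rewrite <- E, in_succ. auto.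
Qed.

(** The union of the iterated unions of [x]. The collapse needs some transitive superset, not the
    least one. *)
Lemma transitive_cover x : exists t, transitive t /\ x ⊆ t.
Proof.
  destruct (omega_recursion x union) as (f & H0 & HS); [dfn|].
  exists (union (repl w (app f))). split.
  - intros y Hy z Hz. rewrite in_union in *. destruct Hy as (u & Hu & Hy).
    rewrite in_repl in Hu by dfn. destruct Hu as (n & Hn & ->).
    exists (app f (succ n)). split.
    + rewrite in_repl by dfn. exists (succ n). auto using omega_succ.
    + rewrite HS, in_union by exact Hn. eauto.
  - intros z Hz. rewrite in_union. exists x. split; [|exact Hz].
    rewrite in_repl by dfn. exists empty. auto using omega_empty.
Qed.

End Omega.

(** * Bijections and successor cardinals *)

Section Bijections.
Context {M : set_structure} {HM : ZFC M}.
Implicit Types x y z a b c f n p : M.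

Lemma is_pair_iff p x y : is_pair p x y <-> p = opair x y.
Proof.
  split.
  - intros H. apply set_ext. intros z. rewrite (H z). unfold opair. rewrite in_upair.
    split; intros [E|E]; [left|right|left|right].
    + apply set_ext. intros u. rewrite in_sing. apply E.
    + apply set_ext. intros u. rewrite in_upair. apply E.
    + subst z. intros u. apply in_sing.
    + subst z. intros u. apply in_upair.
  - intros -> z. unfold opair. rewrite in_upair.
    split; intros [E|E]; [left|right|left|right].
    + subst z. intros u. apply in_sing.
    + subst z. intros u. apply in_upair.
    + apply set_ext. intros u. rewrite in_sing. apply E.
    + apply set_ext. intros u. rewrite in_upair. apply E.
Qed.

Lemma maps_iff f x y : maps f x y <-> opair x y ∈ f.
Proof.
  split.
  - intros (p & Hp & E). apply is_pair_iff in E. now subst.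
  - intros H. exists (opair x y). split; [exact H|]. now apply is_pair_iff.
Qed.

Lemma bijection_lam a b (F : M -> M) : dfun1 F ->
  (forall x, x ∈ a -> F x ∈ b) ->
  (forall x y, x ∈ a -> y ∈ a -> F x = F y -> x = y) ->
  (forall y, y ∈ b -> exists x, x ∈ a /\ F x = y) ->
  is_bijection (lam a F) a b.
Proof.
  intros HF H1 H2 H3.
  assert (Hm : forall x y, maps (lam a F) x y <-> x ∈ a /\ y = F x).
  { intros x y. rewrite maps_iff. now apply opair_in_lam. }
  split; [split|].
  - intros p Hp. rewrite in_lam in Hp by exact HF. destruct Hp as (x & Hx & ->).
    exists x, (F x). rewrite is_pair_iff. auto.
  - intros x Hx. exists (F x). split; [apply Hm; auto|]. intros y Hy. apply Hm in Hy. now symmetry.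
  - intros y Hy. destruct (H3 y Hy) as (x & Hx & E). exists x. split; [apply Hm; auto|].
    intros x' Hx'. apply Hm in Hx' as [Hx' E']. apply H2; congruence.
Qed.

Lemma bijection_app f a b : is_bijection f a b ->
  (forall x, x ∈ a -> app f x ∈ b) /\
  (forall x y, x ∈ a -> y ∈ a -> app f x = app f y -> x = y) /\
  (forall y, y ∈ b -> exists x, x ∈ a /\ app f x = y).
Proof.
  intros [[H1 H2] H3].
  assert (Hf : forall x y, opair x y ∈ f -> x ∈ a /\ y ∈ b /\ app f x = y).
  { intros x y Hp. destruct (H1 _ Hp) as (x' & y' & Hx & Hy & E). apply is_pair_iff in E.
    apply opair_inj in E as [<- <-]. split; [exact Hx|split; [exact Hy|]].
    apply app_eq. intros y'. destruct (H2 x Hx) as (u & Hu & Hu').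
    assert (u = y) by (apply Hu'; now apply maps_iff). subst u. split.
    - intros H. symmetry. apply Hu'. now apply maps_iff.
    - now intros ->. }
  assert (Ha : forall x, x ∈ a -> opair x (app f x) ∈ f).
  { intros x Hx. destruct (H2 x Hx) as (y & Hy & _). apply maps_iff in Hy.
    destruct (Hf x y Hy) as (_ & _ & ->). exact Hy. }
  split; [|split].
  - intros x Hx. apply (Hf x), Ha, Hx.
  - intros x y Hx Hy E. pose proof (Ha x Hx) as Hpx. pose proof (Ha y Hy) as Hpy.
    destruct (H3 (app f x)) as (u & _ & Hu); [apply (Hf x), Hpx|].
    rewrite <- (Hu x) by now apply maps_iff. apply Hu. apply maps_iff. now rewrite E.
  - intros y Hy. destruct (H3 y Hy) as (x & Hx & _). apply maps_iff in Hx.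
    exists x. split; apply (Hf _ _ Hx).
Qed.

Lemma bijection_inverse f a b : is_bijection f a b -> exists g, is_bijection g b a.
Proof.
  intros H. apply bijection_app in H as (H1 & H2 & H3).
  set (G := fun y => iota (fun x => x ∈ a /\ app f x = y)).
  assert (HG : forall x, x ∈ a -> G (app f x) = x).
  { intros x Hx. apply iota_eq; [now split|]. intros x' [Hx' E]. auto. }
  assert (dfun1 G) by (unfold G; dfn).
  exists (lam b G). apply bijection_lam; [assumption|..].
  - intros y Hy. destruct (H3 y Hy) as (x & Hx & <-). now rewrite HG.
  - intros y y' Hy Hy'. destruct (H3 y Hy) as (x & Hx & <-). destruct (H3 y' Hy') as (x' & Hx' & <-).
    rewrite !HG by assumption. congruence.
  - intros x Hx. exists (app f x). auto.
Qed.

Lemma bijection_compose f g a b c : is_bijection f a b -> is_bijection g b c ->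
  exists h, is_bijection h a c.
Proof.
  intros Hf Hg. apply bijection_app in Hf as (F1 & F2 & F3). apply bijection_app in Hg as (G1 & G2 & G3).
  exists (lam a (fun x => app g (app f x))). apply bijection_lam; [dfn|auto|auto|].
  intros z Hz. destruct (G3 z Hz) as (y & Hy & <-). destruct (F3 y Hy) as (x & Hx & <-). eauto.
Qed.

Lemma dpred_bijection s t u : dterm s -> dterm t -> dterm u ->
  defp (fun e : nat -> M => is_bijection (s e) (t e) (u e)).
Proof.
  intros Hs Ht Hu. unfold is_bijection, is_function, maps, is_pair. dfn.
Qed.

Lemma schroeder_bernstein_subset a b (F : M -> M) : dfun1 F -> a ⊆ b ->
  (forall x, x ∈ b -> F x ∈ a) ->
  (forall x y, x ∈ b -> y ∈ b -> F x = F y -> x = y) ->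
  exists f, is_bijection f b a.
Proof.
  intros HF Hab H1 H2.
  (* The least closed set [C] is the orbit under [F] of the part of [b] outside [a]. The bijection
     is [F] on [C] and the identity elsewhere. *)
  set (closed := fun Y => (forall y, y ∈ b -> ~ y ∈ a -> y ∈ Y) /\
    forall y, y ∈ b -> y ∈ Y -> F y ∈ Y).
  assert (Hcl : dpred1 closed) by (unfold closed; dfn).
  set (C := sep b (fun x => forall Y, closed Y -> x ∈ Y)).
  assert (HC : forall x, x ∈ C <-> x ∈ b /\ forall Y, closed Y -> x ∈ Y).
  { intros x. unfold C. rewrite in_sep by dfn. tauto. }
  assert (HCc : closed C).
  { split.
    - intros y Hy Hya. apply HC. split; [exact Hy|]. intros Y [HY _]. auto.
    - intros y Hy HyC. apply HC. split; [auto|]. intros Y HY. apply HY; [exact Hy|].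
      apply HC in HyC. now apply HyC. }
  exists (lam b (fun x => cond (x ∈ C) (F x) x)). apply bijection_lam.
  - dfn.
  - intros x Hx. destruct (classic (x ∈ C)) as [H|H].
    + rewrite cond_true by exact H. auto.
    + rewrite cond_false by exact H. apply NNPP. intros Hn. apply H. now apply HCc.
  - intros x y Hx Hy. destruct (classic (x ∈ C)) as [H|H], (classic (y ∈ C)) as [H'|H'].
    + rewrite !cond_true by assumption. auto.
    + rewrite cond_true, cond_false by assumption. intros E. exfalso. apply H'. rewrite <- E.
      now apply HCc.
    + rewrite cond_false, cond_true by assumption. intros E. exfalso. apply H. rewrite E.
      now apply HCc.
    + now rewrite !cond_false by assumption.
  - intros y Hy. destruct (classic (y ∈ C)) as [H|H].
    + apply NNPP. intros Hn.
      (* If [y ∈ C] were not attained, removing it from [C] would leave a closed set, against the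
         leastness of [C]. *)
      assert (Hcy : closed (sep C (fun z => z <> y))).
      { split.
        - intros z Hz Hza. rewrite in_sep by dfn. split; [now apply HCc | congruence].
        - intros z Hz HzC. rewrite in_sep in * by dfn. destruct HzC as [HzC Hzy].
          split; [now apply HCc|]. intros E. apply Hn. exists z. split; [exact Hz|].
          now rewrite cond_true. }
      apply HC in H as [_ H]. specialize (H _ Hcy). rewrite in_sep in H by dfn. tauto.
    + exists y. split; [auto|]. now apply cond_false.
Qed.

End Bijections.

Section SuccessorCardinal.
Context {M : set_structure} {HM : ZFC M}.
Variables k kp : M.
Hypothesis (Hk : is_ordinal k) (Hkp : is_successor_cardinal k kp).

Lemma succ_card_ordinal : is_ordinal kp.
Proof. apply Hkp. Qed.

Lemma no_injection_succ_card (F : M -> M) : dfun1 F ->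
  (forall x, x ∈ kp -> F x ∈ k) ->
  (forall x y, x ∈ kp -> y ∈ kp -> F x = F y -> x = y) -> False.
Proof.
  intros HF H1 H2. destruct Hkp as ([Ho Hc] & Hkk & _).
  destruct (schroeder_bernstein_subset k kp F) as [f Hf]; auto.
  - now apply Ho.
  - apply bijection_inverse in Hf. exact (Hc k Hkk Hf).
Qed.

(** The least ordinal equinumerous with [g] is a cardinal contained in [k]: otherwise it would
    contain [kp], and [g ∈ g] would follow. *)
Lemma injection_below_succ_card g : g ∈ kp ->
  exists f, f ∈ funs g k /\ forall x y, x ∈ g -> y ∈ g -> app f x = app f y -> x = y.
Proof.
  intros Hg. destruct Hkp as ([Ho Hc] & Hkk & Hmin).
  assert (Hgo : is_ordinal g) by (eapply ordinal_mem; eauto).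
  destruct (least_ordinal (fun c => exists f, is_bijection f c g) g) as (c & Hco & Hcg & [f Hf] & Hcm).
  - unfold dpred1. dfn. apply dpred_bijection; dfn.
  - exact Hgo.
  - exists (lam g (fun x => x)). apply bijection_lam; [dfn|auto|auto|eauto].
  - assert (Hcc : is_cardinal c).
    { split; [exact Hco|]. intros d Hd [h Hh]. apply (Hcm d Hd).
      exact (bijection_compose h f d c g Hh Hf). }
    assert (Hck : c ⊆ k).
    { destruct (ordinal_subset_or c k Hco Hk) as [H|H]; [exact H|].
      exfalso. apply (mem_irrefl g). apply Hcg, (Hmin c Hcc H g Hg). }
    destruct (bijection_inverse f c g Hf) as [h Hh].
    apply bijection_app in Hh as (B1 & B2 & _).
    exists (lam g (app h)). split.
    + apply lam_in_funs; [dfn|auto].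
    + intros x y Hx Hy. rewrite !app_lam by (dfn || assumption). auto.
Qed.

Lemma succ_inj (x y : M) : succ x = succ y -> x = y.
Proof.
  intros E.
  assert (Hx : x ∈ succ y) by (rewrite <- E; apply in_succ; auto).
  assert (Hy : y ∈ succ x) by (rewrite E; apply in_succ; auto).
  rewrite in_succ in Hx, Hy. destruct Hx as [Hx|Hx]; [|exact Hx].
  destruct Hy as [Hy|Hy]; [|now symmetry]. exfalso. exact (mem_asym _ _ Hx Hy).
Qed.

(** Otherwise [kp = succ x], and an injection of [x] into [k] extends to [kp]: shift its values by
    [succ] and send [x] to the freed value [empty]. *)
Lemma succ_card_limit x : (forall y, y ∈ k -> succ y ∈ k) -> nonempty k ->
  x ∈ kp -> succ x ∈ kp.
Proof.
  intros Hks Hkn Hx. pose proof succ_card_ordinal as Ho.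
  assert (Hxo : is_ordinal x) by (eapply ordinal_mem; eauto).
  destruct (ordinal_total (succ x) kp) as [H|[H|H]]; auto using ordinal_succ.
  - exfalso. destruct (injection_below_succ_card x Hx) as (f & Hf & Hinj).
    apply in_funs in Hf as [_ Hf].
    apply (no_injection_succ_card (fun z => cond (z = x) empty (succ (app f z)))).
    + dfn.
    + intros z Hz. rewrite <- H, in_succ in Hz. destruct (classic (z = x)) as [->|Hn].
      * rewrite cond_true by reflexivity. now apply empty_mem.
      * rewrite cond_false by exact Hn. apply Hks, Hf. tauto.
    + intros y z Hy Hz. rewrite <- H, in_succ in Hy, Hz.
      assert (He : forall u : M, succ u <> empty).
      { intros u E. apply (in_empty u). rewrite <- E. apply in_succ. auto. }
      destruct (classic (y = x)) as [->|Hn], (classic (z = x)) as [->|Hn'];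
        repeat first [rewrite cond_true by reflexivity | rewrite cond_false by assumption]; intros E.
      * reflexivity.
      * exfalso. now apply (He (app f z)).
      * exfalso. now apply (He (app f y)).
      * apply succ_inj in E. apply Hinj; tauto.
  - exfalso. rewrite in_succ in H. destruct H as [H| ->].
    + exact (mem_asym _ _ H Hx).
    + exact (mem_irrefl _ Hx).
Qed.

End SuccessorCardinal.

(** * Measures *)

Section MeasureDefs.
Context {M : set_structure} {HM : ZFC M}.

Definition measure (m u : M) : Prop :=
  is_cardinal m /\ (exists w, is_omega w /\ w ∈ m) /\
  is_nonprincipal_ultrafilter u m /\ is_complete m u m.

Lemma measurable_measure m : is_measurable m -> exists u, measure m u.
Proof. intros (H1 & H2 & u & H3 & H4). exists u. exact (conj H1 (conj H2 (conj H3 H4))). Qed.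

Definition ualmost (u : M) (P : M -> Prop) : Prop :=
  exists x, x ∈ u /\ forall z, z ∈ x -> P z.

(* Every function into [a] is almost constant: this stands for [a] having size below the
   cardinal that [u] measures. *)
Definition small (u a : M) : Prop :=
  forall f, ualmost u (fun z => app f z ∈ a) -> exists q, q ∈ a /\ ualmost u (fun z => app f z = q).

End MeasureDefs.

Ltac dfn_measures := match goal with
  | |- defp (fun e => is_bijection (@?s e) (@?t e) (@?u e)) => simple apply (dpred_bijection s t u)
  | |- defp (fun e => ualmost _ _) => unfold ualmost
  | |- defp (fun e => small _ _) => unfold small
  | |- defp (fun e => is_cardinal _) => unfold is_cardinal
  | |- _ => dfn_ordinals
  end.
Ltac dfn_ext ::= dfn_measures.

Lemma dpred1_measurable {M : set_structure} {HM : ZFC M} : dpred1 (M:=M) is_measurable.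
Proof.
  unfold is_measurable, is_omega, is_limit_ordinal, is_nonprincipal_ultrafilter, is_complete,
    cardinality_below, is_cardinality. dfn.
Qed.

Section Measure.
Context {M : set_structure} {HM : ZFC M}.
Implicit Types x y z a b f q : M.
Variables m u : M.
Hypothesis Hm : measure m u.

Lemma measure_ordinal : is_ordinal m.
Proof. apply Hm. Qed.

Lemma ualmost_mono (P Q : M -> Prop) : (forall z, z ∈ m -> P z -> Q z) -> ualmost u P -> ualmost u Q.
Proof.
  intros H (x & Hx & HP). exists x. split; [exact Hx|]. intros z Hz.
  destruct Hm as (_ & _ & (Hs & _) & _). apply H; [exact (Hs x Hx z Hz)|auto].
Qed.

Lemma ualmost_and (P Q : M -> Prop) : ualmost u P -> ualmost u Q -> ualmost u (fun z => P z /\ Q z).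
Proof.
  intros (x & Hx & HP) (y & Hy & HQ). exists (sep x (fun z => z ∈ y)).
  assert (H : forall z, z ∈ sep x (fun z => z ∈ y) <-> z ∈ x /\ z ∈ y).
  { intros z. now rewrite in_sep by dfn. }
  split.
  - destruct Hm as (_ & _ & (_ & _ & _ & _ & Hi & _) & _). exact (Hi x y _ Hx Hy H).
  - intros z Hz. apply H in Hz. destruct Hz. auto.
Qed.

Lemma ualmost_true (P : M -> Prop) : (forall z, z ∈ m -> P z) -> ualmost u P.
Proof. intros H. exists m. split; [apply Hm|exact H]. Qed.

Lemma ualmost_nonempty (P : M -> Prop) : ualmost u P -> exists z, z ∈ m /\ P z.
Proof.
  intros (x & Hx & HP). apply NNPP. intros Hn.
  destruct Hm as (_ & _ & (Hs & _ & He & _) & _). apply (He x); [|exact Hx].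
  intros z Hz. apply Hn. exists z. split; [exact (Hs x Hx z Hz)|auto].
Qed.

Lemma ualmost_ultra (P : M -> Prop) : dpred1 P -> ualmost u P \/ ualmost u (fun z => ~ P z).
Proof.
  intros HP. destruct Hm as (_ & _ & (_ & _ & _ & _ & _ & Hu & _) & _).
  destruct (Hu (sep m P) (sep m (fun z => ~ P z))) as [H|H].
  - intros z Hz. rewrite in_sep in Hz by exact HP. tauto.
  - intros z. rewrite !in_sep by dfn. tauto.
  - left. eexists. split; [exact H|]. intros z Hz. rewrite in_sep in Hz by exact HP. tauto.
  - right. eexists. split; [exact H|]. intros z Hz. rewrite in_sep in Hz by dfn. tauto.
Qed.

Lemma ualmost_neq b : ualmost u (fun z => z <> b).
Proof.
  destruct (ualmost_ultra (fun z => z = b)) as [(x & Hx & H)|H]; [dfn| |exact H].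
  exfalso. destruct (ualmost_nonempty (fun z => z ∈ x)) as (z & _ & Hz).
  { exists x. auto. }
  destruct Hm as (_ & _ & (_ & _ & _ & _ & _ & _ & Hn) & _). apply (Hn b x); [|exact Hx].
  intros y. split; [apply H|]. intros ->. rewrite <- (H z Hz). exact Hz.
Qed.

Lemma ualmost_in_filter (P : M -> Prop) : dpred1 P -> ualmost u P -> sep m P ∈ u.
Proof.
  intros HP (x & Hx & H). destruct Hm as (_ & _ & (Hs & _ & _ & Hup & _) & _).
  apply (Hup x); [exact Hx| |].
  - intros z Hz. rewrite in_sep by exact HP. split; [exact (Hs x Hx z Hz)|auto].
  - intros z Hz. rewrite in_sep in Hz by exact HP. tauto.
Qed.

Lemma small_injection a b (F : M -> M) : dfun1 F -> (forall x, x ∈ a -> F x ∈ b) ->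
  (forall x y, x ∈ a -> y ∈ a -> F x = F y -> x = y) -> small u b -> small u a.
Proof.
  intros HF H1 H2 Hb f Hf.
  destruct (Hb (lam m (fun z => F (app f z)))) as (q & Hq & Hc).
  { eapply ualmost_mono; [|exact Hf]. intros z Hz Hfz. cbv beta in *. rewrite app_lam by (dfn || assumption). auto. }
  pose proof (ualmost_and _ _ Hf Hc) as H.
  destruct (ualmost_nonempty _ H) as (z0 & Hz0 & Ha0 & E0).
  rewrite app_lam in E0 by (dfn || assumption).
  exists (app f z0). split; [exact Ha0|].
  eapply ualmost_mono; [|exact H]. intros z Hz [Ha E]. cbv beta in *.
  rewrite app_lam in E by (dfn || assumption). apply H2; congruence.
Qed.

Lemma small_subset a b : a ⊆ b -> small u b -> small u a.
Proof. intros H. apply (small_injection a b (fun x => x)); [dfn | exact H | auto]. Qed.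

(* Completeness refers to families [d] whose cardinality exists; deleting [t] from the [t]-th
   set makes the family injectively indexed, so that its cardinality is that of the index set. *)
Lemma small_ordinal b : b ∈ m -> small u b.
Proof.
  intros Hb. pose proof measure_ordinal as Hmo.
  pose proof (ordinal_mem m b Hmo Hb) as Hbo. revert Hb.
  apply (ordinal_induction (fun b => b ∈ m -> small u b)); [dfn|exact Hbo|].
  clear b Hbo. intros b Hbo IH Hb.
  destruct (classic (is_cardinal b)) as [Hc|Hc].
  - intros f Hf. apply NNPP. intros Hn.
    assert (Hne : forall t, t ∈ b -> ualmost u (fun z => app f z <> t)).
    { intros t Ht. destruct (ualmost_ultra (fun z => app f z = t)) as [H|H]; [dfn| |exact H].
      exfalso. apply Hn. eauto. }
    set (X := fun t => sep m (fun z => z <> t /\ (z ∈ b \/ app f z <> t))).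
    assert (HX : dfun1 X) by (unfold X; dfn).
    assert (HXs : forall t z, z ∈ X t <-> z ∈ m /\ z <> t /\ (z ∈ b \/ app f z <> t)).
    { intros t z. unfold X. rewrite in_sep by dfn. tauto. }
    assert (Hbm : b ⊆ m) by (now apply ordinal_transitive).
    destruct Hm as (_ & _ & _ & Hcomp).
    assert (Hi : sep m (fun z => forall x, x ∈ repl b X -> z ∈ x) ∈ u).
    { apply (Hcomp (repl b X)).
      - intros x Hx. rewrite in_repl in Hx by dfn. destruct Hx as (t & Ht & ->).
        apply ualmost_in_filter; [dfn|].
        eapply ualmost_mono; [|exact (ualmost_and _ _ (ualmost_neq t) (Hne t Ht))].
        simpl. tauto.
      - exists b. split; [exact Hb|]. split; [exact Hc|].
        apply (bijection_inverse (lam b X)). apply bijection_lam; [exact HX|..].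
        + intros t Ht. rewrite in_repl by dfn. eauto.
        + intros t t' Ht Ht' E. apply NNPP. intros Htt.
          assert (H : t' ∈ X t). { apply HXs. split; [auto|]. split; [congruence|now left]. }
          rewrite E in H. apply HXs in H. tauto.
        + intros y Hy. rewrite in_repl in Hy by dfn. destruct Hy as (t & Ht & ->). eauto.
      - intros z. rewrite in_sep by dfn. tauto. }
    destruct (ualmost_nonempty _ (ualmost_and _ (fun z => z ∈ sep m (fun z => forall x, x ∈ repl b X -> z ∈ x)) Hf
      (ex_intro _ _ (conj Hi (fun z H => H))))) as (z & Hz & Hfz & Hz').
    rewrite in_sep in Hz' by dfn. destruct Hz' as [_ Hz'].
    assert (Hzt : forall t, t ∈ b -> z ∈ X t).
    { intros t Ht. apply Hz'. rewrite in_repl by dfn. eauto. }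
    (* The index [app f z] leaves only the alternative [z ∈ b], which was put into [X] to keep the
       sets distinct; the index [z] itself then refutes it. *)
    pose proof (Hzt _ Hfz) as H1. apply HXs in H1 as (_ & _ & [H1|H1]); [|easy].
    pose proof (Hzt _ H1) as H2. apply HXs in H2. tauto.
  - assert (H : exists a f, a ∈ b /\ is_bijection f a b).
    { apply NNPP. intros Hn. apply Hc. split; [exact Hbo|]. intros a Ha [f Hf]. eauto. }
    destruct H as (a & f & Ha & Hf). apply bijection_inverse in Hf as [g Hg].
    apply bijection_app in Hg as (B1 & B2 & _).
    apply (small_injection b a (app g)); [dfn|auto|auto|].
    apply IH; [exact Ha|]. exact (ordinal_trans m b a Hmo Hb Ha).
Qed.

(** Otherwise almost every [z] can choose an index at which it fails, and smallness makes that
    choice constant almost everywhere. *)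
Lemma ualmost_small_inter a (P : M -> M -> Prop) : small u a -> dpred2 P ->
  (forall q, q ∈ a -> ualmost u (P q)) -> ualmost u (fun z => forall q, q ∈ a -> P q z).
Proof.
  intros Ha HP H.
  destruct (ualmost_ultra (fun z => forall q, q ∈ a -> P q z)) as [H1|H1]; [dfn|exact H1|].
  exfalso.
  destruct (choice_function (sep m (fun z => ~ forall q, q ∈ a -> P q z)) a (fun z q => ~ P q z))
    as (f & Hfa & Hf).
  - dfn.
  - intros z Hz. rewrite in_sep in Hz by dfn. destruct Hz as [_ Hz].
    apply NNPP. intros Hn. apply Hz. intros q Hq. apply NNPP. eauto.
  - apply in_funs in Hfa as [_ Hfa].
    assert (Hf' : ualmost u (fun z => app f z ∈ a /\ ~ P (app f z) z)).
    { eapply ualmost_mono; [|exact H1]. intros z Hz Hnz. cbv beta in *.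
      assert (Hzs : z ∈ sep m (fun z => ~ forall q, q ∈ a -> P q z)) by (rewrite in_sep by dfn; tauto).
      split; auto. }
    destruct (Ha f) as (q & Hq & Hfq).
    { eapply ualmost_mono; [|exact Hf']. simpl. tauto. }
    destruct (ualmost_nonempty _ (ualmost_and _ _ (ualmost_and _ _ Hf' Hfq) (H q Hq)))
      as (z & _ & [[_ Hnz] E] & Hz). rewrite E in Hnz. contradiction.
Qed.

(** Otherwise the identity maps almost all of [m] into the small set [b] and is almost constant,
    which a nonprincipal ultrafilter excludes. *)
Lemma ualmost_above b : b ∈ m -> ualmost u (fun z => b ∈ z).
Proof.
  intros Hb. pose proof measure_ordinal as Hmo.
  destruct (ualmost_ultra (fun z => b ∈ z)) as [H|H]; [dfn|exact H|]. exfalso.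
  assert (H1 : ualmost u (fun z => app (lam m (fun z => z)) z ∈ b)).
  { eapply ualmost_mono; [|exact (ualmost_and _ _ H (ualmost_neq b))].
    intros z Hz [Hn Hne]. rewrite app_lam by (dfn || assumption).
    destruct (ordinal_total z b) as [Hzb|[Hzb|Hzb]]; eauto using ordinal_mem; contradiction. }
  destruct (small_ordinal b Hb _ H1) as (q & _ & Hq).
  destruct (ualmost_nonempty _ (ualmost_and _ _ Hq (ualmost_neq q))) as (z & Hz & E & Hn).
  rewrite app_lam in E by (dfn || assumption). contradiction.
Qed.

Lemma measure_succ b : b ∈ m -> succ b ∈ m.
Proof.
  apply limit_succ; [exact measure_ordinal|]. intros x Hx.
  destruct (ualmost_nonempty _ (ualmost_above x Hx)) as (z & Hz & Hxz). eauto.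
Qed.

Lemma measure_nonempty : nonempty m.
Proof. destruct Hm as (_ & (w & _ & Hw) & _). now exists w. Qed.

Lemma measure_empty : empty ∈ m.
Proof. exact (empty_mem m measure_ordinal measure_nonempty). Qed.

(** A function into [funs a b] is almost constant at each argument because [b] is small, and at all
    arguments simultaneously because [a] is. This stands in for the strong limit property of [m]. *)
Lemma small_funs a b : small u a -> small u b -> small u (funs a b).
Proof.
  intros Ha Hb f Hf.
  set (G := fun x => iota (fun y => ualmost u (fun z => app (app f z) x = y))).
  assert (HG : dfun1 G) by (unfold G; dfn).
  assert (HGs : forall x, x ∈ a -> G x ∈ b /\ ualmost u (fun z => app (app f z) x = G x)).
  { intros x Hx. destruct (Hb (lam m (fun z => app (app f z) x))) as (y & Hy & Hc).
    - eapply ualmost_mono; [|exact Hf]. intros z Hz Hfz. cbv beta in *.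
      rewrite app_lam by (dfn || assumption). apply in_funs in Hfz. now apply Hfz.
    - assert (Hc' : ualmost u (fun z => app (app f z) x = y)).
      { eapply ualmost_mono; [|exact Hc]. intros z Hz E. cbv beta in *.
        now rewrite app_lam in E by (dfn || assumption). }
      assert (E : G x = y).
      { apply iota_eq; [exact Hc'|]. intros y' Hy'.
        destruct (ualmost_nonempty _ (ualmost_and _ _ Hc' Hy')) as (z & _ & <- & <-). reflexivity. }
      now rewrite E. }
  exists (lam a G). split.
  - apply lam_in_funs; [exact HG|]. intros x Hx. now apply HGs.
  - pose proof (ualmost_small_inter a (fun x z => app (app f z) x = G x) Ha) as H.
    eapply ualmost_mono; [|exact (ualmost_and _ _ Hf (H ltac:(dfn) (fun x Hx => proj2 (HGs x Hx))))].
    intros z Hz [Hfz E]. apply in_funs in Hfz as [Hfz _].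
    apply (fun_ext _ _ a Hfz); [now apply is_fun_lam|].
    intros x Hx. rewrite app_lam by assumption. auto.
Qed.

Lemma small_power a : small u a -> small u (power a).
Proof.
  intros Ha.
  apply (small_injection (power a) (funs a (succ (succ empty)))
    (fun x => lam a (fun y => cond (y ∈ x) (succ empty) empty))).
  - dfn.
  - intros x Hx. apply lam_in_funs; [dfn|]. intros y Hy.
    destruct (classic (y ∈ x)) as [H|H]; [rewrite cond_true by exact H|rewrite cond_false by exact H];
      rewrite !in_succ; auto.
  - assert (H : forall x x', x ∈ power a -> x' ∈ power a ->
      lam a (fun y => cond (y ∈ x) (succ empty) empty) = lam a (fun y => cond (y ∈ x') (succ empty) empty) ->
      x ⊆ x').
    { intros x x' Hx Hx' E y Hy. rewrite in_power in Hx. apply NNPP. intros Hn.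
      assert (E1 : app (lam a (fun y => cond (y ∈ x) (succ empty) empty)) y =
        app (lam a (fun y => cond (y ∈ x') (succ empty) empty)) y) by now rewrite E.
      rewrite !app_lam in E1 by (dfn || auto).
      rewrite cond_true, cond_false in E1 by assumption.
      apply (in_empty empty). rewrite <- E1 at 2. apply in_succ. auto. }
    intros x x' Hx Hx' E. apply subset_antisym; apply H; auto.
  - apply small_funs; [exact Ha|]. apply small_ordinal. apply measure_succ, measure_succ, measure_empty.
Qed.

Lemma small_prod a b : small u a -> small u b -> small u (prod a b).
Proof.
  intros Ha Hb f Hf.
  destruct (Ha (lam m (fun z => pfst (app f z)))) as (x & Hx & Hcx).
  { eapply ualmost_mono; [|exact Hf]. intros z Hz Hfz. cbv beta in *.
    rewrite app_lam by (dfn || assumption). rewrite in_prod in Hfz.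
    destruct Hfz as (x & y & Hx & Hy & ->). now rewrite pfst_opair. }
  destruct (Hb (lam m (fun z => psnd (app f z)))) as (y & Hy & Hcy).
  { eapply ualmost_mono; [|exact Hf]. intros z Hz Hfz. cbv beta in *.
    rewrite app_lam by (dfn || assumption). rewrite in_prod in Hfz.
    destruct Hfz as (x' & y & Hx' & Hy & ->). now rewrite psnd_opair. }
  exists (opair x y). split; [rewrite in_prod; eauto|].
  eapply ualmost_mono; [|exact (ualmost_and _ _ Hf (ualmost_and _ _ Hcx Hcy))].
  intros z Hz (Hfz & Hzx & Hzy). rewrite app_lam in Hzx, Hzy by (dfn || assumption).
  rewrite in_prod in Hfz. destruct Hfz as (x' & y' & _ & _ & E).
  rewrite E in Hzx, Hzy |- *. rewrite pfst_opair in Hzx. rewrite psnd_opair in Hzy. now subst.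
Qed.

(** Regularity of [m]. If each [b ∈ m] had an [x] violating it as a bound, the choice of [x] would
    be constant on a set in [u], while almost every [b] exceeds that one value. *)
Lemma small_bounded a (F : M -> M) : small u a -> dfun1 F -> (forall x, x ∈ a -> F x ∈ m) ->
  exists b, b ∈ m /\ forall x, x ∈ a -> F x ∈ b.
Proof.
  intros Ha HF H. apply NNPP. intros Hn.
  destruct (choice_function m a (fun b x => ~ F x ∈ b)) as (h & Hh & Hhs); [dfn| |].
  - intros b Hb. apply NNPP. intros Hn'. apply Hn. exists b. split; [exact Hb|].
    intros x Hx. apply NNPP. eauto.
  - apply in_funs in Hh as [_ Hh].
    destruct (Ha h) as (q & Hq & Hc); [now apply ualmost_true|].
    destruct (ualmost_nonempty _ (ualmost_and _ _ Hc (ualmost_above _ (H q Hq)))) as (z & Hz & E & Hqz).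
    specialize (Hhs z Hz). now rewrite E in Hhs.
Qed.

Lemma small_image a (F : M -> M) : dfun1 F -> small u a -> small u (repl a F).
Proof.
  intros HF Ha. destruct (choice_function (repl a F) a (fun y x => F x = y)) as (c & Hc & Hcs); [dfn| |].
  - intros y Hy. rewrite in_repl in Hy by dfn. destruct Hy as (x & Hx & ->). eauto.
  - apply in_funs in Hc as [_ Hc]. apply (small_injection (repl a F) a (app c)); [dfn|exact Hc| |exact Ha].
    intros x y Hx Hy E. rewrite <- (Hcs x Hx), <- (Hcs y Hy). congruence.
Qed.

(* An injection of [m] into a [small] set would be constant on a set in [u]. *)
Lemma small_no_injection a f : small u a -> (forall x, x ∈ m -> app f x ∈ a) ->
  (forall x y, x ∈ m -> y ∈ m -> app f x = app f y -> x = y) -> False.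
Proof.
  intros Ha H1 H2. destruct (Ha f) as (q & _ & Hc); [now apply ualmost_true|].
  destruct (ualmost_nonempty _ Hc) as (z & Hz & E).
  destruct (ualmost_nonempty _ (ualmost_and _ _ Hc (ualmost_neq z))) as (z' & Hz' & E' & Hn).
  apply Hn, H2; congruence.
Qed.
End Measure.

(** * Iterated ultrapowers *)

Section IterationDefs.
Context {M : set_structure} {HM : ZFC M}.
Implicit Types m u i a f s : M.

Definition agree s s' a : Prop := forall k, k ∈ a -> app s k = app s' k.

(** The argument is a full sequence on whose values below [k] alone the answer depends; this avoids
    sequences of varying length. *)
Definition strategy m u i g : Prop := forall k s, k ∈ i -> s ∈ funs i m ->
  app g (opair k s) ∈ u /\
  forall s', s' ∈ funs i m -> agree s s' k -> app g (opair k s) = app g (opair k s').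

(* [u]-almost everywhere for the iteration of [u] of length [i]: the set of sequences
   following a strategy that prescribes, from the earlier values, a set in [u] for the next. *)
Definition almost m u i (P : M -> Prop) : Prop :=
  exists g, strategy m u i g /\
    forall s, s ∈ funs i m -> (forall k, k ∈ i -> app s k ∈ app g (opair k s)) -> P s.

(* Used for sets of ordinals only. *)
Definition finite a : Prop := forall b, b ⊆ a -> nonempty b ->
  exists k, k ∈ b /\ forall l, l ∈ b -> l ∈ k \/ l = k.

Definition supports m i a (P : M -> Prop) : Prop :=
  forall s s', s ∈ funs i m -> s' ∈ funs i m -> agree s s' a -> P s -> P s'.

Definition supports_fun m i a f : Prop :=
  forall s s', s ∈ funs i m -> s' ∈ funs i m -> agree s s' a -> app f s = app f s'.

Definition finsupp m i f : Prop := is_fun f (funs i m) /\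
  exists a, a ⊆ i /\ finite a /\ supports_fun m i a f.

Definition update i s k z : M := lam i (fun l => cond (l = k) z (app s l)).

Definition mem_ae m u i g f : Prop := almost m u i (fun s => app g s ∈ app f s).

End IterationDefs.

Ltac dfn_iteration := match goal with
  | |- defp (fun e => agree _ _ _) => unfold agree
  | |- defp (fun e => strategy _ _ _ _) => unfold strategy
  | |- defp (fun e => almost _ _ _ _) => unfold almost
  | |- defp (fun e => finite _) => unfold finite
  | |- defp (fun e => supports _ _ _ _) => unfold supports
  | |- defp (fun e => supports_fun _ _ _ _) => unfold supports_fun
  | |- defp (fun e => finsupp _ _ _) => unfold finsupp
  | |- defp (fun e => mem_ae _ _ _ _ _) => unfold mem_ae
  | |- dterm (fun e => update _ _ _ _) => unfold update
  | |- _ => dfn_measures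
  end.
Ltac dfn_ext ::= dfn_iteration.

Section Iteration.
Context {M : set_structure} {HM : ZFC M}.
Implicit Types s f g h x y z a b k l : M.
Variables m u i : M.
Hypotheses (Hm : measure m u) (Hi : is_ordinal i).

Notation paths := (funs i m).
Notation ae := (almost m u i).
Notation K := (finsupp m i).
Notation E := (mem_ae m u i).

Lemma almost_mono (P Q : M -> Prop) : (forall s, s ∈ paths -> P s -> Q s) -> ae P -> ae Q.
Proof. intros H (g & Hg & Hs). exists g. split; [exact Hg|]. auto. Qed.

(** Trimmed to its relevant arguments, a strategy belongs to a fixed set of functions, from which
    strategies for a whole family can be chosen. *)
Lemma strategy_lam g : strategy m u i g -> strategy m u i (lam (prod i paths) (app g)).
Proof.
  intros H k s Hk Hs. destruct (H k s Hk Hs) as [H1 H2]. split.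
  - rewrite app_lam; [exact H1|dfn|]. rewrite in_prod. eauto.
  - intros s' Hs' Ha. rewrite !app_lam; [auto|dfn|..]; try dfn; rewrite in_prod; eauto.
Qed.

Lemma strategy_build (G : M -> M -> M) : dfun1 (fun p => G (pfst p) (psnd p)) ->
  (forall k s, k ∈ i -> s ∈ paths -> G k s ∈ u) ->
  (forall k s s', k ∈ i -> s ∈ paths -> s' ∈ paths -> agree s s' k -> G k s = G k s') ->
  exists g, strategy m u i g /\ forall k s, k ∈ i -> s ∈ paths -> app g (opair k s) = G k s.
Proof.
  intros HG H1 H2. exists (lam (prod i paths) (fun p => G (pfst p) (psnd p))).
  assert (E : forall k s, k ∈ i -> s ∈ paths ->
    app (lam (prod i paths) (fun p => G (pfst p) (psnd p))) (opair k s) = G k s).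
  { intros k s Hk Hs. now apply app_lam_prod. }
  split; [|exact E].
  intros k s Hk Hs. rewrite E by assumption. split; [auto|].
  intros s' Hs' Ha. rewrite E by assumption. auto.
Qed.

Lemma measure_mem : m ∈ u.
Proof. apply Hm. Qed.

Lemma measure_subset x : x ∈ u -> x ⊆ m.
Proof. apply Hm. Qed.

Lemma almost_true (P : M -> Prop) : (forall s, s ∈ paths -> P s) -> ae P.
Proof.
  intros H. destruct (strategy_build (fun _ _ => m)) as (g & Hg & _); [dfn| | |].
  - intros. apply measure_mem.
  - auto.
  - exists g. auto.
Qed.

(** Choose one strategy for each index and intersect their answers, which stay in [u] because the
    index set is small. The predicates may depend on infinitely many coordinates. *)
Lemma almost_small_inter a (P : M -> M -> Prop) : small u a -> dpred2 P ->
  (forall q, q ∈ a -> ae (P q)) -> ae (fun s => forall q, q ∈ a -> P q s).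
Proof.
  intros Ha HP H.
  destruct (choice_function a (funs (prod i paths) u) (fun q g => strategy m u i g /\
    forall s, s ∈ paths -> (forall k, k ∈ i -> app s k ∈ app g (opair k s)) -> P q s))
    as (c & _ & Hc).
  - dfn.
  - intros q Hq. destruct (H q Hq) as (g & Hg & Hs).
    exists (lam (prod i paths) (app g)). split; [|split].
    + apply lam_in_funs; [dfn|]. intros p Hp. rewrite in_prod in Hp.
      destruct Hp as (k & s & Hk & Hs' & ->). now apply Hg.
    + now apply strategy_lam.
    + intros s Hsp Hf. apply Hs; [exact Hsp|]. intros k Hk. specialize (Hf k Hk).
      rewrite app_lam in Hf; [exact Hf|dfn|]. rewrite in_prod. eauto.
  - destruct (strategy_build (fun k s => sep m (fun z => forall q, q ∈ a -> z ∈ app (app c q) (opair k s))))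
      as (g & Hg & Eg).
    + dfn.
    + intros k s Hk Hs. apply ualmost_in_filter; [exact Hm|dfn|].
      apply (ualmost_small_inter m u Hm a (fun q z => z ∈ app (app c q) (opair k s))); [exact Ha|dfn|].
      intros q Hq. exists (app (app c q) (opair k s)). split; [|auto].
      now apply Hc.
    + intros k s s' Hk Hs Hs' Hag. apply set_ext. intros z. rewrite !in_sep by dfn.
      split; intros [Hz Hq]; split; auto; intros q Hqa; specialize (Hq q Hqa);
        destruct (Hc q Hqa) as [Hst _]; destruct (Hst k s Hk Hs) as [_ Hst'];
        specialize (Hst' s' Hs' Hag); congruence.
    + exists g. split; [exact Hg|]. intros s Hs Hf q Hq. apply (Hc q Hq); [exact Hs|].
      intros k Hk. specialize (Hf k Hk). rewrite Eg in Hf by assumption.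
      rewrite in_sep in Hf by dfn. now apply Hf.
Qed.

Lemma almost_and (P Q : M -> Prop) : ae P -> ae Q -> ae (fun s => P s /\ Q s).
Proof.
  intros (g & Hg & Hgs) (h & Hh & Hhs).
  assert (Hint : forall x y z, z ∈ sep x (fun z => z ∈ y) <-> z ∈ x /\ z ∈ y).
  { intros x y z. now rewrite in_sep by dfn. }
  destruct (strategy_build (fun k s => sep (app g (opair k s)) (fun z => z ∈ app h (opair k s))))
    as (c & Hc & Ec).
  - dfn.
  - intros k s Hk Hs. destruct Hm as (_ & _ & (_ & _ & _ & _ & Hint' & _) & _).
    apply (Hint' (app g (opair k s)) (app h (opair k s))); [now apply Hg|now apply Hh|auto].
  - intros k s s' Hk Hs Hs' Ha. destruct (Hg k s Hk Hs) as [_ E1]. destruct (Hh k s Hk Hs) as [_ E2].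
    now rewrite (E1 s' Hs' Ha), (E2 s' Hs' Ha).
  - exists c. split; [exact Hc|]. intros s Hs Hf.
    assert (H : forall k, k ∈ i -> app s k ∈ app g (opair k s) /\ app s k ∈ app h (opair k s)).
    { intros k Hk. apply Hint. rewrite <- Ec by assumption. auto. }
    split; [apply Hgs|apply Hhs]; auto; intros k Hk; now apply H.
Qed.

Lemma almost_nonempty (P : M -> Prop) : ae P -> exists s, s ∈ paths /\ P s.
Proof.
  intros (g & Hg & Hgs).
  destruct (choice_of_elements u) as [c Hc].
  assert (Hcu : forall x, x ∈ u -> app c x ∈ x).
  { intros x Hx. apply Hc; [exact Hx|].
    destruct (ualmost_nonempty m u Hm (fun z => z ∈ x)) as (z & _ & Hz); [exists x; auto|now exists z]. }
  destruct (wf_recursion mem i (fun k h => app c (app g (opair k (lam i (app h))))))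
    as (f & _ & Hf); [dfn|apply wf_on_mem|dfn|].
  (* The run constructed so far, padded with [empty] from [k] on, because a strategy expects a full
     sequence; [empty] is in [m], so this is a path. *)
  set (t := fun k => lam i (app (lam (sep i (fun y => y ∈ k)) (app f)))).
  assert (Ht : forall k l, k ∈ i -> l ∈ k -> app (t k) l = app f l).
  { intros k l Hk Hl. assert (Hli : l ∈ i) by exact (ordinal_trans i k l Hi Hk Hl).
    unfold t. rewrite app_lam by (dfn || assumption).
    rewrite app_lam; [reflexivity|dfn|]. rewrite in_sep by dfn. now split. }
  assert (Htp : forall k, k ∈ i -> (forall l, l ∈ i -> l ∈ k -> app f l ∈ m) -> t k ∈ paths).
  { intros k Hk IH. apply lam_in_funs; [dfn|]. intros l Hl.
    destruct (classic (l ∈ k)) as [H|H].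
    - rewrite app_lam; [auto|dfn|]. rewrite in_sep by dfn. now split.
    - rewrite app_lam_out; [now apply (measure_empty m u)|dfn|]. rewrite in_sep by dfn. tauto. }
  assert (Hfm : forall k, k ∈ i -> app f k ∈ m).
  { apply (wf_induction mem i (fun k => app f k ∈ m) (wf_on_mem i)); [dfn|].
    intros k Hk IH. rewrite Hf by exact Hk. fold (t k).
    assert (Hgk : app g (opair k (t k)) ∈ u) by (apply Hg; auto).
    exact (measure_subset _ Hgk _ (Hcu _ Hgk)). }
  assert (Hs : lam i (app f) ∈ paths) by (apply lam_in_funs; [dfn|exact Hfm]).
  exists (lam i (app f)). split; [exact Hs|]. apply Hgs; [exact Hs|].
  intros k Hk. rewrite app_lam by (dfn || assumption).
  assert (Htk : t k ∈ paths) by auto.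
  destruct (Hg k (lam i (app f)) Hk Hs) as [_ Eg]. rewrite (Eg (t k) Htk).
  - rewrite Hf by exact Hk. fold (t k). apply Hcu. now apply Hg.
  - intros l Hl. rewrite Ht, app_lam by (dfn || eauto using ordinal_trans). reflexivity.
Qed.

Lemma update_paths s k z : s ∈ paths -> z ∈ m -> update i s k z ∈ paths.
Proof.
  intros Hs Hz. apply in_funs in Hs as [_ Hs]. apply lam_in_funs; [dfn|].
  intros l Hl. destruct (classic (l = k)) as [H|H];
    [rewrite cond_true by exact H|rewrite cond_false by exact H]; auto.
Qed.

Lemma update_same s k z : k ∈ i -> app (update i s k z) k = z.
Proof. intros Hk. unfold update. rewrite app_lam by (dfn || assumption). now apply cond_true. Qed.

Lemma update_other s k z l : l ∈ i -> l <> k -> app (update i s k z) l = app s l.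
Proof. intros Hl Hn. unfold update. rewrite app_lam by (dfn || assumption). now apply cond_false. Qed.

Lemma update_self s k : s ∈ paths -> update i s k (app s k) = s.
Proof.
  intros Hs. apply in_funs in Hs as [Hs _].
  apply (fun_ext _ _ i); [apply is_fun_lam; dfn|exact Hs|].
  intros l Hl. destruct (classic (l = k)) as [->|H].
  - now apply update_same.
  - now apply update_other.
Qed.

Lemma update_agree s s' k z a : a ⊆ i ->
  (forall l, l ∈ a -> l <> k -> app s l = app s' l) -> agree (update i s k z) (update i s' k z) a.
Proof.
  intros Ha H l Hl. destruct (classic (l = k)) as [->|Hn].
  - rewrite !update_same by auto. reflexivity.
  - rewrite !update_other by auto. auto.
Qed.

(** The given strategy is changed at stage [k] only, where its answer is intersected with the set
    [A s] of good values. By the support hypothesis [A s] depends only on the values before [k], as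
    a strategy must. *)
Lemma almost_fubini (P : M -> Prop) k : dpred1 P -> k ∈ i -> supports m i (succ k) P ->
  ae (fun s => ualmost u (fun z => P (update i s k z))) -> ae P.
Proof.
  intros HP Hk Hsup (g & Hg & Hgs).
  set (A := fun s => sep m (fun z => P (update i s k z))).
  assert (HAs : forall s z, z ∈ A s <-> z ∈ m /\ P (update i s k z)).
  { intros s z. unfold A. now rewrite in_sep by dfn. }
  assert (Hki : succ k ⊆ i).
  { intros l. rewrite in_succ. intros [Hl| ->]; [exact (ordinal_trans i k l Hi Hk Hl)|exact Hk]. }
  assert (HAa : forall s s', s ∈ paths -> s' ∈ paths -> agree s s' k -> A s = A s').
  { assert (H : forall s s', s ∈ paths -> s' ∈ paths -> agree s s' k -> A s ⊆ A s').
    { intros s s' Hs Hs' Ha z Hz. apply HAs in Hz as [Hz Hpz]. apply HAs. split; [exact Hz|].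
      apply (Hsup (update i s k z)); auto using update_paths.
      apply update_agree; [exact Hki|]. intros l Hl Hn. rewrite in_succ in Hl. apply Ha. tauto. }
    intros s s' Hs Hs' Ha. apply subset_antisym; apply H; auto.
    intros l Hl. symmetry. auto. }
  (* Where [A s] is not in [u] the old answer stays, so that the result is a strategy everywhere; on
     sequences that follow [g] this case does not occur. *)
  destruct (strategy_build (fun l s => cond (l = k /\ A s ∈ u)
      (sep (app g (opair l s)) (fun z => z ∈ A s)) (app g (opair l s)))) as (h & Hh & Eh).
  - unfold A. dfn.
  - intros l s Hl Hs. destruct (classic (l = k /\ A s ∈ u)) as [H|H].
    + rewrite cond_true by exact H. destruct H as [-> H].
      destruct Hm as (_ & _ & (_ & _ & _ & _ & Hint & _) & _).
      apply (Hint (app g (opair k s)) (A s)); [now apply Hg|exact H|].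
      intros z. now rewrite in_sep by dfn.
    + rewrite cond_false by exact H. now apply Hg.
  - intros l s s' Hl Hs Hs' Ha. destruct (Hg l s Hl Hs) as [_ Eg]. rewrite (Eg s' Hs' Ha).
    destruct (classic (l = k)) as [->|H].
    + now rewrite (HAa s s' Hs Hs' Ha).
    + rewrite !cond_false by tauto. reflexivity.
  - exists h. split; [exact Hh|]. intros s Hs Hf.
    assert (Hf' : forall l, l ∈ i -> app s l ∈ app g (opair l s)).
    { intros l Hl. specialize (Hf l Hl). rewrite Eh in Hf by assumption.
      destruct (classic (l = k /\ A s ∈ u)) as [H|H].
      - rewrite cond_true in Hf by exact H. rewrite in_sep in Hf by dfn. tauto.
      - now rewrite cond_false in Hf by exact H. }
    pose proof (Hgs s Hs Hf') as H.
    assert (HAu : A s ∈ u). { apply ualmost_in_filter; [exact Hm|dfn|exact H]. }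
    specialize (Hf k Hk). rewrite Eh, cond_true in Hf by auto. rewrite in_sep in Hf by dfn.
    destruct Hf as [_ Hf]. apply HAs in Hf as [_ Hf]. now rewrite update_self in Hf.
Qed.

Lemma finite_subset a b : b ⊆ a -> finite a -> finite b.
Proof. intros Hb Ha c Hc. apply Ha. eapply subset_trans; eauto. Qed.

Lemma finite_sing k : finite (sing k).
Proof.
  intros b Hb [x Hx]. exists x. split; [exact Hx|]. intros l Hl. right.
  apply Hb in Hl, Hx. rewrite in_sing in Hl, Hx. congruence.
Qed.

Lemma finite_empty : finite (empty : M).
Proof. intros b Hb [x Hx]. apply Hb in Hx. now apply in_empty in Hx. Qed.

Lemma finite_cup a b : a ⊆ i -> b ⊆ i -> finite a -> finite b -> finite (cup a b).
Proof.
  intros Hai Hbi Ha Hb c Hc Hne.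
  assert (Hca : forall x, sep c (fun l => l ∈ x) ⊆ x /\ sep c (fun l => l ∈ x) ⊆ c).
  { intros x. split; intros l Hl; rewrite in_sep in Hl by dfn; tauto. }
  assert (Hin : forall x l, l ∈ c -> l ∈ x -> l ∈ sep c (fun l => l ∈ x)).
  { intros x l. rewrite in_sep by dfn. tauto. }
  assert (Hor : forall l, l ∈ c -> l ∈ a \/ l ∈ b).
  { intros l Hl. rewrite <- in_cup. auto. }
  destruct (classic (nonempty (sep c (fun l => l ∈ a)))) as [Na|Na],
    (classic (nonempty (sep c (fun l => l ∈ b)))) as [Nb|Nb].
  - destruct (Ha _ (proj1 (Hca a)) Na) as (x & Hx & Hxm).
    destruct (Hb _ (proj1 (Hca b)) Nb) as (y & Hy & Hym).
    assert (Hxo : is_ordinal x) by (apply (ordinal_mem i); auto; apply Hai; now apply (Hca a)).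
    assert (Hyo : is_ordinal y) by (apply (ordinal_mem i); auto; apply Hbi; now apply (Hca b)).
    destruct (ordinal_subset_or x y Hxo Hyo) as [H|H].
    + exists y. split; [now apply (Hca b)|]. intros l Hl. destruct (Hor l Hl) as [Hla|Hlb]; auto.
      assert (Hls : l ∈ succ y).
      { apply (ordinal_subset_mem l y); [now apply ordinal_succ|apply (ordinal_mem i); auto| |apply in_succ; auto].
        destruct (Hxm l) as [H1| ->]; auto. eapply subset_trans; [|exact H]. now apply Hxo. }
      now rewrite in_succ in Hls.
    + exists x. split; [now apply (Hca a)|]. intros l Hl. destruct (Hor l Hl) as [Hla|Hlb]; auto.
      left. destruct (Hym l) as [H1| ->]; auto. exact (ordinal_trans x y l Hxo H H1).
  - destruct (Ha _ (proj1 (Hca a)) Na) as (x & Hx & Hxm).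
    exists x. split; [now apply (Hca a)|]. intros l Hl. destruct (Hor l Hl) as [Hla|Hlb]; auto.
    exfalso. apply Nb. exists l. auto.
  - destruct (Hb _ (proj1 (Hca b)) Nb) as (x & Hx & Hxm).
    exists x. split; [now apply (Hca b)|]. intros l Hl. destruct (Hor l Hl) as [Hla|Hlb]; auto.
    exfalso. apply Na. exists l. auto.
  - exfalso. destruct Hne as [l Hl]. destruct (Hor l Hl); [apply Na|apply Nb]; exists l; auto.
Qed.

(** Induction on a bound of the support. Asking whether [u]-almost every value at the largest
    coordinate [k] is good gives a set supported below [k]; once that is decided, [almost_fubini]
    carries the answer back. With empty support the predicate is constant on the paths. *)
Lemma almost_ultra (P : M -> Prop) a : dpred1 P -> a ⊆ i -> finite a -> supports m i a P ->
  ae P \/ ae (fun s => ~ P s).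
Proof.
  intros HP Hai Hfin Hsup.
  (* The induction statement must be first-order, so it quantifies over sets [x] of paths in place
     of predicates. *)
  assert (H : forall b, is_ordinal b -> forall x a, a ⊆ b -> a ⊆ i -> finite a ->
    supports m i a (fun s => s ∈ x) -> ae (fun s => s ∈ x) \/ ae (fun s => ~ s ∈ x)).
  { intros b Hb.
    apply (ordinal_induction (fun b => forall x a, a ⊆ b -> a ⊆ i -> finite a ->
      supports m i a (fun s => s ∈ x) -> ae (fun s => s ∈ x) \/ ae (fun s => ~ s ∈ x)));
      [dfn|exact Hb|].
    clear a b Hb Hai Hfin Hsup. intros b Hb IH x a Hab Hai Hfin Hsup.
    destruct (classic (nonempty a)) as [Hne|Hne].
    - destruct (Hfin a (subset_refl a) Hne) as (k & Hk & Hmax).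
      assert (Hki : k ∈ i) by auto.
      assert (Hsk : supports m i (succ k) (fun s => s ∈ x)).
      { intros s s' Hs Hs' Hag. apply Hsup; auto. intros l Hl. apply Hag. rewrite in_succ. auto. }
      assert (Ha' : forall l, l ∈ sep a (fun l => l ∈ k) <-> l ∈ a /\ l ∈ k).
      { intros l. now rewrite in_sep by dfn. }
      set (x' := sep paths (fun s => ualmost u (fun z => update i s k z ∈ x))).
      assert (Hx' : forall s, s ∈ x' <-> s ∈ paths /\ ualmost u (fun z => update i s k z ∈ x)).
      { intros s. unfold x'. now rewrite in_sep by dfn. }
      destruct (IH k (Hab k Hk) x' (sep a (fun l => l ∈ k))) as [H|H].
      + intros l Hl. now apply Ha'.
      + intros l Hl. apply Hai. now apply Ha'.
      + apply (finite_subset a); [|exact Hfin]. intros l Hl. now apply Ha'.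
      + intros s s' Hs Hs' Hag H. apply Hx' in H as [_ H]. apply Hx'. split; [exact Hs'|].
        eapply ualmost_mono; [exact Hm| |exact H]. intros z Hz. cbv beta.
        apply Hsup; auto using update_paths. apply update_agree; [exact Hai|].
        intros l Hl Hn. apply Hag. apply Ha'. split; [exact Hl|]. destruct (Hmax l Hl); tauto.
      + left. apply (almost_fubini (fun s => s ∈ x) k); [dfn|exact Hki|exact Hsk|].
        eapply almost_mono; [|exact H]. intros s _ Hs. now apply Hx'.
      + right. apply (almost_fubini (fun s => ~ s ∈ x) k); [dfn|exact Hki| |].
        * intros s s' Hs Hs' Hag Hn Hs'x. apply Hn. apply (Hsk s'); auto.
          intros l Hl. symmetry. auto.
        * eapply almost_mono; [|exact H]. intros s Hs Hn.
          destruct (ualmost_ultra m u Hm (fun z => update i s k z ∈ x)) as [Hu|Hu];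
            [dfn| |exact Hu]. exfalso. apply Hn. now apply Hx'.
    - destruct (classic (exists s, s ∈ paths /\ s ∈ x)) as [(s & Hs & Hsx)|Hn].
      + left. apply almost_true. intros s' Hs'. apply (Hsup s); auto.
        intros l Hl. exfalso. apply Hne. now exists l.
      + right. apply almost_true. eauto. }
  destruct (H i Hi (sep paths P) a) as [H1|H1]; auto.
  - intros s s' Hs Hs' Hag Hp. rewrite in_sep in * by exact HP. destruct Hp as [_ Hp]. eauto.
  - left. eapply almost_mono; [|exact H1]. intros s _ Hs. rewrite in_sep in Hs by exact HP. tauto.
  - right. eapply almost_mono; [|exact H1]. intros s Hsp Hs Hps. apply Hs.
    rewrite in_sep by exact HP. now split.
Qed.

Lemma almost_false (P : M -> Prop) : ae P -> ae (fun s => ~ P s) -> False.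
Proof.
  intros H1 H2. destruct (almost_nonempty _ (almost_and _ _ H1 H2)) as (s & _ & H & Hn). auto.
Qed.

(** The converse of [almost_fubini]: the finite support lets the filter decide, and a negative
    decision would yield [~ P] almost everywhere. *)
Lemma almost_fubini_down (P : M -> Prop) k a : dpred1 P -> k ∈ i -> a ⊆ i -> finite a ->
  a ⊆ succ k -> supports m i a P -> ae P -> ae (fun s => ualmost u (fun z => P (update i s k z))).
Proof.
  intros HP Hk Hai Hfin Hak Hsup H.
  assert (Hsym : forall s s', s ∈ paths -> s' ∈ paths -> agree s s' a -> P s <-> P s').
  { intros s s' Hs Hs' Hag. split; apply Hsup; auto. intros l Hl. symmetry. auto. }
  destruct (almost_ultra (fun s => ualmost u (fun z => P (update i s k z))) a) as [H1|H1]; auto.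
  - dfn.
  - intros s s' Hs Hs' Hag. apply (ualmost_mono m u Hm). intros z Hz.
    apply Hsup; auto using update_paths. apply update_agree; auto.
  - exfalso. apply (almost_false P H). apply (almost_fubini (fun s => ~ P s) k); [dfn|exact Hk| |].
    + intros s s' Hs Hs' Hag Hn Hp. apply Hn. apply (Hsym s s'); auto. intros l Hl. auto.
    + eapply almost_mono; [|exact H1]. intros s Hs Hn.
      destruct (ualmost_ultra m u Hm (fun z => P (update i s k z))) as [Hu|Hu]; [dfn|exfalso; exact (Hn Hu)|exact Hu].
Qed.

End Iteration.

(** * The transitive collapse and Łoś's theorem for bounded formulas *)

Section CollapseDefs.
Context {M : set_structure} {HM : ZFC M}.
Implicit Types m u i f t r : M.

Definition fdom m i t : M := sep (funs (funs i m) t) (finsupp m i).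

(** Mostowski's recursion, confined to functions with values in [t]. For transitive [t] no member is
    lost, since a function almost everywhere in [f] can be altered to have its values in [t]. *)
Definition collapse_map m u i t r : Prop := forall f, f ∈ fdom m i t ->
  forall z, z ∈ app r f <-> exists g, g ∈ fdom m i t /\ mem_ae m u i g f /\ z = app r g.

(* The image in the transitive collapse of the ultrapower class of a function [f] on [funs i m];
   it is computed inside any transitive set containing the values of [f]. *)
Definition collapse m u i f : M := iota (fun y => exists t r,
  transitive t /\ f ∈ fdom m i t /\ collapse_map m u i t r /\ y = app r f).

Definition constant m i x : M := lam (funs i m) (fun _ => x).

Definition embed m u i x : M := collapse m u i (constant m i x).

End CollapseDefs.

Ltac dfn_collapse := match goal with
  | |- dterm (fun e => fdom _ _ _) => unfold fdom
  | |- defp (fun e => collapse_map _ _ _ _ _) => unfold collapse_map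
  | |- dterm (fun e => collapse _ _ _ _) => unfold collapse
  | |- dterm (fun e => constant _ _ _) => unfold constant
  | |- dterm (fun e => embed _ _ _ _) => unfold embed
  | |- _ => dfn_iteration
  end.
Ltac dfn_ext ::= dfn_collapse.

Section Ultrapower.
Context {M : set_structure} {HM : ZFC M}.
Implicit Types s f g h x y z a b k l t r : M.
Variables m u i : M.
Hypotheses (Hm : measure m u) (Hi : is_ordinal i).

Notation paths := (funs i m).
Notation ae := (almost m u i).
Notation K := (finsupp m i).
Notation E := (mem_ae m u i).
Notation cst := (constant m i).
Notation pi := (collapse m u i).
Notation j := (embed m u i).

Lemma finsupp_lam (F : M -> M) a : dfun1 F -> a ⊆ i -> finite a ->
  (forall s s', s ∈ paths -> s' ∈ paths -> agree s s' a -> F s = F s') -> K (lam paths F).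
Proof.
  intros HF Ha Hfin H. split; [now apply is_fun_lam|]. exists a. split; [exact Ha|split; [exact Hfin|]].
  intros s s' Hs Hs' Hag. rewrite !app_lam by assumption. auto.
Qed.

Lemma finsupp_constant x : K (cst x).
Proof.
  apply (finsupp_lam (fun _ => x) empty); [dfn| |apply finite_empty|auto].
  intros z Hz. now apply in_empty in Hz.
Qed.

Lemma app_constant x s : s ∈ paths -> app (cst x) s = x.
Proof. intros Hs. unfold constant. now rewrite app_lam by (dfn || assumption). Qed.

Lemma finsupp_comp2 f g (F : M -> M -> M) : K f -> K g -> dfun2 F ->
  K (lam paths (fun s => F (app f s) (app g s))).
Proof.
  intros [_ (a & Ha & Hfa & Hsa)] [_ (b & Hb & Hfb & Hsb)] HF.
  apply (finsupp_lam _ (cup a b)); [dfn| |now apply (finite_cup i)|].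
  - intros l. rewrite in_cup. intros [H|H]; auto.
  - intros s s' Hs Hs' Hag. rewrite (Hsa s s'), (Hsb s s'); auto;
      intros l Hl; apply Hag; rewrite in_cup; auto.
Qed.

Lemma finsupp_comp f (F : M -> M) : K f -> dfun1 F -> K (lam paths (fun s => F (app f s))).
Proof. intros Hf HF. apply (finsupp_comp2 f f (fun x _ => F x)); auto. Qed.

Lemma almost_decide2 f g (P : M -> M -> Prop) : K f -> K g -> dpred2 P ->
  ae (fun s => P (app f s) (app g s)) \/ ae (fun s => ~ P (app f s) (app g s)).
Proof.
  intros [_ (a & Ha & Hfa & Hsa)] [_ (b & Hb & Hfb & Hsb)] HP.
  apply (almost_ultra m u i Hm Hi _ (cup a b)); [dfn| |now apply (finite_cup i)|].
  - intros l. rewrite in_cup. intros [H|H]; auto.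
  - intros s s' Hs Hs' Hag. rewrite (Hsa s s'), (Hsb s s'); auto;
      intros l Hl; apply Hag; rewrite in_cup; auto.
Qed.

Lemma almost_decide f (P : M -> Prop) : K f -> dpred1 P ->
  ae (fun s => P (app f s)) \/ ae (fun s => ~ P (app f s)).
Proof. intros Hf HP. apply (almost_decide2 f f (fun x _ => P x)); auto. Qed.

(** Otherwise each element of [a] is avoided almost everywhere, hence by smallness all of them
    together. *)
Lemma almost_constant f a : small u a -> K f -> ae (fun s => app f s ∈ a) ->
  exists q, q ∈ a /\ ae (fun s => app f s = q).
Proof.
  intros Ha Hf H. apply NNPP. intros Hn.
  apply (almost_false m u i Hm Hi _ H).
  eapply almost_mono;
    [|apply (almost_small_inter m u i Hm a (fun q s => app f s <> q)); [exact Ha|dfn|]].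
  - intros s Hs Hq Hfs. exact (Hq _ Hfs eq_refl).
  - intros q Hq. destruct (almost_decide f (fun x => x = q) Hf) as [H1|H1]; [dfn| |exact H1].
    exfalso. eauto.
Qed.

(** Composing [f] with a single choice function on its values preserves its support; independent
    choices for the sequences [s] would not. *)
Lemma almost_choose f : K f -> ae (fun s => nonempty (app f s)) ->
  exists h, K h /\ ae (fun s => app h s ∈ app f s).
Proof.
  intros Hf H. destruct (choice_of_elements (repl paths (app f))) as [c Hc].
  exists (lam paths (fun s => app c (app f s))). split; [apply finsupp_comp; [exact Hf|dfn]|].
  eapply almost_mono; [|exact H]. intros s Hs Hne. rewrite app_lam by (dfn || assumption).
  apply Hc; [|exact Hne]. rewrite in_repl by dfn. eauto.
Qed.

Lemma mem_ae_congr f g g' : ae (fun s => app g s = app g' s) -> E g f -> E g' f.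
Proof.
  intros H1 H2. eapply almost_mono; [|exact (almost_and m u i Hm _ _ H1 H2)].
  intros s _ [E1 E2]. now rewrite <- E1.
Qed.

Lemma mem_ae_congr_r f f' g : ae (fun s => app f s = app f' s) -> E g f -> E g f'.
Proof.
  intros H1 H2. eapply almost_mono; [|exact (almost_and m u i Hm _ _ H1 H2)].
  intros s _ [E1 E2]. now rewrite <- E1.
Qed.

Lemma almost_sym f g : ae (fun s => app f s = app g s) -> ae (fun s => app g s = app f s).
Proof. apply almost_mono. intros s _. now symmetry. Qed.

(** A descending omega-sequence of functions would, because omega is small, descend pointwise at
    some path, against Foundation. *)
Lemma mem_ae_wf a : wf_on E a.
Proof.
  intros b _ [f0 Hf0]. apply NNPP. intros Hn.
  destruct (choice_function b b (fun f g => E g f)) as (c & Hc & Hcs); [dfn| |].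
  { intros f Hf. apply NNPP. intros Hn'. apply Hn. exists f. split; [exact Hf|].
    intros g Hg HE. eauto. }
  apply in_funs in Hc as [_ Hc].
  pose proof Hm as (_ & (w & Hw & Hwm) & _).
  destruct (omega_recursion w Hw f0 (app c)) as (q & Hq0 & HqS); [dfn|].
  assert (Hqb : forall n, n ∈ w -> app q n ∈ b).
  { apply (omega_induction w Hw (fun n => app q n ∈ b)); [dfn|congruence|].
    intros n Hn' IH. rewrite HqS by exact Hn'. auto. }
  destruct (almost_nonempty m u i Hm Hi
    (fun s => forall n, n ∈ w -> app (app q (succ n)) s ∈ app (app q n) s)) as (s & Hs & Hd).
  { apply (almost_small_inter m u i Hm w (fun n s => app (app q (succ n)) s ∈ app (app q n) s)).
    - now apply (small_ordinal m u).
    - dfn.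
    - intros n Hn'. rewrite HqS by exact Hn'. apply Hcs. auto. }
  destruct (wf_on_mem (repl w (fun n => app (app q n) s)) (repl w (fun n => app (app q n) s)))
    as (x & Hx & Hmin).
  - apply subset_refl.
  - exists (app (app q empty) s). rewrite in_repl by dfn. exists empty.
    split; [now apply omega_empty|reflexivity].
  - rewrite in_repl in Hx by dfn. destruct Hx as (n & Hn' & ->).
    apply (Hmin (app (app q (succ n)) s)); [|auto].
    rewrite in_repl by dfn. exists (succ n). split; [now apply omega_succ|reflexivity].
Qed.

Lemma in_fdom t f : f ∈ fdom m i t <-> K f /\ forall s, s ∈ paths -> app f s ∈ t.
Proof.
  unfold fdom. rewrite in_sep by dfn. rewrite in_funs. split; [tauto|].
  intros [H1 H2]. split; [|exact H1]. split; [apply H1|exact H2].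
Qed.

Lemma collapse_map_exists t : exists r, collapse_map m u i t r.
Proof.
  destruct (wf_recursion E (fdom m i t)
    (fun f h => repl (sep (fdom m i t) (fun g => E g f)) (app h))) as (r & _ & Hr);
    [dfn|apply mem_ae_wf|dfn|].
  exists r. intros f Hf z. rewrite (Hr f Hf). rewrite in_repl by dfn.
  split.
  - intros (g & Hg & ->). rewrite app_lam by (dfn || assumption).
    rewrite in_sep in Hg by dfn. exists g. tauto.
  - intros (g & Hg & HE & ->).
    assert (Hg' : g ∈ sep (fdom m i t) (fun g => E g f)) by (rewrite in_sep by dfn; tauto).
    exists g. split; [exact Hg'|]. now rewrite app_lam by (dfn || assumption).
Qed.

Lemma collapse_map_congr t r f g : collapse_map m u i t r -> f ∈ fdom m i t -> g ∈ fdom m i t ->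
  ae (fun s => app f s = app g s) -> app r f = app r g.
Proof.
  intros Hr Hf Hg H. apply set_ext. intros z. rewrite (Hr f Hf), (Hr g Hg).
  split; intros (h & Hh & HE & ->); exists h; split; auto; split; auto;
    eapply mem_ae_congr_r; eauto using almost_sym.
Qed.

(** Where [g] fails to be in [f], the value of [f] is a default that lies in every transitive set
    containing the values of [f], and it adds only the support of [f]. *)
Let patch g f := lam paths (fun s => cond (app g s ∈ app f s) (app g s) (app f s)).

Lemma patch_spec g f : K g -> K f -> E g f ->
  K (patch g f) /\ ae (fun s => app g s = app (patch g f) s) /\
  forall t s, transitive t -> s ∈ paths -> app f s ∈ t -> app (patch g f) s ∈ t.
Proof.
  intros Hg Hf HE. unfold patch. split; [|split].
  - apply (finsupp_comp2 g f (fun x y => cond (x ∈ y) x y)); auto. dfn.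
  - eapply almost_mono; [|exact HE]. intros s Hs H. rewrite app_lam by (dfn || assumption).
    now rewrite cond_true.
  - intros t s Ht Hs Hfs. rewrite app_lam by (dfn || assumption).
    destruct (classic (app g s ∈ app f s)) as [H|H];
      [rewrite cond_true by exact H|rewrite cond_false by exact H]; [|exact Hfs].
    exact (Ht _ Hfs _ H).
Qed.

(** Makes [collapse] independent of the transitive set used. Members of [f] represented in one of
    the two sets are patched so as to be represented in both. *)
Lemma collapse_map_agree t r t' r' : transitive t -> transitive t' ->
  collapse_map m u i t r -> collapse_map m u i t' r' ->
  forall f, f ∈ fdom m i t -> f ∈ fdom m i t' -> app r f = app r' f.
Proof.
  intros Ht Ht' Hr Hr'.
  assert (H : forall f, f ∈ fdom m i t -> f ∈ fdom m i t' -> app r f = app r' f).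
  { apply (wf_induction E (fdom m i t) (fun f => f ∈ fdom m i t' -> app r f = app r' f) (mem_ae_wf _));
      [dfn|].
    intros f Hf IH Hf'.
    assert (Hp : forall g, K g -> E g f -> patch g f ∈ fdom m i t /\ patch g f ∈ fdom m i t' /\
      ae (fun s => app g s = app (patch g f) s)).
    { intros g Hg HE. destruct (patch_spec g f) as (H1 & H2 & H3); auto.
      { now apply in_fdom in Hf. }
      rewrite !in_fdom in *. repeat split; try apply H1; try exact H2;
        intros s Hs; apply H3; auto; now apply Hf || now apply Hf'. }
    apply set_ext. intros z. rewrite (Hr f Hf), (Hr' f Hf').
    split; intros (g & Hg & HE & ->).
    - destruct (Hp g) as (H1 & H2 & H3); auto; [now apply in_fdom in Hg|].
      assert (HE' : E (patch g f) f) by (eapply mem_ae_congr; eauto).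
      exists (patch g f). split; [exact H2|]. split; [exact HE'|].
      rewrite (collapse_map_congr t r g (patch g f)); auto.
    - destruct (Hp g) as (H1 & H2 & H3); auto; [now apply in_fdom in Hg|].
      assert (HE' : E (patch g f) f) by (eapply mem_ae_congr; eauto).
      exists (patch g f). split; [exact H1|]. split; [exact HE'|].
      rewrite (collapse_map_congr t' r' g (patch g f)); auto. symmetry. auto. }
  exact H.
Qed.

Lemma collapse_eq t r f : transitive t -> collapse_map m u i t r -> f ∈ fdom m i t -> pi f = app r f.
Proof.
  intros Ht Hr Hf. apply iota_eq; [now exists t, r|].
  intros y (t' & r' & Ht' & Hf' & Hr' & ->). now apply (collapse_map_agree t' r' t r).
Qed.

Lemma common_collapse f g : K f -> K g -> exists t r, transitive t /\ collapse_map m u i t r /\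
  f ∈ fdom m i t /\ g ∈ fdom m i t.
Proof.
  intros Hf Hg. pose proof Hm as (_ & (w & Hw & _) & _).
  destruct (transitive_cover w Hw (cup (repl paths (app f)) (repl paths (app g)))) as (t & Ht & Hts).
  destruct (collapse_map_exists t) as [r Hr]. exists t, r.
  split; [exact Ht|split; [exact Hr|]].
  rewrite !in_fdom. split; split; auto; intros s Hs; apply Hts; rewrite in_cup, !in_repl by dfn; eauto.
Qed.

Lemma collapse_congr f g : K f -> K g -> ae (fun s => app f s = app g s) -> pi f = pi g.
Proof.
  intros Hf Hg H. destruct (common_collapse f g Hf Hg) as (t & r & Ht & Hr & Hft & Hgt).
  rewrite (collapse_eq t r f), (collapse_eq t r g) by assumption.
  now apply (collapse_map_congr t).
Qed.

Lemma in_collapse f z : K f -> z ∈ pi f <-> exists g, K g /\ E g f /\ z = pi g.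
Proof.
  intros Hf. split.
  - destruct (common_collapse f f Hf Hf) as (t & r & Ht & Hr & Hft & _).
    rewrite (collapse_eq t r f), (Hr f) by assumption.
    intros (g & Hg & HE & ->). exists g. split; [now apply in_fdom in Hg|]. split; [exact HE|].
    symmetry. now apply (collapse_eq t).
  - intros (g & Hg & HE & ->). destruct (common_collapse f g Hf Hg) as (t & r & Ht & Hr & Hft & Hgt).
    rewrite (collapse_eq t r f), (collapse_eq t r g), (Hr f) by assumption. eauto.
Qed.

(** Extensionality of the ultrapower. If the functions differ almost everywhere, one of them has
    almost everywhere an element outside the other, selected by some [h]. Equality of the collapses
    gives a member [h'] of the other with the same collapse as [h], and the induction hypothesis
    identifies [h] and [h'] almost everywhere. *)
Lemma collapse_inj f g : K f -> K g -> pi f = pi g -> ae (fun s => app f s = app g s).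
Proof.
  intros Hf Hg. destruct (common_collapse f g Hf Hg) as (t & r & Ht & Hr & Hft & Hgt).
  rewrite (collapse_eq t r f), (collapse_eq t r g) by assumption.
  revert f Hft g Hgt Hf Hg.
  assert (H : forall f, f ∈ fdom m i t -> forall g, g ∈ fdom m i t -> app r f = app r g ->
    ae (fun s => app f s = app g s)); [|auto].
  apply (wf_induction E (fdom m i t) (fun f => forall g, g ∈ fdom m i t -> app r f = app r g ->
    ae (fun s => app f s = app g s)) (mem_ae_wf _)); [dfn|].
  intros f Hft IH g Hgt Eq.
  assert (Hf : K f) by now apply in_fdom in Hft. assert (Hg : K g) by now apply in_fdom in Hgt.
  destruct (almost_decide2 f g (fun x y => x = y) Hf Hg) as [H|H]; [dfn|exact H|]. exfalso.
  assert (Hd : forall f g, f ∈ fdom m i t -> g ∈ fdom m i t ->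
    ae (fun s => ~ app f s ⊆ app g s) ->
    exists h, h ∈ fdom m i t /\ E h f /\ ae (fun s => ~ app h s ∈ app g s)).
  { clear f g IH Hft Hgt Eq Hf Hg H. intros f g Hft Hgt H.
    assert (Hf : K f) by now apply in_fdom in Hft. assert (Hg : K g) by now apply in_fdom in Hgt.
    destruct (almost_choose (lam paths (fun s => sep (app f s) (fun x => ~ x ∈ app g s)))) as (h & Hh & Hhs).
    - apply (finsupp_comp2 f g (fun x y => sep x (fun z => ~ z ∈ y))); auto. dfn.
    - eapply almost_mono; [|exact H]. intros s Hs Hns. rewrite app_lam by (dfn || assumption).
      apply NNPP. intros Hn. apply Hns. intros x Hx. apply NNPP. intros Hxg. apply Hn.
      exists x. rewrite in_sep by dfn. now split.
    - assert (Hhs' : ae (fun s => app h s ∈ app f s /\ ~ app h s ∈ app g s)).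
      { eapply almost_mono; [|exact Hhs]. intros s Hs Hx. cbv beta in Hx. rewrite app_lam in Hx by (dfn || assumption).
        now rewrite in_sep in Hx by dfn. }
      assert (HE : E h f) by (eapply almost_mono; [|exact Hhs']; simpl; tauto).
      destruct (patch_spec h f Hh Hf HE) as (P1 & P2 & P3).
      exists (patch h f). split; [|split].
      + apply in_fdom. split; [exact P1|]. intros s Hs. apply P3; auto. apply in_fdom in Hft as [_ Hft]. auto.
      + eapply mem_ae_congr; eauto.
      + eapply almost_mono; [|exact (almost_and m u i Hm _ _ Hhs' P2)].
        intros s Hs [[_ Hn] <-]. exact Hn. }
  destruct (almost_decide2 f g (fun x y => x ⊆ y) Hf Hg) as [H1|H1]; [dfn| |].
  - destruct (Hd g f Hgt Hft) as (h & Hh & HE & Hn).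
    { eapply almost_mono; [|exact (almost_and m u i Hm _ _ H H1)]. intros s Hs [Hne Hsub] Hsub'.
      apply Hne. now apply subset_antisym. }
    assert (Hz : app r h ∈ app r f). { rewrite Eq. apply (Hr g Hgt). eauto. }
    apply (Hr f Hft) in Hz as (h' & Hh' & HE' & Eh).
    apply (almost_false m u i Hm Hi _ HE').
    eapply almost_mono; [|exact (almost_and m u i Hm _ _ Hn (IH h' Hh' HE' h Hh (eq_sym Eh)))].
    intros s Hs [Hns ->]. exact Hns.
  - destruct (Hd f g Hft Hgt H1) as (h & Hh & HE & Hn).
    assert (Hz : app r h ∈ app r g). { rewrite <- Eq. apply (Hr f Hft). eauto. }
    apply (Hr g Hgt) in Hz as (h' & Hh' & HE' & Eh).
    apply (almost_false m u i Hm Hi _ HE').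
    eapply almost_mono; [|exact (almost_and m u i Hm _ _ Hn (IH h Hh HE h' Hh' Eh))].
    intros s Hs [Hns <-]. exact Hns.
Qed.

Lemma collapse_mem f g : K f -> K g -> pi g ∈ pi f <-> E g f.
Proof.
  intros Hf Hg. rewrite in_collapse by exact Hf. split; [|eauto].
  intros (g' & Hg' & HE & Eq). eapply mem_ae_congr; [|exact HE].
  apply collapse_inj; auto.
Qed.

Definition los (phi : formula) : Prop := forall e : nat -> M, (forall n, K (e n)) ->
  sat (fun n => pi (e n)) phi <-> ae (fun s => sat (fun n => app (e n) s) phi).

Lemma common_support (e : nat -> M) n : (forall n, K (e n)) -> exists a, a ⊆ i /\ finite a /\
  forall s s', s ∈ paths -> s' ∈ paths -> agree s s' a -> forall c, c < n -> app (e c) s = app (e c) s'.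
Proof.
  intros He. induction n as [|n (a & Ha & Hf & Hs)].
  - exists empty. split; [|split; [apply finite_empty|intros; lia]].
    intros z Hz. now apply in_empty in Hz.
  - destruct (He n) as [_ (b & Hb & Hfb & Hsb)]. exists (cup a b). split; [|split].
    + intros l. rewrite in_cup. intros [H|H]; auto.
    + now apply (finite_cup i).
    + intros s s' Hsp Hsp' Hag c Hc.
      assert (c < n \/ c = n) as [H|H] by lia; [|subst c].
      * apply Hs; auto. intros l Hl. apply Hag. rewrite in_cup. auto.
      * apply Hsb; auto. intros l Hl. apply Hag. rewrite in_cup. auto.
Qed.

Lemma dpred_sat (e : nat -> M) phi : dpred1 (fun s => sat (fun n => app (e n) s) phi).
Proof. apply (defp_sat phi (fun n e' => app (e n) (e' 0))). intros n. dfn. Qed.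

Lemma almost_decide_sat (e : nat -> M) phi : (forall n, K (e n)) ->
  ae (fun s => sat (fun n => app (e n) s) phi) \/ ae (fun s => ~ sat (fun n => app (e n) s) phi).
Proof.
  intros He. destruct (common_support e (var_bound phi) He) as (a & Ha & Hf & Hs).
  apply (almost_ultra m u i Hm Hi _ a); auto.
  - apply dpred_sat.
  - intros s s' Hsp Hsp' Hag. cbv beta.
    rewrite (sat_agree_below _ _ (free_vars_below_var_bound phi) (fun n => app (e n) s) (fun n => app (e n) s'));
      [auto|]. intros c Hc. auto.
Qed.

Lemma los_not phi : los phi -> los (Neg phi).
Proof.
  intros H e He. cbn [sat]. rewrite (H e He). split.
  - intros Hn. destruct (almost_decide_sat e phi He); tauto.
  - intros H1 H2. exact (almost_false m u i Hm Hi _ H2 H1).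
Qed.

Lemma los_and phi psi : los phi -> los psi -> los (And phi psi).
Proof.
  intros H1 H2 e He. cbn [sat]. rewrite (H1 e He), (H2 e He). split.
  - intros [A B]. exact (almost_and m u i Hm _ _ A B).
  - intros A. split; (eapply almost_mono; [|exact A]); simpl; tauto.
Qed.

(** The bound collects the witnesses at each path [s] into a set [X s], and [almost_choose] then
    selects a finitely supported witness. *)
Lemma los_bex n phi : los phi -> los (Ex (And (Mem 0 (S n)) phi)).
Proof.
  intros H e He. cbn [sat scons].
  assert (Hsc : forall g, K g -> (forall c, K (scons g e c)) /\
    (fun c => pi (scons g e c)) = scons (pi g) (fun c => pi (e c)) /\
    forall s, (fun c => app (scons g e c) s) = scons (app g s) (fun c => app (e c) s)).
  { intros g Hg. split; [|split].
    - intros [|c]; simpl; auto.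
    - extensionality c. now destruct c.
    - intros s. extensionality c. now destruct c. }
  split.
  - intros (x & Hx & Hp). rewrite in_collapse in Hx by auto. destruct Hx as (g & Hg & HE & ->).
    destruct (Hsc g Hg) as (S1 & S2 & S3). rewrite <- S2 in Hp. apply H in Hp; [|exact S1].
    eapply almost_mono; [|exact (almost_and m u i Hm _ _ HE Hp)].
    intros s Hs [A B]. exists (app g s). rewrite <- S3. now split.
  - intros Hae.
    set (X := fun s => sep (app (e n) s) (fun x => sat (scons x (fun c => app (e c) s)) phi)).
    assert (Hd : forall s, dpred1 (fun x => sat (scons x (fun c => app (e c) s)) phi)).
    { intros s. apply (defp_sat phi (fun c e' => scons (e' 0) (fun c => app (e c) s) c)).
      intros [|c]; simpl; dfn. }
    assert (HX : dfun1 X).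
    { apply (dterm_sep (fun e' => app (e n) (e' 0))
        (fun e' x => sat (scons x (fun c => app (e c) (e' 0))) phi)); [dfn|].
      apply (defp_sat phi (fun c e' => scons (e' 0) (fun c => app (e c) (e' 1)) c)).
      intros [|c]; simpl; dfn. }
    (* Covers the bounding variable [n] as well as all variables of [phi], so that [X] has finite
       support. *)
    destruct (common_support e (S (max n (var_bound phi))) He) as (a & Ha & Hf & Hs).
    destruct (almost_choose (lam paths X)) as (h & Hh & Hhs).
    + apply (finsupp_lam X a); auto. intros s s' Hsp Hsp' Hag.
      unfold X. rewrite (Hs s s' Hsp Hsp' Hag n) by lia.
      apply set_ext. intros x. rewrite !in_sep by auto.
      rewrite (sat_agree_below _ _ (free_vars_below_var_bound phi) (scons x (fun c => app (e c) s))
        (scons x (fun c => app (e c) s'))); [reflexivity|].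
      intros [|c] Hc; simpl; [reflexivity|]. apply Hs; auto. lia.
    + eapply almost_mono; [|exact Hae]. intros s Hsp (x & Hx & Hp).
      rewrite app_lam by assumption. exists x. unfold X. rewrite in_sep by auto. now split.
    + destruct (Hsc h Hh) as (S1 & S2 & S3).
      assert (Hboth : ae (fun s => app h s ∈ app (e n) s /\ sat (fun c => app (scons h e c) s) phi)).
      { eapply almost_mono; [|exact Hhs]. intros s Hsp Hx. cbv beta in Hx. rewrite app_lam in Hx by assumption.
        unfold X in Hx. rewrite in_sep in Hx by auto. now rewrite S3. }
      exists (pi h). split.
      * apply collapse_mem; auto. eapply almost_mono; [|exact Hboth]. simpl; tauto.
      * rewrite <- S2. apply (H (scons h e) S1). eapply almost_mono; [|exact Hboth]. simpl; tauto.
Qed.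

Lemma los_equiv phi psi : (forall e : nat -> M, sat e phi <-> sat e psi) -> los phi -> los psi.
Proof.
  intros Heq H e He. rewrite <- Heq, (H e He). split; apply almost_mono; intros s _; apply Heq.
Qed.

Lemma los_Delta0 phi : Delta0 phi -> los phi.
Proof.
  induction 1 as [| | | | | |n f H IH|n f H IH].
  - intros e He. now apply collapse_mem.
  - intros e He. cbn [sat]. split; [now apply collapse_inj|now apply collapse_congr].
  - now apply los_not.
  - now apply los_and.
  - apply (los_equiv (Neg (And (Neg f) (Neg g)))); [intros e; simpl; tauto|].
    auto using los_not, los_and.
  - apply (los_equiv (Neg (And f (Neg g)))); [intros e; simpl; tauto|].
    auto using los_not, los_and.
  - apply (los_equiv (Neg (Ex (And (Mem 0 (S n)) (Neg f))))); [|auto using los_not, los_bex].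
    intros e. simpl. split.
    + intros H1 x Hx. apply NNPP. intros Hn. apply H1. eauto.
    + intros H1 (x & Hx & Hn). auto.
  - now apply los_bex.
Qed.

Lemma embed_Sigma1 phi (e : nat -> M) : Sigma1 phi -> sat e phi -> sat (fun n => j (e n)) phi.
Proof.
  intros H. revert e. induction H as [phi H|phi H IH]; intros e Hs.
  - apply (los_Delta0 phi H (fun n => cst (e n))); [intros n; apply finsupp_constant|].
    apply almost_true; [exact Hm|]. intros s Hsp.
    replace (fun n => app (cst (e n)) s) with e; [exact Hs|].
    extensionality n. now rewrite app_constant.
  - destruct Hs as [x Hx]. exists (j x). specialize (IH _ Hx).
    replace (scons (j x) (fun n => j (e n))) with (fun n => j (scons x e n)); [exact IH|].
    extensionality n. now destruct n.
Qed.

End Ultrapower.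

(** * The embedding of the universe *)

Section Embedding.
Context {M : set_structure} {HM : ZFC M}.
Implicit Types s f g h x y z a b c k l t r : M.
Variables m u i : M.
Hypotheses (Hm : measure m u) (Hi : is_ordinal i).

Notation paths := (funs i m).
Notation ae := (almost m u i).
Notation K := (finsupp m i).
Notation E := (mem_ae m u i).
Notation cst := (constant m i).
Notation pi := (collapse m u i).
Notation j := (embed m u i).

Lemma mem_ae_constant g x : E g (cst x) <-> ae (fun s => app g s ∈ x).
Proof. split; apply almost_mono; intros s Hs; now rewrite app_constant. Qed.

Lemma in_embed x z : z ∈ j x <-> exists g, K g /\ ae (fun s => app g s ∈ x) /\ z = pi g.
Proof.
  unfold embed. rewrite (in_collapse m u i Hm Hi) by (now apply finsupp_constant).
  split; intros (g & Hg & HE & ->); exists g; split; auto; split; auto; now apply mem_ae_constant.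
Qed.

Lemma collapse_in_embed g x : K g -> pi g ∈ j x <-> ae (fun s => app g s ∈ x).
Proof.
  intros Hg. unfold embed. rewrite collapse_mem by (auto; now apply finsupp_constant).
  apply mem_ae_constant.
Qed.

Lemma embed_mem x y : j x ∈ j y <-> x ∈ y.
Proof.
  unfold embed at 1. rewrite collapse_in_embed by (now apply finsupp_constant). split.
  - intros H. destruct (almost_nonempty m u i Hm Hi _ H) as (s & Hs & Hx).
    now rewrite app_constant in Hx.
  - intros H. apply almost_true; [exact Hm|]. intros s Hs. now rewrite app_constant.
Qed.

(** Functions into a small set are almost constant, so nothing new enters and the image is taken
    pointwise. *)
Lemma in_embed_small x z : small u x -> z ∈ j x <-> exists c, c ∈ x /\ z = j c.
Proof.
  intros Hx. split.
  - rewrite in_embed. intros (g & Hg & HE & ->).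
    destruct (almost_constant m u i Hm Hi g x Hx Hg HE) as (c & Hc & H).
    exists c. split; [exact Hc|]. apply collapse_congr; auto; [now apply finsupp_constant|].
    eapply almost_mono; [|exact H]. intros s Hs Es. now rewrite app_constant.
  - intros (c & Hc & ->). now apply embed_mem.
Qed.

Lemma embed_fixed t x : transitive t -> small u t -> x ⊆ t -> j x = x.
Proof.
  intros Ht Hst.
  assert (H : forall x, (forall c, c ∈ x -> j c = c) -> x ⊆ t -> j x = x).
  { intros y Hc Hy. apply set_ext. intros z.
    rewrite in_embed_small by (eapply small_subset; eauto). split.
    - intros (c & Hcy & ->). now rewrite Hc.
    - intros Hz. exists z. split; [exact Hz|]. symmetry. auto. }
  intros Hx. apply H; [|exact Hx]. intros c Hc. apply Hx in Hc. revert c Hc.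
  apply (wf_induction mem t (fun c => j c = c) (wf_on_mem t)); [dfn|].
  intros c Hc IH. apply H; [|now apply Ht]. intros d Hd. apply IH; [|exact Hd]. exact (Ht c Hc d Hd).
Qed.

Lemma collapse_ordinal f : K f -> ae (fun s => is_ordinal (app f s)) -> is_ordinal (pi f).
Proof.
  intros Hf Ho.
  assert (Hmem : forall g, K g -> E g f -> ae (fun s => is_ordinal (app g s))).
  { intros g Hg HE. eapply almost_mono; [|exact (almost_and m u i Hm _ _ Ho HE)].
    intros s Hs [H1 H2]. exact (ordinal_mem _ _ H1 H2). }
  assert (Ht : forall f, K f -> ae (fun s => is_ordinal (app f s)) -> transitive (pi f)).
  { clear f Hf Ho Hmem. intros f Hf Ho y Hy z Hz.
    apply (in_collapse m u i Hm Hi) in Hy; [|exact Hf]. destruct Hy as (g & Hg & HE & ->).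
    apply (in_collapse m u i Hm Hi) in Hz; [|exact Hg]. destruct Hz as (h & Hh & HE' & ->).
    apply collapse_mem; auto.
    eapply almost_mono; [|exact (almost_and m u i Hm _ _ Ho (almost_and m u i Hm _ _ HE HE'))].
    intros s Hs (H1 & H2 & H3). exact (ordinal_trans _ _ _ H1 H2 H3). }
  apply ordinal_iff. split; [now apply Ht|]. intros x Hx.
  apply (in_collapse m u i Hm Hi) in Hx; [|exact Hf]. destruct Hx as (g & Hg & HE & ->).
  apply Ht; auto.
Qed.

Lemma embed_ordinal x : is_ordinal x -> is_ordinal (j x).
Proof.
  intros H. apply collapse_ordinal; [now apply finsupp_constant|].
  apply almost_true; [exact Hm|]. intros s Hs. now rewrite app_constant.
Qed.

(** If [j x ∈ x], then [j (j x) ∈ j x], and the induction hypothesis at [j x] would give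
    [j (j x) ∈ j (j x)]. *)
Lemma embed_ge x : is_ordinal x -> x ⊆ j x.
Proof.
  intros Hx. apply (ordinal_induction (fun x => x ⊆ j x)); [dfn|exact Hx|].
  clear x Hx. intros x Hx IH.
  destruct (ordinal_subset_or x (j x) Hx (embed_ordinal x Hx)) as [H|H]; [exact H|].
  exfalso. apply (mem_irrefl (j (j x))). apply (IH (j x) H). now apply embed_mem.
Qed.

Lemma embed_below_crit b : b ∈ m -> j b = b.
Proof.
  intros Hb. apply (embed_fixed b); [|now apply (small_ordinal m u)|apply subset_refl].
  apply ordinal_transitive. apply (ordinal_mem m); [now apply (measure_ordinal m u)|exact Hb].
Qed.

(** The coordinate functions [v k] represent a strictly increasing sequence of ordinals below [j m]:
    almost every next value exceeds a given earlier one. The [k]-th term of such a sequence is at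
    least [k]. *)
Lemma length_subset_embed_crit : i ⊆ j m.
Proof.
  pose proof (measure_ordinal m u Hm) as Hmo.
  set (v := fun k => lam paths (fun s => app s k)).
  assert (Hv : forall k s, s ∈ paths -> app (v k) s = app s k).
  { intros k s Hs. unfold v. now rewrite app_lam by (dfn || assumption). }
  assert (HK : forall k, k ∈ i -> K (v k)).
  { intros k Hk. apply (finsupp_lam m i _ (sing k)); [dfn| |apply finite_sing|].
    - intros l Hl. rewrite in_sing in Hl. now subst.
    - intros s s' _ _ H. apply H. now apply in_sing. }
  assert (Hj : forall k, k ∈ i -> pi (v k) ∈ j m).
  { intros k Hk. apply collapse_in_embed; [auto|]. apply almost_true; [exact Hm|].
    intros s Hs. rewrite Hv by exact Hs. apply in_funs in Hs as [_ Hs]. auto. }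
  assert (Hlt : forall k l, k ∈ i -> l ∈ k -> pi (v l) ∈ pi (v k)).
  { intros k l Hk Hl. assert (Hli : l ∈ i) by exact (ordinal_trans i k l Hi Hk Hl).
    apply collapse_mem; auto. apply (almost_fubini m u i Hm Hi (fun s => app (v l) s ∈ app (v k) s) k).
    - unfold v. dfn.
    - exact Hk.
    - intros s s' Hs Hs' Hag. rewrite !Hv by assumption. rewrite !Hag; [auto|..]; rewrite in_succ; auto.
    - apply almost_true; [exact Hm|]. intros s Hs. pose proof Hs as Hs'. apply in_funs in Hs' as [_ Hs'].
      eapply ualmost_mono; [exact Hm| |exact (ualmost_above m u Hm (app s l) (Hs' l Hli))].
      intros z Hz Hlz. rewrite !Hv by (now apply update_paths).
      rewrite update_same, update_other; auto. intros ->. exact (mem_irrefl _ Hl). }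
  assert (Hge : forall k, is_ordinal k -> k ∈ i -> k ⊆ pi (v k)).
  { intros k Hk. apply (ordinal_induction (fun k => k ∈ i -> k ⊆ pi (v k))); [unfold v; dfn|exact Hk|].
    clear k Hk. intros k Hk IH Hki l Hl.
    assert (Hli : l ∈ i) by exact (ordinal_trans i k l Hi Hki Hl).
    apply (ordinal_subset_mem l (pi (v l))).
    - apply (ordinal_mem (j m)); [now apply embed_ordinal|auto].
    - exact (ordinal_mem k l Hk Hl).
    - auto.
    - auto. }
  intros k Hk. assert (Hko : is_ordinal k) by exact (ordinal_mem i k Hi Hk).
  apply (ordinal_subset_mem k (pi (v k))); auto. now apply embed_ordinal.
Qed.

(** Exceptional values are replaced by one fixed element of [x], so supports do not grow. The
    representatives of the elements of [j x] then range over a set of functions whose size can be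
    estimated. *)
Lemma normalize f x : K f -> ae (fun s => app f s ∈ x) ->
  exists g, K g /\ (forall s, s ∈ paths -> app g s ∈ x) /\ pi g = pi f /\
    ae (fun s => app g s = app f s) /\
    forall a, supports_fun m i a f -> supports_fun m i a g.
Proof.
  intros Hf Hx. destruct (almost_nonempty m u i Hm Hi _ Hx) as (s0 & Hs0 & Hx0).
  set (d := app f s0) in Hx0. clearbody d.
  set (g := lam paths (fun s => cond (app f s ∈ x) (app f s) d)).
  assert (Hg : forall s, s ∈ paths -> app g s = cond (app f s ∈ x) (app f s) d).
  { intros s Hs. unfold g. now rewrite app_lam by (dfn || assumption). }
  assert (HK : K g). { apply (finsupp_comp m i Hi f (fun y => cond (y ∈ x) y d)); auto. dfn. }
  assert (Hae : ae (fun s => app g s = app f s)).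
  { eapply almost_mono; [|exact Hx]. intros s Hs H. rewrite Hg by exact Hs. now apply cond_true. }
  exists g. split; [exact HK|]. split; [|split; [|split]].
  - intros s Hs. rewrite Hg by exact Hs. destruct (classic (app f s ∈ x)) as [H|H];
      [rewrite cond_true by exact H|rewrite cond_false by exact H]; auto.
  - now apply collapse_congr.
  - exact Hae.
  - intros a Ha s s' Hs Hs' Hag. rewrite !Hg by assumption. now rewrite (Ha s s' Hs Hs' Hag).
Qed.

(* An initial segment of the image of [m] is already generated by the first [i0] steps. *)
Lemma reduce_support f i0 a g : K f -> (forall s, s ∈ paths -> app f s ∈ m) ->
  is_ordinal i0 -> a ⊆ i0 -> a ⊆ i -> finite a -> supports_fun m i a f ->
  K g -> E g f -> exists g', K g' /\ supports_fun m i i0 g' /\ ae (fun s => app g s = app g' s).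
Proof.
  intros Hf Hfm Hi0 Ha0 Hai Hfa Hsf HKg.
  assert (H : forall b, is_ordinal b -> forall g c, K g -> E g f -> c ⊆ b -> c ⊆ i -> finite c ->
    supports_fun m i c g ->
    exists g', K g' /\ supports_fun m i i0 g' /\ ae (fun s => app g s = app g' s)).
  { intros b Hb. apply (ordinal_induction (fun b => forall g c, K g -> E g f -> c ⊆ b -> c ⊆ i ->
      finite c -> supports_fun m i c g ->
      exists g', K g' /\ supports_fun m i i0 g' /\ ae (fun s => app g s = app g' s))); [dfn|exact Hb|].
    clear b Hb g HKg. intros b Hb IH g c Hg HE Hcb Hci Hfc Hsg.
    destruct (classic (c ⊆ i0)) as [Hc0|Hc0].
    { exists g. split; [exact Hg|]. split.
      - intros s s' Hs Hs' Hag. apply Hsg; auto. intros l Hl. auto.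
      - now apply almost_true. }
    assert (Hl : exists l, l ∈ c /\ ~ l ∈ i0).
    { apply NNPP. intros Hn. apply Hc0. intros l Hl. apply NNPP. eauto. }
    destruct Hl as (l0 & Hl0 & Hl0').
    destruct (Hfc c (subset_refl c) (ex_intro _ l0 Hl0)) as (k & Hk & Hmax).
    assert (Hki : k ∈ i) by auto.
    assert (Hko : is_ordinal k) by exact (ordinal_mem i k Hi Hki).
    assert (Hi0k : i0 ⊆ k).
    { destruct (ordinal_subset_or i0 k Hi0 Hko) as [H|H]; [exact H|]. exfalso. apply Hl0'.
      destruct (Hmax l0 Hl0) as [H1| ->]; [exact (ordinal_trans i0 k l0 Hi0 H H1)|exact H]. }
    assert (Hsk : succ k ⊆ i).
    { intros l. rewrite in_succ. intros [Hl| ->]; [exact (ordinal_trans i k l Hi Hki Hl)|exact Hki]. }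
    (* The largest coordinate [k] of [g] is not in the support [a] of [f]. As the value [z] at [k]
       varies, [g] therefore stays in the fixed ordinal [app f s] below [m] and is almost constant;
       [V s] is that constant, and it no longer depends on [k]. *)
    set (V := fun s => iota (fun v => ualmost u (fun z => app g (update i s k z) = v))).
    assert (HV : dfun1 V) by (unfold V; dfn).
    set (c' := sep c (fun l => l ∈ k)).
    assert (Hc' : forall l, l ∈ c' <-> l ∈ c /\ l ∈ k).
    { intros l. unfold c'. now rewrite in_sep by dfn. }
    assert (HVs : forall s s', s ∈ paths -> s' ∈ paths -> agree s s' c' -> V s = V s').
    { intros s s' Hs Hs' Hag. apply iota_ext. intros v.
      assert (Hz : forall z, z ∈ m -> app g (update i s k z) = app g (update i s' k z)).
      { intros z Hz. apply Hsg; auto using update_paths. apply update_agree; [exact Hci|].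
        intros l Hl Hn. apply Hag, Hc'. split; [exact Hl|]. destruct (Hmax l Hl); tauto. }
      split; apply (ualmost_mono m u Hm); intros z Hzm; rewrite (Hz z Hzm); auto. }
    set (g1 := lam paths V).
    assert (Hg1 : forall s, s ∈ paths -> app g1 s = V s).
    { intros s Hs. unfold g1. now rewrite app_lam by assumption. }
    assert (Hc'i : c' ⊆ i) by (intros l Hl; apply Hci; now apply Hc').
    assert (Hfc' : finite c') by (apply (finite_subset c); [intros l Hl; now apply Hc'|exact Hfc]).
    assert (HK1 : K g1) by (apply (finsupp_lam m i V c'); auto).
    assert (HQ : ae (fun s => ualmost u (fun z => app g (update i s k z) = V s))).
    { assert (Hd : ae (fun s => ualmost u (fun z => app g (update i s k z) ∈ app f (update i s k z)))).
      { apply (almost_fubini_down m u i Hm Hi (fun s => app g s ∈ app f s) k (cup c a)).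
        - dfn.
        - exact Hki.
        - intros l. rewrite in_cup. intros [H|H]; auto.
        - now apply (finite_cup i).
        - intros l. rewrite in_cup, in_succ. intros [H|H]; auto.
        - intros s s' Hs Hs' Hag. rewrite (Hsg s s'), (Hsf s s'); auto;
            intros l Hl; apply Hag; rewrite in_cup; auto.
        - exact HE. }
      eapply almost_mono; [|exact Hd]. intros s Hs Hu. cbv beta in Hu.
      assert (Hu' : ualmost u (fun z => app (lam m (fun z => app g (update i s k z))) z ∈ app f s)).
      { eapply ualmost_mono; [exact Hm| |exact Hu]. intros z Hz Hgz. cbv beta in *.
        rewrite app_lam by (dfn || assumption).
        rewrite (Hsf s (update i s k z)); auto using update_paths.
        intros l Hl. rewrite update_other; auto. intros ->. apply (mem_irrefl k). auto. }
      destruct (small_ordinal m u Hm (app f s) (Hfm s Hs) _ Hu') as (v & _ & Hv).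
      assert (Hv' : ualmost u (fun z => app g (update i s k z) = v)).
      { eapply ualmost_mono; [exact Hm| |exact Hv]. intros z Hz Ez. cbv beta in *.
        now rewrite app_lam in Ez by (dfn || assumption). }
      replace (V s) with v; [exact Hv'|]. symmetry. apply iota_eq; [exact Hv'|].
      intros v' Hv''. destruct (ualmost_nonempty m u Hm _ (ualmost_and m u Hm _ _ Hv' Hv'')) as (z & _ & <- & <-).
      reflexivity. }
    assert (Hae : ae (fun s => app g s = app g1 s)).
    { apply (almost_fubini m u i Hm Hi (fun s => app g s = app g1 s) k); [dfn|exact Hki| |].
      - intros s s' Hs Hs' Hag. rewrite (Hg1 s Hs), (Hg1 s' Hs').
        rewrite (Hsg s s'), (HVs s s'); auto; intros l Hl; apply Hag; rewrite in_succ.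
        + apply Hc' in Hl. tauto.
        + auto.
      - eapply almost_mono; [|exact HQ]. intros s Hs Hu.
        eapply ualmost_mono; [exact Hm| |exact Hu]. intros z Hz Ez. cbv beta in *.
        rewrite Hg1 by (now apply update_paths). rewrite Ez. apply HVs; auto using update_paths.
        intros l Hl. rewrite update_other; auto. apply Hc' in Hl as [_ Hl]. intros ->.
        exact (mem_irrefl _ Hl). }
    destruct (IH k (Hcb k Hk) g1 c') as (g' & H1 & H2 & H3); auto.
    - eapply mem_ae_congr; eauto.
    - intros l Hl. now apply Hc'.
    - intros s s' Hs Hs' Hag. rewrite !Hg1 by assumption. auto.
    - exists g'. split; [exact H1|split; [exact H2|]].
      eapply almost_mono; [|exact (almost_and m u i Hm _ _ Hae H3)]. intros s _ [-> ->]. reflexivity. }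
  intros HE. pose proof HKg as [_ (c & Hci & Hfc & Hsc)]. exact (H i Hi g c HKg HE Hci Hci Hfc Hsc).
Qed.

(* If [i ⊆ z] for some [z ∈ j m], representing functions inject [i] into a set small for [v]. *)
Lemma embed_crit_measurable v : measure i v -> m ∈ i -> j m = i.
Proof.
  intros Hv Hmi. pose proof (measure_ordinal m u Hm) as Hmo.
  apply subset_antisym; [|exact length_subset_embed_crit].
  intros z Hz. pose proof (ordinal_mem _ _ (embed_ordinal m Hmo) Hz) as Hzo.
  destruct (ordinal_subset_or i z Hi Hzo) as [Hiz|]; [exfalso|assumption].
  rewrite in_embed in Hz. destruct Hz as (f0 & Hf0 & Hf0m & ->).
  destruct (normalize f0 m Hf0 Hf0m) as (f & Hf & Hfm & Ef & _). rewrite <- Ef in *. clear Ef f0 Hf0 Hf0m.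
  pose proof Hf as [_ (a & Hai & Hfa & Hsf)].
  (* A finite support is bounded below the limit ordinal [i]; this bound is what makes the set [B]
     of representing functions small for [v]. *)
  assert (Hi0 : exists i0, i0 ∈ i /\ a ⊆ i0).
  { destruct (classic (nonempty a)) as [Hne|Hne].
    - destruct (Hfa a (subset_refl a) Hne) as (k & Hk & Hmax). exists (succ k).
      split; [apply (measure_succ i v Hv); auto|]. intros l Hl. rewrite in_succ. auto.
    - exists empty. split; [now apply (measure_empty i v)|]. intros l Hl. exfalso. apply Hne. now exists l. }
  destruct Hi0 as (i0 & Hi0 & Hai0).
  assert (Hi0o : is_ordinal i0) by exact (ordinal_mem i i0 Hi Hi0).
  assert (Hi0i : i0 ⊆ i) by (now apply ordinal_transitive).
  set (B := sep (funs paths m) (fun g => K g /\ supports_fun m i i0 g)).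
  assert (HB : forall g, g ∈ B <-> g ∈ funs paths m /\ K g /\ supports_fun m i i0 g).
  { intros g. unfold B. now rewrite in_sep by dfn. }
  destruct (choice_function i B (fun x g => pi g = x)) as (h & Hh & Hhs); [dfn| |].
  { intros x Hx. apply Hiz in Hx. rewrite in_collapse in Hx by assumption.
    destruct Hx as (g & Hg & HE & ->).
    destruct (reduce_support f i0 a g Hf Hfm Hi0o Hai0 Hai Hfa Hsf Hg HE) as (g' & Hg' & Hsg' & Hae).
    assert (Hg'm : ae (fun s => app g' s ∈ m)).
    { eapply almost_mono; [|exact (almost_and m u i Hm _ _ Hae HE)]. intros s Hs [<- H].
      exact (ordinal_trans m _ _ Hmo (Hfm s Hs) H). }
    destruct (normalize g' m Hg' Hg'm) as (g'' & Hg'' & Hm'' & E'' & _ & Hs'').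
    exists g''. split.
    - apply HB. split; [|split; auto]. apply in_funs. split; [apply Hg''|exact Hm''].
    - rewrite E''. symmetry. now apply collapse_congr. }
  apply in_funs in Hh as [_ Hh].
  apply (small_no_injection i v Hv B h); auto.
  - assert (Hext : forall t, t ∈ funs i0 m -> lam i (app t) ∈ paths).
    { intros t Ht. apply in_funs in Ht as [Ht1 Ht2]. apply lam_in_funs; [dfn|]. intros l Hl.
      destruct (classic (l ∈ i0)) as [H|H]; [auto|]. rewrite Ht1, app_lam_out by (dfn || assumption).
      now apply (measure_empty m u). }
    (* A function supported on [i0] is determined by its values on sequences of length [i0] padded
       with [empty], and [i0] and [m] are both below [i]. *)
    apply (small_injection i v Hv B (funs (funs i0 m) m) (fun g => lam (funs i0 m) (fun t => app g (lam i (app t))))).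
    + dfn.
    + intros g Hg. apply HB in Hg as (Hg & _ & _). apply in_funs in Hg as [_ Hg].
      apply lam_in_funs; [dfn|]. auto.
    + intros g g' Hg Hg' Eq. apply HB in Hg as (Hg & _ & Hs). apply HB in Hg' as (Hg' & _ & Hs').
      apply in_funs in Hg as [Hg _]. apply in_funs in Hg' as [Hg' _].
      apply (fun_ext _ _ paths Hg Hg'). intros s Hsp.
      assert (Ht : lam i0 (app s) ∈ funs i0 m).
      { apply in_funs in Hsp as [_ Hsp]. apply lam_in_funs; [dfn|]. auto. }
      assert (Hag : agree s (lam i (app (lam i0 (app s)))) i0).
      { intros l Hl. rewrite app_lam by (dfn || auto). now rewrite app_lam by (dfn || auto). }
      rewrite (Hs s _ Hsp (Hext _ Ht) Hag), (Hs' s _ Hsp (Hext _ Ht) Hag).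
      assert (E1 := f_equal (fun q => app q (lam i0 (app s))) Eq). cbv beta in E1.
      now rewrite !app_lam in E1 by (dfn || exact Ht).
    + apply (small_funs i v Hv); [|now apply (small_ordinal i v)].
      apply (small_funs i v Hv); now apply (small_ordinal i v).
  - intros x y Hx Hy Eq. rewrite <- (Hhs x Hx), <- (Hhs y Hy). congruence.
Qed.

Section Above.
Variables m2 v : M.
Hypotheses (Hv : measure m2 v) (Hm2 : m ∈ m2) (Hi2 : i ∈ m2).

Lemma small_paths : small v paths.
Proof. apply (small_funs m2 v Hv); now apply (small_ordinal m2 v). Qed.

(** The elements of [j b] are represented in [funs paths b], which is small for [v] and hence too
    small to represent all of [m2]. *)
Lemma embed_below_measurable b : b ∈ m2 -> j b ∈ m2.
Proof.
  intros Hb. pose proof (measure_ordinal m2 v Hv) as H2o.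
  assert (Hbo : is_ordinal b) by exact (ordinal_mem m2 b H2o Hb).
  destruct (ordinal_subset_or m2 (j b) H2o (embed_ordinal b Hbo)) as [H|]; [exfalso|assumption].
  destruct (choice_function m2 (funs paths b) (fun x g => pi g = x)) as (h & Hh & Hhs); [dfn| |].
  { intros x Hx. apply H in Hx. rewrite in_embed in Hx. destruct Hx as (g & Hg & Hgb & ->).
    destruct (normalize g b Hg Hgb) as (g' & Hg' & Hgb' & Eq & _). exists g'.
    split; [|exact Eq]. apply in_funs. split; [apply Hg'|exact Hgb']. }
  apply in_funs in Hh as [_ Hh].
  apply (small_no_injection m2 v Hv (funs paths b) h); auto.
  - apply (small_funs m2 v Hv); [exact small_paths|now apply (small_ordinal m2 v)].
  - intros x y Hx Hy Eq. rewrite <- (Hhs x Hx), <- (Hhs y Hy). congruence.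
Qed.

(** Continuity at [m2]: a function from the small set of paths into [m2] is bounded by some [b], and
    [j b] is still below [m2]. *)
Lemma embed_measurable : j m2 = m2.
Proof.
  pose proof (measure_ordinal m2 v Hv) as H2o.
  apply subset_antisym; [|now apply embed_ge].
  intros z Hz. rewrite in_embed in Hz. destruct Hz as (g & Hg & Hg2 & ->).
  destruct (normalize g m2 Hg Hg2) as (g' & Hg' & Hgb & Eq & _). rewrite <- Eq.
  destruct (small_bounded m2 v Hv paths (app g') small_paths) as (b & Hb & Hbs); [dfn|exact Hgb|].
  apply (ordinal_trans m2 (j b)); [exact H2o|now apply embed_below_measurable|].
  apply collapse_in_embed; [exact Hg'|]. now apply almost_true.
Qed.
End Above.

End Embedding.

(** * Limits of measurable cardinals *)

Section LimitOfMeasurables.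
Context {M : set_structure} {HM : ZFC M}.
Implicit Types m u i f g h x y z a b c q v : M.
Variable k : M.
Hypothesis Hk : is_limit_of_measurables k.

Lemma limit_ordinal : is_ordinal k.
Proof. apply Hk. Qed.

Lemma limit_nonempty : nonempty k.
Proof. apply Hk. Qed.

Lemma limit_measure a : a ∈ k -> exists m v, m ∈ k /\ a ∈ m /\ measure m v.
Proof.
  intros Ha. destruct Hk as (_ & _ & H). destruct (H a Ha) as (m & Hm & Ham & Hms).
  apply measurable_measure in Hms as [v Hv]. eauto.
Qed.

Lemma limit_measure2 a b : a ∈ k -> b ∈ k ->
  exists m v, m ∈ k /\ a ∈ m /\ b ∈ m /\ measure m v.
Proof.
  intros Ha Hb. pose proof limit_ordinal as Hko.
  destruct (limit_measure (cup a b)) as (m & v & Hmk & Habm & Hv); [now apply ordinal_cup_mem|].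
  assert (Hmo : is_ordinal m) by exact (ordinal_mem k m Hko Hmk).
  destruct (ordinal_cup_mem_inv a b m) as [Ham Hbm]; [exact (ordinal_mem k a Hko Ha)|exact (ordinal_mem k b Hko Hb)|exact Hmo|exact Habm|].
  exists m, v. auto.
Qed.

Lemma limit_of_measurables_succ a : a ∈ k -> succ a ∈ k.
Proof.
  apply limit_succ; [exact limit_ordinal|]. intros x Hx.
  destruct (limit_measure x Hx) as (m & _ & Hmk & Hxm & _). eauto.
Qed.

(** Continuity of the embedding at [k]. Since the embedding maps [k] into itself, this makes [k] a
    fixed point. *)
Definition bounded_functions m u i : Prop := forall f, finsupp m i f ->
  almost m u i (fun s => app f s ∈ k) -> exists b, b ∈ k /\ almost m u i (fun s => app f s ∈ b).

(* At most one regular cardinal, the cofinality of [k], can fail to give bounded functions. *)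
Lemma bounded_functions_above : exists n, n ∈ k /\ forall m u i, measure m u -> n ∈ m -> m ∈ k ->
  i ∈ k -> bounded_functions m u i.
Proof.
  pose proof limit_ordinal as Hko.
  (* Either a set [a] that is small for all measures above some [n] is mapped cofinally into [k];
     then the index in [a] of a bound for [app f s] is almost constant. Or there is no such map, and
     the set of paths, which is small for measures above [cup m i], is mapped boundedly. *)
  destruct (classic (exists a c n, n ∈ k /\ (forall m v, measure m v -> n ∈ m -> small v a) /\
    (forall x, x ∈ a -> app c x ∈ k) /\ forall b, b ∈ k -> exists x, x ∈ a /\ b ⊆ app c x))
    as [(a & c & n & Hn & Hsm & Hc & Hcof)|Hno].
  - exists n. split; [exact Hn|]. intros m u i Hm Hnm Hmk Hik f Hf Hfk.
    assert (Hi : is_ordinal i) by exact (ordinal_mem k i Hko Hik).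
    destruct (almost_choose m u i Hi (lam (funs i m) (fun s => sep a (fun x => app f s ⊆ app c x))))
      as (h & Hh & Hhs).
    + apply (finsupp_comp m i Hi f (fun y => sep a (fun x => y ⊆ app c x))); [exact Hf|dfn].
    + eapply almost_mono; [|exact Hfk]. intros s Hs Hfs. rewrite app_lam by (dfn || assumption).
      destruct (Hcof _ Hfs) as (x & Hx & Hsx). exists x. rewrite in_sep by dfn. now split.
    + assert (Hhs' : almost m u i (fun s => app h s ∈ a /\ app f s ⊆ app c (app h s))).
      { eapply almost_mono; [|exact Hhs]. intros s Hs H. cbv beta in H.
        rewrite app_lam in H by (dfn || assumption). now rewrite in_sep in H by dfn. }
      destruct (almost_constant m u i Hm Hi h a) as (x & Hx & Hhx); [eauto|exact Hh| |].
      { eapply almost_mono; [|exact Hhs']. simpl. tauto. }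
      exists (succ (app c x)). split; [apply limit_of_measurables_succ; auto|].
      eapply almost_mono; [|exact (almost_and m u i Hm _ _ Hfk (almost_and m u i Hm _ _ Hhs' Hhx))].
      intros s Hs (Hfs & (_ & Hsub) & E). rewrite E in Hsub.
      apply (ordinal_subset_mem _ (app c x)).
      * apply ordinal_succ. apply (ordinal_mem k); auto.
      * apply (ordinal_mem k); auto.
      * exact Hsub.
      * rewrite in_succ. auto.
  - exists empty. split; [exact (empty_mem k Hko limit_nonempty)|].
    intros m u i Hm _ Hmk Hik f Hf Hfk.
    assert (Hi : is_ordinal i) by exact (ordinal_mem k i Hko Hik).
    assert (Hmo : is_ordinal m) by exact (ordinal_mem k m Hko Hmk).
    destruct (normalize m u i Hm Hi f k Hf Hfk) as (g & Hg & Hgk & _ & Hae & _).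
    assert (Hb : exists b, b ∈ k /\ forall s, s ∈ funs i m -> app g s ∈ b).
    { apply NNPP. intros Hn. apply Hno. exists (funs i m), g, (cup m i).
      split; [now apply ordinal_cup_mem|]. split; [|split; [exact Hgk|]].
      - intros m' v Hv Hmi. pose proof (measure_ordinal m' v Hv) as Hmo'.
        destruct (ordinal_cup_mem_inv m i m') as [H1 H2]; auto.
        now apply (small_paths m i m' v Hv).
      - intros b Hb. apply NNPP. intros Hn'. apply Hn. exists b. split; [exact Hb|].
        intros s Hs. destruct (ordinal_subset_or b (app g s)) as [H|H]; auto.
        + exact (ordinal_mem k b Hko Hb).
        + apply (ordinal_mem k); auto.
        + exfalso. eauto. }
    destruct Hb as (b & Hb & Hgb). exists b. split; [exact Hb|].
    eapply almost_mono; [|exact Hae]. intros s Hs E. cbv beta in E. rewrite <- E. auto.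
Qed.

Section Embedding.
Variables m u i : M.
Hypotheses (Hm : measure m u) (Hmk : m ∈ k) (Hik : i ∈ k) (Hbd : bounded_functions m u i).
Notation j := (embed m u i).

Let Hi : is_ordinal i.
Proof. exact (ordinal_mem k i limit_ordinal Hik). Qed.

Lemma embed_below_limit b : b ∈ k -> j b ∈ k.
Proof.
  intros Hb. pose proof limit_ordinal as Hko.
  destruct (limit_measure2 m i Hmk Hik) as (m1 & _ & Hm1 & Hmm1 & Him1 & _).
  destruct (limit_measure2 m1 b Hm1 Hb) as (m2 & v & Hm2 & Hm12 & Hbm2 & Hv).
  pose proof (measure_ordinal m2 v Hv) as H2o.
  apply (ordinal_trans k m2); auto.
  pose proof (ordinal_trans m2 m1 m H2o Hm12 Hmm1). pose proof (ordinal_trans m2 m1 i H2o Hm12 Him1).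
  now apply (embed_below_measurable m u i Hm Hi m2 v Hv).
Qed.

Lemma embed_limit : j k = k.
Proof.
  pose proof limit_ordinal as Hko.
  apply subset_antisym; [|now apply embed_ge].
  intros z Hz. rewrite in_embed in Hz by auto. destruct Hz as (f & Hf & Hfk & ->).
  destruct (Hbd f Hf Hfk) as (b & Hb & Hfb).
  apply (ordinal_trans k (j b)); [exact Hko|now apply embed_below_limit|].
  now apply collapse_in_embed.
Qed.
End Embedding.

(** A substitute for [q] having at most [k] elements: it is layered in [k] steps whose initial parts
    are small for measures on arbitrarily large cardinals below [k]. *)
Definition ranked q (r : M -> M) : Prop := (forall x, x ∈ q -> r x ∈ k) /\
  forall b, b ∈ k -> exists m v, m ∈ k /\ b ∈ m /\ measure m v /\
    small v (sep q (fun x => r x ∈ b)).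

Lemma ranked_enumeration q (r : M -> M) : dfun1 r -> ranked q r ->
  exists e, forall x, x ∈ q -> exists y, y ∈ k /\ app e y = x.
Proof.
  intros Hr [Hrk Hsm]. pose proof limit_ordinal as Hko.
  destruct (choice_of_elements (power q)) as [c Hc].
  (* Recursively take an unused element of least rank: if [x0] were never taken, all [k] values
     would have rank at most that of [x0]. *)
  set (rest := fun h y => sep q (fun x => forall z, z ∈ y -> app h z <> x)).
  set (best := fun h y => sep (rest h y) (fun x => forall x', x' ∈ rest h y -> r x ⊆ r x')).
  assert (Hrest : forall h y x, x ∈ rest h y <-> x ∈ q /\ forall z, z ∈ y -> app h z <> x).
  { intros h y x. unfold rest. now rewrite in_sep by dfn. }
  assert (dfun2 rest) by (unfold rest; dfn).
  assert (Hbest : forall h y x, x ∈ best h y <-> x ∈ rest h y /\ forall x', x' ∈ rest h y -> r x ⊆ r x').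
  { intros h y x. unfold best. now rewrite in_sep by dfn. }
  assert (dfun2 best) by (unfold best; dfn).
  destruct (wf_recursion mem k (fun y h => app c (best h y))) as (e & _ & He);
    [dfn|apply wf_on_mem|dfn|].
  exists e. intros x0 Hx0. apply NNPP. intros Hn.
  assert (Hey : forall y, y ∈ k -> app e y ∈ best e y).
  { intros y Hy. rewrite He by exact Hy.
    assert (Eb : best (lam (sep k (fun z => z ∈ y)) (app e)) y = best e y).
    { assert (Er : rest (lam (sep k (fun z => z ∈ y)) (app e)) y = rest e y).
      { assert (Ea : forall z, z ∈ y -> app (lam (sep k (fun z => z ∈ y)) (app e)) z = app e z).
        { intros z Hz. rewrite app_lam; [reflexivity|dfn|]. rewrite in_sep by dfn.
          split; [exact (ordinal_trans k y z Hko Hy Hz)|exact Hz]. }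
        apply set_ext. intros x. rewrite !Hrest. split; intros [H1 H2]; split; auto;
          intros z Hz; specialize (H2 z Hz); rewrite Ea in *; auto. }
      apply set_ext. intros x. rewrite !Hbest. now rewrite Er. }
    rewrite Eb. apply Hc.
    - rewrite in_power. intros x Hx. apply Hbest in Hx as [Hx _]. now apply Hrest in Hx.
    - assert (Hx0r : x0 ∈ rest e y).
      { apply Hrest. split; [exact Hx0|]. intros z Hz Ez. apply Hn. exists z.
        split; [exact (ordinal_trans k y z Hko Hy Hz)|exact Ez]. }
      destruct (minimal_element (repl (rest e y) r) (fun _ => True)) as (b & Hb & _ & Hbm);
        [dfn|exists (r x0); rewrite in_repl by dfn; eauto|].
      rewrite in_repl in Hb by dfn. destruct Hb as (x & Hx & ->). exists x. apply Hbest.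
      split; [exact Hx|]. intros x' Hx'.
      destruct (ordinal_subset_or (r x) (r x')) as [H1|H1]; auto.
      + apply (ordinal_mem k); auto. apply Hrk. now apply Hrest in Hx.
      + apply (ordinal_mem k); auto. apply Hrk. now apply Hrest in Hx'.
      + exfalso. apply (Hbm (r x')); auto. rewrite in_repl by dfn. eauto. }
  (* The elements of rank at most [r x0] form a set small for a measure on some [m], yet already the
     first [m] values are distinct members of it. *)
  assert (Hb : succ (r x0) ∈ k) by (apply limit_of_measurables_succ; auto).
  destruct (Hsm _ Hb) as (m & v & Hmk & _ & Hv & Hs).
  assert (Hym : forall y, y ∈ m -> y ∈ k) by (intros y Hy; exact (ordinal_trans k m y Hko Hmk Hy)).
  apply (small_no_injection m v Hv _ e Hs).
  - intros y Hy. pose proof (Hey y (Hym y Hy)) as H1. apply Hbest in H1 as [H1 H2].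
    rewrite in_sep by dfn. apply Hrest in H1 as [H1 _]. split; [exact H1|].
    apply (ordinal_subset_mem _ (r x0)).
    + exact (ordinal_mem k _ Hko Hb).
    + apply (ordinal_mem k); auto.
    + apply H2, Hrest. split; [exact Hx0|]. intros z Hz Ez. apply Hn. exists z.
      split; [exact (ordinal_trans k y z Hko (Hym y Hy) Hz)|exact Ez].
    + rewrite in_succ. auto.
  - assert (Hne : forall y z, y ∈ k -> z ∈ y -> app e z <> app e y).
    { intros y z Hy Hz. pose proof (Hey y Hy) as H1. apply Hbest in H1 as [H1 _].
      apply Hrest in H1. now apply H1. }
    intros y z Hy Hz Eq.
    destruct (ordinal_total y z) as [H1|[H1|H1]]; auto.
    + exact (ordinal_mem k y Hko (Hym y Hy)).
    + exact (ordinal_mem k z Hko (Hym z Hz)).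
    + exfalso. exact (Hne z y (Hym z Hz) H1 Eq).
    + exfalso. exact (Hne y z (Hym y Hy) H1 (eq_sym Eq)).
Qed.

Lemma ranked_prod q (r : M -> M) : dfun1 r -> ranked q r ->
  ranked (prod q k) (fun p => cup (r (pfst p)) (psnd p)).
Proof.
  intros Hr [Hrk Hsm]. pose proof limit_ordinal as Hko. split.
  - intros p Hp. rewrite in_prod in Hp. destruct Hp as (x & y & Hx & Hy & ->).
    rewrite pfst_opair, psnd_opair. apply ordinal_cup_mem; auto.
  - intros b Hb. destruct (Hsm b Hb) as (m & v & Hmk & Hbm & Hv & Hs).
    exists m, v. repeat (split; [assumption|]).
    apply (small_subset m v Hv _ (prod (sep q (fun x => r x ∈ b)) b)).
    + intros p Hp. rewrite in_sep in Hp by dfn. destruct Hp as [Hp Hpb].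
      rewrite in_prod in *. destruct Hp as (x & y & Hx & Hy & ->).
      rewrite pfst_opair, psnd_opair in Hpb.
      assert (Hbo : is_ordinal b) by exact (ordinal_mem k b Hko Hb).
      destruct (ordinal_cup_mem_inv (r x) y b) as [H1 H2]; auto; try (apply (ordinal_mem k); auto).
      exists x, y. rewrite in_sep by dfn. auto.
    + apply (small_prod m v Hv); [exact Hs|now apply (small_ordinal m v)].
Qed.

Lemma ranked_limit : ranked k (fun x => x).
Proof.
  pose proof limit_ordinal as Hko. split; [auto|].
  intros b Hb. destruct (limit_measure b Hb) as (m & v & Hmk & Hbm & Hv).
  exists m, v. repeat (split; [assumption|]).
  apply (small_subset m v Hv _ b); [|now apply (small_ordinal m v)].
  intros x Hx. rewrite in_sep in Hx by dfn. tauto.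
Qed.

Lemma ranked_small q n : n ∈ k -> (forall m v, measure m v -> n ∈ m -> small v q) ->
  ranked q (fun _ => empty).
Proof.
  intros Hn Hs. split.
  - intros x _. exact (empty_mem k limit_ordinal limit_nonempty).
  - intros b Hb. destruct (limit_measure2 n b Hn Hb) as (m & v & Hmk & Hnm & Hbm & Hv).
    exists m, v. repeat (split; [assumption|]).
    apply (small_subset m v Hv _ q); [|eauto]. intros x Hx. rewrite in_sep in Hx by dfn. tauto.
Qed.

(** * The successor cardinal of the limit *)

Section Successor.
Variable kp : M.
Hypothesis Hkp : is_successor_cardinal k kp.

(** One set coding an injection for every [g] is a parameter, which keeps the encodings built from
    these injections definable. *)
Lemma injections_into_limit : exists e, forall g, g ∈ kp ->
  (forall x, x ∈ g -> app (app e g) x ∈ k) /\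
  forall x y, x ∈ g -> y ∈ g -> app (app e g) x = app (app e g) y -> x = y.
Proof.
  destruct (choice_function kp (power (prod kp k)) (fun g f =>
    (forall x, x ∈ g -> app f x ∈ k) /\
    forall x y, x ∈ g -> y ∈ g -> app f x = app f y -> x = y)) as (e & _ & He); [dfn| |eauto].
  intros g Hg. destruct (injection_below_succ_card k kp limit_ordinal Hkp g Hg) as (f & Hf & Hinj).
  apply in_funs in Hf as [Hf Hfk]. exists f. split; [|split; auto].
  rewrite in_power. intros p Hp. rewrite Hf, in_lam in Hp by dfn. destruct Hp as (x & Hx & ->).
  rewrite in_prod. exists x, (app f x).
  split; [exact (ordinal_trans kp g x (succ_card_ordinal k kp Hkp) Hg Hx)|auto].
Qed.

(** If the [h x] were unbounded, each [g ∈ kp] would lie in some [h x] and be determined by [x]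
    together with its image in [k] under the injection of [h x]. As [prod q k] is enumerated by [k],
    this would inject [kp] into [k]. *)
Lemma succ_card_regular q (r h : M -> M) : dfun1 r -> ranked q r -> dfun1 h ->
  (forall x, x ∈ q -> h x ∈ kp) -> exists g, g ∈ kp /\ forall x, x ∈ q -> h x ⊆ g.
Proof.
  intros Hr Hq Hh Hhk. pose proof (succ_card_ordinal k kp Hkp) as Hpo.
  destruct (ranked_enumeration (prod q k) (fun p => cup (r (pfst p)) (psnd p))) as (en & Hen);
    [dfn|now apply ranked_prod|].
  destruct injections_into_limit as (e & He).
  apply NNPP. intros Hn.
  destruct (choice_function kp k (fun g y => exists x, x ∈ q /\ g ∈ h x /\
    app en y = opair x (app (app e (h x)) g))) as (f & Hf & Hfs); [dfn| |].
  - intros g Hg.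
    assert (Hx : exists x, x ∈ q /\ ~ h x ⊆ g).
    { apply NNPP. intros Hn'. apply Hn. exists g. split; [exact Hg|]. intros x Hx. apply NNPP. eauto. }
    destruct Hx as (x & Hx & Hns).
    assert (Hgx : g ∈ h x).
    { destruct (ordinal_subset_or (h x) g) as [H|H]; try (apply (ordinal_mem kp); auto); [contradiction|exact H]. }
    destruct (Hen (opair x (app (app e (h x)) g))) as (y & Hy & Ey).
    { rewrite in_prod. exists x, (app (app e (h x)) g). split; [exact Hx|]. split; [|reflexivity].
      apply He; auto. }
    exists y. split; [exact Hy|]. exists x. auto.
  - apply in_funs in Hf as [_ Hf].
    apply (no_injection_succ_card k kp Hkp (app f)); [dfn|exact Hf|].
    intros g g' Hg Hg' Eq.
    destruct (Hfs g Hg) as (x & Hx & Hgx & Ex). destruct (Hfs g' Hg') as (x' & Hx' & Hgx' & Ex').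
    rewrite Eq, Ex' in Ex. apply opair_inj in Ex as [-> Ex].
    destruct (He (h x) (Hhk x Hx)) as [_ Hinj]. apply Hinj; auto.
Qed.

Section Embedding.
Variables m u i : M.
Hypotheses (Hm : measure m u) (Hi : is_ordinal i) (Hjk : embed m u i k = k).
Notation j := (embed m u i).

(* [collapse f] injects into [embed k = k]: represent the elements of [app f s] in [k]. *)
Lemma embed_succ_card : j kp = kp.
Proof.
  pose proof (succ_card_ordinal k kp Hkp) as Hpo. pose proof limit_ordinal as Hko.
  apply subset_antisym; [|now apply embed_ge].
  intros z Hz. rewrite in_embed in Hz by auto. destruct Hz as (f & Hf & Hfk & ->).
  assert (Hzo : is_ordinal (collapse m u i f)).
  { apply collapse_ordinal; auto. eapply almost_mono; [|exact Hfk]. intros s Hs H.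
    exact (ordinal_mem kp _ Hpo H). }
  destruct (ordinal_subset_or kp _ Hpo Hzo) as [Hsub|]; [exfalso|assumption].
  destruct injections_into_limit as (e & He).
  set (code := fun g => lam (funs i m) (fun s => app (app e (app f s)) (app g s))).
  assert (Hcs : forall g s, s ∈ funs i m -> app (code g) s = app (app e (app f s)) (app g s)).
  { intros g s Hs. unfold code. now rewrite app_lam by (dfn || assumption). }
  assert (HcK : forall g, finsupp m i g -> finsupp m i (code g)).
  { intros g Hg. apply (finsupp_comp2 m i Hi f g (fun x y => app (app e x) y)); auto. dfn. }
  destruct (choice_function kp k (fun x y => exists g, finsupp m i g /\ mem_ae m u i g f /\
    collapse m u i g = x /\ y = collapse m u i (code g))) as (h & Hh & Hhs);
    [unfold code; dfn| |].
  - intros x Hx. apply Hsub in Hx. apply (in_collapse m u i Hm Hi f x Hf) in Hx as (g & Hg & HE & ->).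
    exists (collapse m u i (code g)). split; [|eauto].
    rewrite <- Hjk. apply collapse_in_embed; auto.
    eapply almost_mono; [|exact (almost_and m u i Hm _ _ Hfk HE)]. intros s Hs [H1 H2].
    rewrite Hcs by exact Hs. now apply He.
  - apply in_funs in Hh as [_ Hh].
    apply (no_injection_succ_card k kp Hkp (app h)); [dfn|exact Hh|].
    intros x y Hx Hy Eq.
    destruct (Hhs x Hx) as (g & Hg & HE & <- & E1). destruct (Hhs y Hy) as (g' & Hg' & HE' & <- & E2).
    rewrite Eq, E2 in E1. apply (collapse_inj m u i Hm Hi) in E1; auto.
    apply collapse_congr; auto.
    eapply almost_mono; [|exact (almost_and m u i Hm _ _ (almost_and m u i Hm _ _ Hfk E1)
      (almost_and m u i Hm _ _ HE HE'))].
    intros s Hs [[H1 H2] [H3 H4]]. rewrite !Hcs in H2 by exact Hs.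
    apply (He _ H1); auto.
Qed.
End Embedding.
End Successor.
End LimitOfMeasurables.

(** * Undefinability of well-orderings and injections *)

Section Main.
Context {M : set_structure} {HM : ZFC M}.
Implicit Types m u i g x y z a b q v : M.
Variables k kp : M.
Hypotheses (Hk : is_limit_of_measurables k) (Hkp : is_successor_cardinal k kp).

(** The bound [b] exceeds the sizes of finitely many transitive closures, which are therefore small
    for every measure above it and fixed together with their subsets. *)
Lemma parameters_fixed (p : nat -> M) n : exists b, b ∈ k /\ forall c, c < n -> in_H k (p c) ->
  forall m u i, measure m u -> is_ordinal i -> b ∈ m -> embed m u i (p c) = p c.
Proof.
  pose proof (limit_ordinal k Hk) as Hko.
  induction n as [|n (b & Hb & IH)].
  - exists empty. split; [exact (empty_mem k Hko (limit_nonempty k Hk))|]. intros c Hc. lia.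
  - destruct (classic (in_H k (p n))) as [(t & (Ht & Hpt & _) & d & Hd & _ & [f Hf])|Hn].
    + exists (cup b d). split; [now apply ordinal_cup_mem|].
      intros c Hc Hpc m u i Hm Hi Hbm.
      destruct (ordinal_cup_mem_inv b d m) as [H1 H2];
        [exact (ordinal_mem k b Hko Hb)|exact (ordinal_mem k d Hko Hd)|
         exact (measure_ordinal m u Hm)|exact Hbm|].
      assert (c < n \/ c = n) as [H|H] by lia; [now apply IH|subst c].
      apply (embed_fixed m u i Hm Hi t); [exact Ht| |exact Hpt].
      apply bijection_app in Hf as (B1 & B2 & _).
      apply (small_injection m u Hm t d (app f)); [dfn|exact B1|exact B2|].
      now apply (small_ordinal m u).
    + exists b. split; [exact Hb|]. intros c Hc Hpc.
      assert (c < n \/ c = n) as [H|H] by lia; [now apply IH|now subst c].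
Qed.

Lemma embed_Sigma1_relation (f : formula) n (p : nat -> M) m u i (R : M -> M -> Prop) :
  Sigma1 f -> free_vars_below (2 + n) f ->
  (forall x y, R x y <-> sat (scons x (scons y p)) f) ->
  measure m u -> is_ordinal i -> (forall c, c < n -> embed m u i (p c) = p c) ->
  forall x y, R x y -> R (embed m u i x) (embed m u i y).
Proof.
  intros Hf Hfv HR Hm Hi Hp x y Hxy. apply HR in Hxy. apply HR.
  apply (embed_Sigma1 m u i Hm Hi f _ Hf) in Hxy.
  refine (proj1 (sat_agree_below _ _ Hfv _ _ _) Hxy).
  intros [|[|c]] Hc; simpl; auto. apply Hp. lia.
Qed.

Lemma dpred2_of_formula (f : formula) (p : nat -> M) (R : M -> M -> Prop) :
  (forall x y, R x y <-> sat (scons x (scons y p)) f) -> dpred2 R.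
Proof.
  intros HR. apply (defp_iff_compat (fun e => sat (scons (e 0) (scons (e 1) p)) f)).
  - intros e. now rewrite HR.
  - apply (defp_sat f (fun c e => scons (e 0) (scons (e 1) p) c)).
    intros [|[|c]]; simpl; dfn.
Qed.

(** Taking the least candidate makes the step definable, so that it can be iterated along omega. *)
Lemma next_measurable : exists N : M -> M, dfun1 N /\
  forall y, y ∈ k -> is_measurable (N y) /\ N y ∈ k /\ y ∈ N y.
Proof.
  pose proof (limit_ordinal k Hk) as Hko.
  pose proof (@dpred1_measurable M HM) as Hdm.
  set (P := fun y z => is_measurable z /\ z ∈ k /\ y ∈ z).
  assert (HP : dpred2 P) by (unfold P; dfn).
  exists (fun y => iota (fun z => P y z /\ forall z', z' ∈ k -> z' ∈ z -> ~ P y z')).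
  split; [dfn|]. intros y Hy.
  destruct Hk as (_ & _ & Hl). destruct (Hl y Hy) as (m & Hm & Hym & Hmm).
  destruct (minimal_element k (P y)) as (z & Hz & Pz & Hmin).
  - exact (dpred2_instance P y HP).
  - exists m. unfold P. auto.
  - match goal with |- is_measurable ?t /\ _ => assert (E : t = z) end.
    { apply iota_eq; [auto|]. intros z' [Pz' Hmin'].
      destruct (ordinal_total z' z) as [H|[H|H]]; auto.
      - apply Pz'.
      - exact (ordinal_mem k z Hko Hz).
      - exfalso. apply (Hmin z'); auto. apply Pz'.
      - exfalso. apply (Hmin' z); auto. }
    rewrite E. exact Pz.
Qed.

Section Shift.
Variables w b0 : M.
Hypotheses (Hw : is_omega w) (Hb0 : b0 ∈ k) (Hwb : w ⊆ b0).

(* Shifting the [n]-th measurable of an increasing sequence onto the next one by iterating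
   its measure moves the sequence without its [n+1]-st to the sequence without its [n]-th term. *)
Lemma shifted_sequences : exists (f : M) (X : M -> M), dfun1 X /\
  (forall n, n ∈ w -> app f n ∈ k /\ is_measurable (app f n) /\ b0 ∈ app f n) /\
  (forall n, n ∈ w -> X n ⊆ k) /\
  forall n u, n ∈ w -> measure (app f n) u ->
    X (succ n) <> X n /\ embed (app f n) u (app f (succ n)) (X (succ n)) = X n.
Proof.
  pose proof (limit_ordinal k Hk) as Hko. pose proof (omega_ordinal w Hw) as Hwo.
  destruct next_measurable as (N & HN & HNs).
  destruct (omega_recursion w Hw (N b0) N HN) as (f & Hf0 & HfS).
  assert (Hf : forall n, n ∈ w -> app f n ∈ k /\ is_measurable (app f n) /\ b0 ∈ app f n).
  { apply (omega_induction w Hw (fun n => app f n ∈ k /\ is_measurable (app f n) /\ b0 ∈ app f n)).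
    - pose proof (@dpred1_measurable M HM). dfn.
    - rewrite Hf0. destruct (HNs b0 Hb0) as (H1 & H2 & H3). auto.
    - intros n Hn (IH1 & IH2 & IH3). rewrite HfS by exact Hn.
      destruct (HNs _ IH1) as (H1 & H2 & H3). split; [exact H2|split; [exact H1|]].
      exact (ordinal_trans _ _ _ (ordinal_mem k _ Hko H2) H3 IH3). }
  assert (HfSm : forall n, n ∈ w -> app f n ∈ app f (succ n)).
  { intros n Hn. rewrite HfS by exact Hn. apply HNs. now apply Hf. }
  assert (Hfo : forall n, n ∈ w -> is_ordinal (app f n)).
  { intros n Hn. apply (ordinal_mem k); auto. now apply Hf. }
  assert (Hmono : forall n, n ∈ w -> forall l, l ∈ n -> app f l ∈ app f n).
  { apply (omega_induction w Hw (fun n => forall l, l ∈ n -> app f l ∈ app f n)); [dfn| |].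
    - intros l Hl. now apply in_empty in Hl.
    - intros n Hn IH l Hl. rewrite in_succ in Hl. destruct Hl as [Hl| ->]; [|auto].
      apply (ordinal_trans _ (app f n)); auto using omega_succ. }
  assert (Hinj : forall n l, n ∈ w -> l ∈ w -> app f n = app f l -> n = l).
  { intros n l Hn Hl E.
    destruct (ordinal_total n l (ordinal_mem w n Hwo Hn) (ordinal_mem w l Hwo Hl)) as [H|[H|H]];
      [exfalso|exact H|exfalso]; apply (mem_irrefl (app f n)).
    - rewrite E at 2. auto.
    - rewrite E at 1. auto. }
  set (X := fun n => repl (sep w (fun l => l <> n)) (app f)).
  assert (HX : forall n z, z ∈ X n <-> exists l, l ∈ w /\ l <> n /\ z = app f l).
  { intros n z. unfold X. rewrite in_repl by dfn. split.
    - intros (l & Hl & ->). rewrite in_sep in Hl by dfn. exists l. tauto.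
    - intros (l & Hl & Hn & ->). exists l. rewrite in_sep by dfn. auto. }
  exists f, X. split; [unfold X; dfn|]. split; [exact Hf|]. split.
  { intros n Hn z Hz. apply HX in Hz as (l & Hl & _ & ->). now apply Hf. }
  intros n u Hn Hm. assert (HSn : succ n ∈ w) by now apply omega_succ.
  assert (Hnn : succ n <> n).
  { intros E. apply (mem_irrefl n). rewrite <- E at 2. apply in_succ. auto. }
  assert (Hno : is_ordinal n) by exact (ordinal_mem w n Hwo Hn).
  destruct (Hf n Hn) as (Hfk & Hfm & Hfb). destruct (Hf (succ n) HSn) as (HfSk & HfSms & HfSb).
  apply measurable_measure in HfSms as [v Hv].
  assert (Hi : is_ordinal (app f (succ n))) by auto.
  split.
  - intros E. assert (H : app f (succ n) ∈ X n) by (apply HX; eauto).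
    rewrite <- E in H. apply HX in H as (l & Hl & Hne & E'). apply Hne. symmetry. auto.
  (* Omega is contained in [b0], hence lies below the critical point, so this countable set is moved
     pointwise and only the images of its terms matter. *)
  - assert (Hsmall : small u (X (succ n))).
    { apply (small_image _ u Hm); [dfn|]. apply (small_subset _ u Hm _ w).
      - intros l Hl. rewrite in_sep in Hl by dfn. tauto.
      - apply (small_ordinal _ u Hm). apply (ordinal_subset_mem w b0); auto. }
    assert (J1 : forall l, l ∈ n -> embed (app f n) u (app f (succ n)) (app f l) = app f l).
    { intros l Hl. apply embed_below_crit; auto. }
    assert (J2 : embed (app f n) u (app f (succ n)) (app f n) = app f (succ n)).
    { apply (embed_crit_measurable _ _ _ Hm Hi v Hv). auto. }
    assert (J3 : forall l, l ∈ w -> succ n ∈ l -> embed (app f n) u (app f (succ n)) (app f l) = app f l).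
    { intros l Hl Hsl. destruct (Hf l Hl) as (_ & Hlm & _). apply measurable_measure in Hlm as [v' Hv'].
      apply (embed_measurable _ _ _ Hm Hi _ _ Hv'); [|auto].
      apply Hmono; [exact Hl|]. apply (ordinal_trans l (succ n)); [|exact Hsl|rewrite in_succ; auto].
      exact (ordinal_mem w l Hwo Hl). }
    assert (Hcase : forall l, l ∈ w -> l ∈ n \/ l = n \/ l = succ n \/ succ n ∈ l).
    { intros l Hl. destruct (ordinal_total (succ n) l) as [H|[H|H]]; auto using ordinal_succ.
      - exact (ordinal_mem w l Hwo Hl).
      - rewrite in_succ in H. tauto. }
    apply set_ext. intros z. rewrite in_embed_small by auto. split.
    + intros (c & Hc & ->). apply HX in Hc as (l & Hl & Hne & ->). apply HX.
      destruct (Hcase l Hl) as [H|[H|[H|H]]].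
      * exists l. rewrite J1 by exact H. split; [exact Hl|split; [|reflexivity]].
        intros ->. exact (mem_irrefl _ H).
      * subst l. exists (succ n). rewrite J2. auto.
      * contradiction.
      * exists l. rewrite J3 by assumption. split; [exact Hl|split; [|reflexivity]].
        intros ->. apply (mem_asym n (succ n)); [rewrite in_succ; auto|exact H].
    + intros Hz. apply HX in Hz as (l & Hl & Hne & ->).
      destruct (Hcase l Hl) as [H|[H|[H|H]]].
      * exists (app f l). rewrite J1 by exact H. split; [|reflexivity]. apply HX. exists l.
        split; [exact Hl|split; [|reflexivity]].
        intros ->. apply (mem_asym n (succ n)); [rewrite in_succ; auto|exact H].
      * contradiction.
      * subst l. exists (app f n). rewrite J2. split; [|reflexivity]. apply HX. exists n. auto.
      * exists (app f l). rewrite J3 by assumption. split; [|reflexivity]. apply HX. exists l.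
        split; [exact Hl|split; [|reflexivity]]. intros ->. exact (mem_irrefl _ H).
Qed.
End Shift.

Lemma no_Sigma1_well_ordering (R : M -> M -> Prop) :
  Sigma1_definable (fun p => in_H k p \/ p = k \/ p = kp) R ->
  is_well_ordering_of (fun x => x ⊆ k) R -> False.
Proof.
  intros (f & n & p & Hf & Hfv & Hp & HR) (HRk & Hirr & Htr & Htot & Hwf).
  pose proof (limit_ordinal k Hk) as Hko.
  pose proof (dpred2_of_formula f p R HR) as HRd.
  destruct (bounded_functions_above k Hk) as (b1 & Hb1 & Hbd).
  destruct (parameters_fixed p n) as (b2 & Hb2 & Hpf).
  destruct (limit_measure k Hk empty) as (m0 & v0 & Hm0 & _ & _ & (w & Hw & Hwm0) & _);
    [exact (empty_mem k Hko (limit_nonempty k Hk))|].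
  assert (Hwk : w ∈ k) by exact (ordinal_trans k m0 w Hko Hm0 Hwm0).
  assert (Hb12 : cup b1 b2 ∈ k) by now apply ordinal_cup_mem.
  (* For critical points above it: [b1] secures that [k], and with it [kp], is fixed; [b2] secures
     the parameters in [H(k)]; and [w] makes countable sets small. *)
  set (b0 := cup (cup b1 b2) w).
  assert (Hb0 : b0 ∈ k) by now apply ordinal_cup_mem.
  destruct (shifted_sequences w b0 Hw Hb0) as (s & X & HX & Hs & HXk & Hshift).
  { intros z Hz. unfold b0. rewrite in_cup. auto. }
  destruct (Hwf (repl w X)) as (x & Hx & Hmin).
  { intros x Hx. rewrite in_repl in Hx by dfn. destruct Hx as (l & Hl & ->). auto. }
  { exists (X empty). rewrite in_repl by dfn. exists empty. auto using omega_empty. }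
  rewrite in_repl in Hx by dfn. destruct Hx as (l & Hl & ->).
  assert (HlS : succ l ∈ w) by now apply omega_succ.
  destruct (Hs l Hl) as (Hmk & Hm & Hbm). apply measurable_measure in Hm as [u Hm].
  destruct (Hs (succ l) HlS) as (Hik & _ & _).
  destruct (Hshift l u Hl Hm) as [Hne Hjx].
  set (m := app s l) in *. set (i := app s (succ l)) in *.
  pose proof (measure_ordinal m u Hm) as Hmo.
  assert (Hi : is_ordinal i) by exact (ordinal_mem k i Hko Hik).
  destruct (ordinal_cup_mem_inv (cup b1 b2) w m) as [Hbm12 Hwm];
    [exact (ordinal_mem k _ Hko Hb12)|exact (omega_ordinal w Hw)|exact Hmo|exact Hbm|].
  destruct (ordinal_cup_mem_inv b1 b2 m) as [Hbm1 Hbm2];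
    [exact (ordinal_mem k _ Hko Hb1)|exact (ordinal_mem k _ Hko Hb2)|exact Hmo|exact Hbm12|].
  assert (Hjk : embed m u i k = k) by (apply embed_limit; auto).
  assert (Hjkp : embed m u i kp = kp) by (apply (embed_succ_card k Hk); auto).
  assert (HRj : forall x y, R x y -> R (embed m u i x) (embed m u i y)).
  { apply (embed_Sigma1_relation f n p); auto. intros c Hc.
    destruct (Hp c Hc) as [H|[->| ->]]; auto. }
  assert (HRx : R (embed m u i (X (succ l))) (X (succ l))).
  { rewrite Hjx. destruct (Hmin (X (succ l))) as [H|H]; [|contradiction|exact H].
    rewrite in_repl by dfn. eauto. }
  destruct (Hwf (sep (power k) (fun z => R (embed m u i z) z))) as (z & Hz & Hzmin).
  { intros z Hz. rewrite in_sep, in_power in Hz by dfn. tauto. }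
  { exists (X (succ l)). rewrite in_sep, in_power by dfn. auto. }
  rewrite in_sep, in_power in Hz by dfn. destruct Hz as [Hzk HRz].
  (* [R] relates only subsets of [k], so the image of [z] belongs, by [HRj], to the same set in
     which [z] is least. *)
  assert (Hjz : embed m u i z ⊆ k) by now apply HRk in HRz.
  destruct (Hzmin (embed m u i z)) as [E|HRz'].
  - rewrite in_sep, in_power by dfn. auto.
  - rewrite E in HRz. exact (Hirr z Hzk HRz).
  - exact (Hirr z Hzk (Htr z _ z Hzk Hjz Hzk HRz' HRz)).
Qed.

Section FixedPoints.
Variables m u w : M.
Hypotheses (Hm : measure m u) (Hmk : m ∈ k) (Hw : is_omega w) (Hwm : w ∈ m).
Hypothesis Hbd : forall i, i ∈ k -> bounded_functions k m u i.

(** [N y] bounds the images of [y] under all [k] embeddings, and lies below [kp] by regularity. Let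
    [g] be the union of the iterates of [N]. A function into [g] chooses a stage of the iteration;
    omega is small, so the stage is almost constantly some [n], and the represented ordinal lies
    below stage [succ n]. *)
Lemma common_fixed_points b : b ∈ kp -> exists g, g ∈ kp /\ b ∈ g /\
  forall i, i ∈ k -> embed m u i g = g.
Proof.
  intros Hb. pose proof (limit_ordinal k Hk) as Hko. pose proof (succ_card_ordinal k kp Hkp) as Hpo.
  assert (Hio : forall i, i ∈ k -> is_ordinal i) by (intros i; exact (ordinal_mem k i Hko)).
  assert (Hjkp : forall i, i ∈ k -> embed m u i kp = kp).
  { intros i Hi. apply (embed_succ_card k Hk); auto. apply embed_limit; auto. }
  set (P := fun y z => forall i, i ∈ k -> embed m u i y ⊆ z).
  assert (HP : dpred2 P) by (unfold P; dfn).
  set (N := fun y => iota (fun z => (z ∈ kp /\ P y z) /\ forall z', z' ∈ kp -> z' ∈ z -> ~ P y z')).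
  assert (HN : dfun1 N) by (unfold N; dfn).
  assert (HNs : forall y, y ∈ kp -> N y ∈ kp /\ P y (N y)).
  { intros y Hy.
    destruct (succ_card_regular k Hk kp Hkp k (fun x => x) (fun i => embed m u i y)) as (g0 & Hg0 & Hg0s);
      [dfn|now apply ranked_limit|dfn| |].
    { intros i Hi. rewrite <- (Hjkp i Hi). apply embed_mem; auto. }
    destruct (minimal_element kp (P y)) as (z & Hz & Pz & Hmin).
    - exact (dpred2_instance P y HP).
    - exists g0. auto.
    - assert (E : N y = z); [|rewrite E; auto].
      apply iota_eq; [auto|]. intros z' [[Hz' Pz'] Hmin'].
      destruct (ordinal_total z' z) as [H|[H|H]]; auto.
      + exact (ordinal_mem kp z' Hpo Hz').
      + exact (ordinal_mem kp z Hpo Hz).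
      + exfalso. exact (Hmin z' Hz' H Pz').
      + exfalso. exact (Hmin' z Hz H Pz). }
  (* Starting at [succ b] puts [b] into the union. *)
  destruct (omega_recursion w Hw (succ b) N HN) as (q & Hq0 & HqS).
  assert (Hq : forall n, n ∈ w -> app q n ∈ kp).
  { apply (omega_induction w Hw (fun n => app q n ∈ kp)); [dfn| |].
    - rewrite Hq0. apply (succ_card_limit k kp Hko Hkp); auto.
      + intros y. now apply limit_of_measurables_succ.
      + now apply limit_nonempty.
    - intros n Hn IH. rewrite HqS by exact Hn. now apply HNs. }
  destruct (succ_card_regular k Hk kp Hkp w (fun _ => empty) (app q)) as (g0 & Hg0 & Hg0s);
    [dfn| |dfn|exact Hq|].
  { apply (ranked_small k Hk w w); [exact (ordinal_trans k m w Hko Hmk Hwm)|].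
    intros m' v Hv Hwm'. now apply (small_ordinal m' v). }
  set (g := union (repl w (app q))).
  assert (Hg : forall z, z ∈ g <-> exists n, n ∈ w /\ z ∈ app q n).
  { intros z. unfold g. rewrite in_union. split.
    - intros (y & Hy & Hz). rewrite in_repl in Hy by dfn. destruct Hy as (n & Hn & ->). eauto.
    - intros (n & Hn & Hz). exists (app q n). rewrite in_repl by dfn. eauto. }
  assert (Hgo : is_ordinal g).
  { apply ordinal_union. intros y Hy. rewrite in_repl in Hy by dfn. destruct Hy as (n & Hn & ->).
    apply (ordinal_mem kp); auto. }
  exists g. split; [|split].
  - apply (ordinal_subset_mem g g0); auto. intros z Hz. apply Hg in Hz as (n & Hn & Hz).
    exact (Hg0s n Hn z Hz).
  - apply Hg. exists empty. rewrite Hq0, in_succ. auto using omega_empty.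
  - intros i Hi. apply subset_antisym; [|now apply embed_ge; auto].
    intros z Hz. rewrite in_embed in Hz by auto. destruct Hz as (f & Hf & Hfg & ->).
    destruct (almost_choose m u i (Hio i Hi) (lam (funs i m) (fun s => sep w (fun n => app f s ∈ app q n))))
      as (h & Hh & Hhs).
    + apply (finsupp_comp m i (Hio i Hi) f (fun y => sep w (fun n => y ∈ app q n))); [exact Hf|dfn].
    + eapply almost_mono; [|exact Hfg]. intros s Hs Hfs. cbv beta in Hfs.
      rewrite app_lam by (dfn || assumption). apply Hg in Hfs as (n & Hn & Hfs).
      exists n. rewrite in_sep by dfn. auto.
    + assert (Hhs' : almost m u i (fun s => app h s ∈ w /\ app f s ∈ app q (app h s))).
      { eapply almost_mono; [|exact Hhs]. intros s Hs H. cbv beta in H.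
        rewrite app_lam in H by (dfn || assumption). now rewrite in_sep in H by dfn. }
      destruct (almost_constant m u i Hm (Hio i Hi) h w) as (n & Hn & Hhn);
        [now apply (small_ordinal m u)|exact Hh| |].
      { eapply almost_mono; [|exact Hhs']. simpl. tauto. }
      apply Hg. exists (succ n). split; [now apply omega_succ|]. rewrite HqS by exact Hn.
      apply (proj2 (HNs (app q n) (Hq n Hn)) i Hi). apply collapse_in_embed; auto.
      eapply almost_mono; [|exact (almost_and m u i Hm _ _ Hhs' Hhn)].
      intros s Hs [[_ H1] H2]. now rewrite H2 in H1.
Qed.
End FixedPoints.

Lemma no_Sigma1_injection (F : M -> M -> Prop) :
  Sigma1_definable (fun p => in_H k p \/ p = k) F ->
  is_injection_from_into (fun a => a ∈ kp) (fun x => x ⊆ k) F -> False.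
Proof.
  intros (f & n & p & Hf & Hfv & Hp & HF) (HFk & Htot & Hinj).
  pose proof (limit_ordinal k Hk) as Hko. pose proof (succ_card_ordinal k kp Hkp) as Hpo.
  pose proof (dpred2_of_formula f p F HF) as HFd.
  destruct (bounded_functions_above k Hk) as (b1 & Hb1 & Hbd).
  destruct (parameters_fixed p n) as (b2 & Hb2 & Hpf).
  destruct (limit_measure2 k Hk b1 b2 Hb1 Hb2) as (m & u & Hmk & Hbm1 & Hbm2 & Hm).
  pose proof Hm as (_ & (w & Hw & Hwm) & _).
  pose proof (measure_ordinal m u Hm) as Hmo.
  assert (Hbdi : forall i, i ∈ k -> bounded_functions k m u i) by auto.
  assert (Hio : forall i, i ∈ k -> is_ordinal i) by (intros i; exact (ordinal_mem k i Hko)).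
  assert (HFj : forall i, i ∈ k -> forall x y, F x y -> F (embed m u i x) (embed m u i y)).
  { intros i Hi. apply (embed_Sigma1_relation f n p); auto. intros c Hc.
    destruct (Hp c Hc) as [H| ->]; auto. apply embed_limit; auto. }
  set (val := fun g => iota (F g)).
  assert (Hvd : dfun1 val) by (unfold val; dfn).
  assert (Hval : forall g, g ∈ kp -> F g (val g)).
  { intros g Hg. destruct (Htot g Hg) as (y & Hy & Hu). unfold val.
    rewrite (iota_eq (F g) y); auto. intros y' Hy'. symmetry. auto. }
  set (S := sep kp (fun g => forall i, i ∈ k -> embed m u i g = g)).
  assert (HS : forall g, g ∈ S <-> g ∈ kp /\ forall i, i ∈ k -> embed m u i g = g).
  { intros g. unfold S. now rewrite in_sep by dfn. }
  assert (Hfix : forall g i, g ∈ S -> i ∈ k -> embed m u i (val g) = val g).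
  { intros g i Hg Hi. apply HS in Hg as [Hg Hgf].
    pose proof (HFj i Hi _ _ (Hval g Hg)) as H. rewrite Hgf in H by exact Hi.
    destruct (Htot g Hg) as (y & _ & Hu). rewrite <- (Hu _ H). apply Hu. auto. }
  set (trace := fun g => sep (val g) (fun x => x ∈ m)).
  assert (Htr : forall g x, x ∈ trace g <-> x ∈ val g /\ x ∈ m).
  { intros g x. unfold trace. now rewrite in_sep by dfn. }
  assert (Htd : dfun1 trace) by (unfold trace; dfn).
  (* [d ∈ k] lies below the image of [m] under the iteration of length [d + 1]. *)
  assert (Hsub : forall g g', g ∈ S -> g' ∈ S -> trace g = trace g' -> val g ⊆ val g').
  { intros g g' Hg Hg' E d Hd.
    assert (Hdk : d ∈ k).
    { apply HS in Hg as [Hg _]. destruct (HFk _ _ (Hval g Hg)) as [_ H]. auto. }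
    assert (Hi : succ d ∈ k) by now apply limit_of_measurables_succ.
    assert (Hdi : d ∈ succ d) by (rewrite in_succ; auto).
    revert Hi Hdi. generalize (succ d). intros i Hi Hdi.
    pose proof (Hio _ Hi) as Hio'.
    assert (Hdm : d ∈ embed m u i m) by exact (length_subset_embed_crit m u i Hm Hio' d Hdi).
    (* As [val g] is fixed, [d] is represented by a function [h] with values almost everywhere in
       [val g] and in [m], that is, in the common trace. Hence its values are in [val g'], which is
       fixed as well. *)
    rewrite <- (Hfix g i Hg Hi) in Hd. rewrite in_embed in Hd by auto.
    destruct Hd as (h & Hh & Hhv & ->).
    rewrite collapse_in_embed in Hdm by auto.
    rewrite <- (Hfix g' _ Hg' Hi). apply collapse_in_embed; auto.
    eapply almost_mono; [|exact (almost_and m u _ Hm _ _ Hhv Hdm)].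
    intros s _ H. apply Htr in H. rewrite E in H. now apply Htr in H. }
  assert (Hinj' : forall g g', g ∈ S -> g' ∈ S -> trace g = trace g' -> g = g').
  { intros g g' Hg Hg' E.
    assert (Ev : val g = val g') by (apply subset_antisym; apply Hsub; auto).
    apply HS in Hg as [Hg _]. apply HS in Hg' as [Hg' _].
    apply (Hinj g g' (val g)); [auto|]. rewrite Ev. auto. }
  (* Each [g ∈ S] is recovered from its trace, so [S] is covered by a function on [power m] and is
     bounded by some [b]. Subsets of [m] that are no trace are sent to the default [empty], an
     element of [kp]. A common fixed point above [b] then contradicts the bound. *)
  destruct (succ_card_regular k Hk kp Hkp (power m) (fun _ => empty)
    (fun a => iota (fun g => g ∈ S /\ trace g = a))) as (b & Hb & Hbs); [dfn| |dfn| |].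
  - apply (ranked_small k Hk _ m Hmk). intros m' v Hv Hmm'.
    apply (small_power m' v Hv). now apply (small_ordinal m' v).
  - intros a _. destruct (iota_spec (fun g => g ∈ S /\ trace g = a)) as [[[H _] _]|[_ ->]].
    + now apply HS in H.
    + apply empty_mem; [exact Hpo|]. exists k. exact (proj1 (proj2 Hkp)).
  - destruct (common_fixed_points m u w Hm Hmk Hw Hwm Hbdi b Hb) as (g & Hg & Hbg & Hgf).
    assert (HgS : g ∈ S) by (apply HS; auto).
    assert (E : iota (fun g' => g' ∈ S /\ trace g' = trace g) = g).
    { apply iota_eq; [auto|]. intros g' [H1 H2]. auto. }
    apply (mem_irrefl b). specialize (Hbs (trace g)). cbv beta in Hbs. rewrite E in Hbs.
    apply Hbs; [|exact Hbg]. rewrite in_power. intros x Hx. now apply Htr in Hx.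
Qed.

End Main.

Theorem corollary7p4 (M : set_structure) (HM : ZFC M) (k kp : M)
    (Hk : is_limit_of_measurables k) (Hkp : is_successor_cardinal k kp) :
  (~ exists R : M -> M -> Prop,
       Sigma1_definable (fun p => in_H k p \/ p = k \/ p = kp) R /\
       is_well_ordering_of (fun x => x ⊆ k) R) /\
  (uncountable_cofinality k ->
   ~ exists F : M -> M -> Prop,
       Sigma1_definable (fun p => in_H k p \/ p = k) F /\
       is_injection_from_into (fun a => a ∈ kp) (fun x => x ⊆ k) F).
Proof.
  split.
  - intros (R & HR & HW). exact (no_Sigma1_well_ordering k kp Hk Hkp R HR HW).
  - intros _ (F & HF & HI). exact (no_Sigma1_injection k kp Hk Hkp F HF HI).
Qed.
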